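(* Let $s\in(0,1]$, $T>0$, $\varepsilon>0$, $\mu\in\mathbb{R}$, $p\in(1,\infty)$, and let $u\in\mathcal{H}_p^\mu(Q_T)$ with $u(0)\in H_p^{\mu-2s/p+\varepsilon}(\mathbb{T}^d)$. If $\beta$ is such that $$\frac sp<\beta<s,$$ then $u\in C^{\frac\beta s-\frac1p}([0,T];H_p^{\mu-2\beta}(\mathbb{T}^d))$. In particular, there exists $C>0$, depending on $d,p,\beta,s,T,\varepsilon$, such that for all $0\le t,\tau\le T$ $$\|u(\cdot,t)-u(\cdot,\tau)\|_{\mu-2\beta,p}^p\le C|t-\tau|^{\frac\beta sp-1}\big(\|u\|_{\mathcal{H}_p^\mu(Q_T)}^p+\|u(0)\|_{\mu-2s/p+\varepsilon,p}^p\big).$$ Hence $$\|u\|_{C^{\frac\beta s-\frac1p}([0,T];H_p^{\mu-2\beta}(\mathbb{T}^d))}\le C\big(\|u\|_{\mathcal{H}_p^\mu(Q_T)}+\|u(0)\|_{\mu-2s/p+\varepsilon,p}\big).$$ The constant $C$ remains bounded for bounded values of $T$.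
   Context: $\mathbb{T}^d=\mathbb{R}^d/\mathbb{Z}^d$, $Q_T=\mathbb{T}^d\times(0,T)$. For $\mu\in\mathbb{R}$, $p\in(1,\infty)$, $H_p^\mu(\mathbb{T}^d)$ is the space of distributions $u$ on $\mathbb{T}^d$ with $\|u\|_{\mu,p}:=\|(I-\Delta)^{\mu/2}u\|_{L^p(\mathbb{T}^d)}<\infty$, where $(I-\Delta)^{\mu/2}u=\sum_{k\in\mathbb{Z}^d}(1+4\pi^2|k|^2)^{\mu/2}\hat u(k)e^{2\pi ik\cdot x}$. $\mathbb{H}_p^\mu(Q_T)=L^p(0,T;H_p^\mu(\mathbb{T}^d))$. $\mathcal{H}_p^\mu(Q_T)$ (depending on $s$) is the space of $u\in\mathbb{H}_p^\mu(Q_T)$ with $\partial_tu\in\mathbb{H}_p^{\mu-2s}(Q_T)$, with norm $\|u\|_{\mathcal{H}_p^\mu(Q_T)}=\|u\|_{\mathbb{H}_p^\mu(Q_T)}+\|\partial_tu\|_{\mathbb{H}_p^{\mu-2s}(Q_T)}$. Such $u$ has a representative continuous in time with values in $H_p^{\mu-2s}(\mathbb{T}^d)$, which gives meaning to $u(t)$ and $u(0)$. For a Banach space $X$ and $\beta\in(0,1)$, $\|u\|_{C^\beta([0,T];X)}=\sup_t\|u(t)\|_X+\sup_{t\neq\tau}\|u(t)-u(\tau)\|_X/|t-\tau|^\beta$. *)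

(* Defs.v *)
From HB Require Import structures.
From mathcomp Require Import all_boot all_order all_algebra.
From mathcomp Require Import all_classical all_reals all_analysis.
From mathcomp.real_closed Require Import complex.

Set Implicit Arguments.
Unset Strict Implicit.
Unset Printing Implicit Defensive.

Import Order.TTheory GRing.Theory Num.Theory.
Import numFieldNormedType.Exports.

Local Open Scope classical_set_scope.
Local Open Scope complex_scope.
Local Open Scope ring_scope.

(* [torus_measure d] is Lebesgue measure on the unit cube of R^d, i.e. the
   normalized Haar measure of T^d = R^d / Z^d, as a d-fold product. *)
Section torus_measure.
Context {R : realType}.
Local Notation cube n := (n.-tuple (measurableTypeR R)).

Section cube_step.
Context {n : nat} (P : probability (cube n) R).

Definition cube_prod := (uniform_prob (@ltr01 R) \x P)%E.

HB.instance Definition _ := Measure.on cube_prod.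

Let cube_prod_setT : cube_prod setT = 1%E.
Proof.
rewrite /cube_prod -setXTT [LHS]product_measure1E//.
rewrite [X in (_ * X)%E](@probability_setT _ _ _ P) mule1.
exact: (@probability_setT _ _ _ (uniform_prob (@ltr01 R))).
Qed.

HB.instance Definition _ :=
  Measure_isProbability.Build _ _ _ cube_prod cube_prod_setT.

Definition cube_cons (z : measurableTypeR R * cube n) : cube n.+1 :=
  [tuple of z.1 :: z.2].

Let measurable_cube_cons : measurable_fun setT cube_cons.
Proof. exact: measurable_cons. Qed.

HB.instance Definition _ :=
  isMeasurableFun.Build _ _ _ _ cube_cons measurable_cube_cons.

Definition cube_step : probability (cube n.+1) R :=
  distribution cube_prod cube_cons.

End cube_step.

Fixpoint torus_measure (n : nat) : probability (cube n) R :=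
  match n with
  | 0 => dirac ([tuple] : cube 0)
  | m.+1 => cube_step (torus_measure m)
  end.

End torus_measure.

Definition Cintegral {R : realType} {disp} {X : measurableType disp}
    (m : {measure set X -> \bar R}) (D : set X) (f : X -> R[i]) : R[i] :=
  (\int[m]_(x in D) complex.Re (f x)) +i* (\int[m]_(x in D) complex.Im (f x)).

(* Functions on T^d are 1-periodic functions on R^d = 'rV[R]_d; functions of
   L^p(T^d) are functions on d-tuples, seen modulo [torus_measure d]. *)
Section distributions.
Context {R : realType} {d : nat}.

Implicit Types phi psi : 'rV[R]_d -> R.

Definition partials (a : seq 'I_d) phi : 'rV[R]_d -> R :=
  foldr (fun i g x => 'D_(delta_mx 0 i) g x) phi a.

(* Real-valued elements of C^oo(T^d). *)
Definition test_function phi :=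
  (forall x (i : 'I_d), phi (x + delta_mx 0 i) = phi x) /\
  forall a, continuous (partials a phi) /\
    forall x (i : 'I_d), derivable (partials a phi) x (delta_mx 0 i).

(* A complex distribution on T^d is given by its restriction to real test
   functions, which is R-linear; the value at phi1 + i phi2 is then
   u phi1 + i * u phi2. The values of u outside the test functions are
   irrelevant: [distr_eq] is equality of distributions. *)
Definition functional := ('rV[R]_d -> R) -> R[i].

Definition is_distribution (u : functional) :=
  (forall (c : R) phi psi, test_function phi -> test_function psi ->
     u (fun x => c * phi x + psi x) = c%:C * u phi + u psi) /\
  exists (N : nat) (C : R), forall phi (M : R), test_function phi ->
    (forall a x, (size a <= N)%N -> `|partials a phi x| <= M) ->
    Normc.normc (u phi) <= C * M.

Definition distr_eq (u v : functional) :=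
  forall phi, test_function phi -> u phi = v phi.

Definition dotk (k : 'rV[int]_d) (x : 'rV[R]_d) : R :=
  \sum_(i < d) (k 0 i)%:~R * x 0 i.

(* \hat u(k) = <u, exp (- 2 i pi k.x)> *)
Definition fourier (u : functional) (k : 'rV[int]_d) : R[i] :=
  u (fun x => cos (2 * pi * dotk k x)) -
  (0 +i* 1) * u (fun x => sin (2 * pi * dotk k x)).

Definition distr_of_fun (f : d.-tuple (measurableTypeR R) -> R[i]) : functional :=
  fun phi => Cintegral (torus_measure d) setT
    (fun x => f x * (phi (\row_i tnth x i))%:C).

Definition bessel_symbol (mu : R) (k : 'rV[int]_d) : R :=
  (1 + 4 * pi ^+ 2 * \sum_(i < d) (k 0 i)%:~R ^+ 2) `^ (mu / 2).

(* v = (I - Delta)^(mu/2) u, i.e. v is the distribution given by the series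
   \sum_k (1 + 4 pi^2 |k|^2)^(mu/2) \hat u(k) exp (2 i pi k.x). *)
Definition is_bessel (mu : R) (u v : functional) :=
  forall k, fourier v k = (bessel_symbol mu k)%:C * fourier u k.

Definition torus_Lnorm (p : R) (f : d.-tuple (measurableTypeR R) -> R[i]) : \bar R :=
  'N[torus_measure d]_(p%:E)[(fun x => (Normc.normc (f x))%:E)].

Definition torus_Lp (p : R) (f : d.-tuple (measurableTypeR R) -> R[i]) :=
  [/\ measurable_fun setT (fun x => complex.Re (f x)),
      measurable_fun setT (fun x => complex.Im (f x)) &
      (torus_Lnorm p f < +oo)%E].

(* The infimum is over the (at most one) class of functions f of L^p(T^d)
   equal to (I - Delta)^(mu/2) u; it is +oo if there is none. *)
Definition bessel_norm (mu p : R) (u : functional) : \bar R :=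
  ereal_inf [set torus_Lnorm p f |
    f in [set f | torus_Lp p f /\ is_bessel mu u (distr_of_fun f)]].

Definition bessel_space (mu p : R) : set functional :=
  [set u | is_distribution u /\ (bessel_norm mu p u < +oo)%E].

End distributions.

Arguments functional : clear implicits.

Section parabolic_spaces.
Context {R : realType} {d : nat}.

Implicit Types u v w : R -> functional R d.

Definition simple_fun (mu p : R) u :=
  exists (m : nat) (A : 'I_m -> set R) (h : 'I_m -> functional R d),
    [/\ forall i, measurable (A i), forall i, bessel_space mu p (h i) &
        forall t, u t = fun phi => \sum_(i < m) (\1_(A i) t)%:C * h i phi].

Definition strongly_measurable (T mu p : R) u :=
  (forall t, t \in `]0, T[ -> bessel_space mu p (u t)) /\
  exists2 u_ : nat -> R -> functional R d,
    forall n, simple_fun mu p (u_ n) &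
    forall t, t \in `]0, T[ ->
      (fun n => bessel_norm mu p (u_ n t - u t)) @ \oo --> 0%E.

Definition bochner_norm (T mu p : R) u : \bar R :=
  ((\int[lebesgue_measure]_(t in `]0%R, T[) bessel_norm mu p (u t) `^ p)
     `^ p^-1)%E.

(* Representatives of the elements of L^p(0, T; H_p^mu(T^d)). As usual each
   class has a representative which is a limit of simple functions at every
   (and not only almost every) time. *)
Definition bochner_space (T mu p : R) : set (R -> functional R d) :=
  [set u | strongly_measurable T mu p u /\ (bochner_norm T mu p u < +oo)%E].

(* C_c^oo(0, T) *)
Definition time_test_function (T : R) (eta : R -> R) :=
  (forall n t, derivable (eta^`(n))%classic t 1) /\
  exists a b, [/\ 0 < a, b < T & forall t, t \notin `[a, b] -> eta t = 0].

(* v is the distributional derivative of u with respect to t in Q_T. *)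
Definition is_time_derivative (T : R) u v :=
  forall eta phi, time_test_function T eta -> test_function phi ->
    Cintegral lebesgue_measure `]0, T[ (fun t => (eta^`()%classic t)%:C * u t phi) =
    - Cintegral lebesgue_measure `]0, T[ (fun t => (eta t)%:C * v t phi).

Definition calH_space (s T mu p : R) : set (R -> functional R d) :=
  [set u | bochner_space T mu p u /\
    exists2 v, bochner_space T (mu - 2 * s) p v & is_time_derivative T u v].

Definition dt (s T mu p : R) u : R -> functional R d :=
  xget (fun=> 0) [set v | bochner_space T (mu - 2 * s) p v /\
                          is_time_derivative T u v].

Definition calH_norm (s T mu p : R) u : \bar R :=
  (bochner_norm T mu p u + bochner_norm T (mu - 2 * s) p (dt s T mu p u))%E.

(* w is the representative of u in C([0, T]; H_p^(mu - 2 s)(T^d)). *)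
Definition continuous_representative (s T mu p : R) u w :=
  [/\ {ae lebesgue_measure, forall t, t \in `]0, T[ -> distr_eq (w t) (u t)},
      forall t, t \in `[0, T] -> bessel_space (mu - 2 * s) p (w t) &
      forall t, t \in `[0, T] ->
        (fun r => bessel_norm (mu - 2 * s) p (w r - w t))
          @ within `[0, T] (nbhs t) --> 0%E].

Definition holder_norm (alpha T mu p : R) w : \bar R :=
  let pairs := [set z : R * R |
    [/\ z.1 \in `[0, T], z.2 \in `[0, T] & z.1 != z.2]] in
  (ereal_sup [set bessel_norm mu p (w t) | t in `[0%R, T]] +
   ereal_sup [set bessel_norm mu p (w z.1 - w z.2)%R *
                  ((`|z.1 - z.2| `^ alpha)^-1)%R%:E | z in pairs])%E.

Definition holder_space (alpha T mu p : R) : set (R -> functional R d) :=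
  [set w | (forall t, t \in `[0, T] -> bessel_space mu p (w t)) /\
           (holder_norm alpha T mu p w < +oo)%E].

End parabolic_spaces.

(* Main.v *)
(* A real L^p function on the torus is described by its coefficients against
   cosines and sines. Convolution with a probability measure contracts L^p; for
   the law of a Gaussian vector with independent Gamma distributed variance it
   multiplies the k-th coefficients by (1 + 4 pi^2 lam |k|^2)^(-al). Together
   with the binomial series of (1 - x)^g, this yields a moment inequality: with
   b = 1 + 4 pi^2 |k|^2 and 0 <= g <= s <= 1,
     |(rho b)^g a| <= 2 |a| + 4 |(rho b)^s a|     for every rho > 0.

   Let J' be one half of an interval J of length l in [0, T]. The difference of
   smooth averages of u over J' and J has the form int eta' u = - int eta u_t,
   hence, by Hoelder in time, is O(l^(-1/p)) in H_p^mu and O(l^(1 - 1/p)) in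
   H_p^(mu - 2s). The moment inequality with rho = l^(1/s) and g = s - beta
   turns this into O(l^(beta/s - 1/p)) in H_p^(mu - 2 beta), which is summable
   along intervals l = 2^(-k) |t - tau| shrinking to t or to tau, both sequences
   starting from [t, tau]. The bound of u(t) itself then follows from that of
   u(0), because mu - 2 beta < mu - 2s/p + eps. *)
Require Import Defs.
From HB Require Import structures.
From mathcomp Require Import all_boot all_order all_algebra.
From mathcomp Require Import all_classical all_reals all_analysis.
From mathcomp.real_closed Require Import complex.
From mathcomp Require Import measurable_realfun lebesgue_integral_under normal_distribution.
From mathcomp Require Import ring lra.

Set Implicit Arguments.
Unset Strict Implicit.
Unset Printing Implicit Defensive.

Import Order.TTheory GRing.Theory Num.Theory.
Import numFieldNormedType.Exports.

Local Open Scope classical_set_scope.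
Local Open Scope ring_scope.

(** * Gaussian integrals *)

(** Every multiplier bound is obtained by averaging translations or by summing an absolutely
    convergent series of such averages, so it is a triangle inequality, valid for all p at once and
    uniform in the scale rho. This is why the moment inequality is built from the powers of q = 1 /
    (1 + rho b) and of 1 - q instead of from imaginary powers or singular integrals. Functions on
    the torus are handled through their coefficients: the relation between u and u_t then holds
    coefficient by coefficient, fractional powers are products by positive numbers, and limits in
    L^p reduce to limits of numbers and one completeness argument, [riesz_fischer]. Real and
    imaginary parts are treated separately. Test functions in time must have compact support in ]0,
    T[, and the points 0 and T must be reached too. All the averages therefore live on subintervals
    of [t, tau] and no extension of u in time is made; the length T enters only when u(t) is
    compared with u(0). *)

Section density_prob.
Context {R : realType}.
Local Notation mu := (@lebesgue_measure R).
Variable h : R -> R.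
Hypothesis h0 : forall x, 0 <= h x.
Hypothesis mh : measurable_fun setT h.
Hypothesis h1 : (\int[mu]_x (h x)%:E = 1)%E.

(** The three proofs are arguments of the constant so that the measure and probability instances
    below, which depend on them, can be inferred from the term alone. *)
Definition density_prob (_ : forall x, 0 <= h x) (_ : measurable_fun setT h)
    (_ : (\int[mu]_x (h x)%:E = 1)%E) (V : set (measurableTypeR R)) : \bar R :=
  (\int[mu]_(x in V) (h x)%:E)%E.

Local Notation nu := (density_prob h0 mh h1).

Let nu_set0 : nu set0 = 0%E.
Proof. by rewrite /density_prob integral_set0. Qed.

Let nu_ge0 A : (0 <= nu A)%E.
Proof. by apply: integral_ge0 => x _; rewrite lee_fin. Qed.

Let nu_additive : semi_sigma_additive nu.
Proof.
move=> /= F mF tF mUF; rewrite /density_prob; apply: cvg_toP.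
  apply: ereal_nondecreasing_is_cvgn => m n mn.
  by apply: lee_sum_nneg_natr => // k _ _; apply: nu_ge0.
rewrite ge0_integral_bigcup//=.
  by apply/measurable_EFinP; exact: measurable_funTS.
by move=> x _; rewrite lee_fin.
Qed.

HB.instance Definition _ := isMeasure.Build _ _ _ nu nu_set0 nu_ge0 nu_additive.

Let nu_setT : nu setT = 1%E. Proof. exact: h1. Qed.

HB.instance Definition _ := @Measure_isProbability.Build _ _ R nu nu_setT.

Import HBNNSimple.

(** Both sides are limits of the integrals of the same increasing simple functions, which reduces
    the claim to indicators of measurable sets, where it is the definition of [nu]. *)
Lemma ge0_integral_density_prob (f : measurableTypeR R -> \bar R) :
  (forall x, 0 <= f x)%E -> measurable_fun [set: measurableTypeR R] f ->
  (\int[nu]_x f x = \int[mu]_x (f x * (h x)%:E))%E.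
Proof.
move=> f0 mf; pose g := nnsfun_approx measurableT mf.
have -> : (\int[nu]_x f x = lim (\int[nu]_x (EFin \o g n) x @[n --> \oo]))%E.
  have fE x : f x = lim ((EFin \o g n) x @[n --> \oo]).
    by apply/esym/cvg_lim => //; exact: cvg_nnsfun_approx.
  under eq_integral do rewrite fE.
  apply: monotone_convergence => //.
  - by move=> n; exact/measurable_EFinP.
  - by move=> n x _ /=; rewrite lee_fin.
  - by move=> x _ a b ab; rewrite lee_fin; exact/lefP/nd_nnsfun_approx.
have -> : (\int[mu]_x (f x * (h x)%:E) =
    lim (\int[mu]_x ((EFin \o g n) x * (h x)%:E) @[n --> \oo]))%E.
  have fE x : (f x * (h x)%:E = lim ((EFin \o g n) x * (h x)%:E @[n --> \oo]))%E.
    by apply/esym/cvg_lim => //; apply: cvgeZr => //; exact: cvg_nnsfun_approx.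
  under eq_integral do rewrite fE.
  apply: monotone_convergence => //.
  - by move=> n; apply: emeasurable_funM; exact/measurable_EFinP.
  - by move=> n x _ /=; rewrite mule_ge0 ?lee_fin.
  - move=> x _ a b ab; rewrite lee_wpmul2r ?lee_fin//.
    exact/lefP/nd_nnsfun_approx.
congr (lim _); apply: congr2 => //; apply/funext => n.
transitivity (\int[nu]_x (\sum_(y \in range (g n))
    (y * \1_(g n @^-1` [set y]) x)%:E))%E.
  by apply: eq_integral => t tE; rewrite /= fimfunE -fsumEFin.
have mind r : measurable_fun setT (fun x => (r * \1_(g n @^-1` [set r]) x)%:E).
  by apply/measurable_EFinP; exact: measurable_funM.
rewrite ge0_integral_fsum//; last by move=> y x _; exact: nnfun_muleindic_ge0.
transitivity (\int[mu]_x (\sum_(y \in range (g n))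
    (y * \1_(g n @^-1` [set y]) x)%:E * (h x)%:E))%E; last first.
  apply: eq_integral => x _; rewrite -ge0_mule_fsuml => [|y]; last first.
    exact: nnfun_muleindic_ge0.
  by rewrite fsumEFin // -(fimfunE _ x).
rewrite ge0_integral_fsum//; last 2 first.
  - by move=> y; apply: emeasurable_funM => //; exact/measurable_EFinP.
  - by move=> y x _; apply: mule_ge0; [exact: nnfun_muleindic_ge0|rewrite lee_fin].
apply: eq_fsbigr => r rhn.
under eq_integral do rewrite EFinM.
rewrite integralZl_indic_nnsfun //.
under [RHS]eq_integral do rewrite EFinM -muleA.
rewrite ge0_integralZl//.
- rewrite integral_indic// setIT; congr *%E.
  under eq_integral do rewrite muleC.
  rewrite (eq_integral ((EFin \o h) \_ (g n @^-1` [set r]))%E); last first.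
    by move=> x xE; rewrite epatch_indic.
  by rewrite -integral_mkcond.
- by apply: emeasurable_funM; exact/measurable_EFinP.
- by move=> t Et; rewrite mule_ge0 ?lee_fin.
- by move: rhn; rewrite inE => -[t _ <-]; rewrite lee_fin.
Qed.

End density_prob.

Section gaussian_characteristic_function.
Context {R : realType}.
Local Notation mu := (@lebesgue_measure R).

(** The fundamental theorem of calculus gives the integrals over [-(n + 1), n + 1]; integrability of
    [f] is what lets them pass to the limit, by domination by |f|. *)
Lemma Rintegral_derivative_eq0 (F f : R -> R) :
  continuous f -> (forall x : R, is_derive x 1 F (f x)) ->
  mu.-integrable setT (EFin \o f) ->
  F x @[x --> +oo] --> (0 : R) -> F x @[x --> -oo] --> (0 : R) ->
  \int[mu]_x f x = 0.
Proof.
move=> cf dF intf Fy FNy.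
have cF : continuous F.
  by move=> x; apply: differentiable_continuous; apply/derivable1_diffP; have [] := dF x.
pose fn (n : nat) := (EFin \o f) \_ `[- n.+1%:R, n.+1%:R].
have H1 n : (\int[mu]_x fn n x = (F n.+1%:R - F (- n.+1%:R))%:E)%E.
  rewrite -integral_mkcond/=.
  rewrite (@continuous_FTC2 _ f F)//.
  - by rewrite gtrN.
  - exact: continuous_subspaceT.
  - split.
    + by move=> x _; have [] := dF x.
    + by apply/cvg_at_right_filter; exact: cF.
    + by apply/cvg_at_left_filter; exact: cF.
  - by move=> x _; rewrite derive1E; have [_ ->] := dF x.
have H2 : (\int[mu]_x fn n x @[n --> \oo] --> \int[mu]_x (f x)%:E)%E.
  apply: (@dominated_cvg _ _ _ mu _ _ fn (EFin \o f) (abse \o (EFin \o f))) => //.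
  - move=> n; apply: (measurable_restrictT _ _).1 => //.
    by apply: measurable_funTS; case/integrableP: intf.
  - move=> x _; apply: (@cvg_trans _ (cst (f x)%:E @ \oo)); last exact: cvg_cst.
    apply: near_eq_cvg; near=> n; rewrite /fn patchE ifT//.
    rewrite inE/= in_itv/= -ler_norml; near: n.
    near=> n; apply: ltW; apply: (@lt_trans _ _ n%:R); last by rewrite ltr_nat.
    near: n; exact: nbhs_infty_gtr.
  - exact: integrable_abse.
  - by move=> n x _; rewrite /fn patchE; case: ifP => //= _; rewrite normr0 lee_fin normr_ge0.
have H3 : (F n.+1%:R - F (- n.+1%:R))%:E @[n --> \oo] --> (0 - 0)%:E.
  apply: cvg_EFin; first exact: nearW.
  apply: cvgB.
  - apply: (cvg_comp _ _ _ Fy).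
    apply/cvgryPge => A; near=> n; apply: (@le_trans _ _ n%:R); last by rewrite ler_nat.
    by near: n; exact: nbhs_infty_ger.
  - apply: (cvg_comp _ _ _ FNy).
    apply/cvgrNyPle => A; near=> n; rewrite lerNl; apply: (@le_trans _ _ n%:R); last by rewrite ler_nat.
    by near: n; exact: nbhs_infty_ger.
rewrite /Rintegral.
have -> : (\int[mu]_x (f x)%:E = (0 - 0)%:E)%E; last by rewrite subrr.
have E : (fun n => \int[mu]_x fn n x)%E = (fun n => (F n.+1%:R - F (- n.+1%:R))%:E).
  by apply/funext => n; rewrite H1.
by rewrite E in H2; exact: (cvg_unique _ H2 H3).
Unshelve. all: by end_near. Qed.

Local Notation g := (@normal_pdf R 0 1).

Lemma normal_pdf01E x : g x = normal_peak 1 * expR (- (x ^+ 2 / 2)).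
Proof.
rewrite /normal_pdf ifF ?oner_eq0// /normal_fun subr0 expr1n.
by rewrite mulNr.
Qed.

Lemma is_derive_normal_pdf01 (x : R) : is_derive x 1 g (- x * g x).
Proof.
rewrite (_ : g = fun x => normal_peak 1 * expR (- (x ^+ 2 / 2))); last first.
  by apply/funext => y; rewrite normal_pdf01E.
apply: is_derive_eq; rewrite /GRing.scale/=; lra.
Qed.

Lemma integrable_id_normal_pdf01 :
  mu.-integrable setT (EFin \o (fun x : R => x * g x)).
Proof.
(* The Gaussian density of variance 2 dominates, because |x| <= 1 + x^2/4 <= exp (x^2/4); [c] is the
   ratio of the two peaks. *)
pose c := normal_peak 1 / normal_peak (Num.sqrt 2) : R.
have s20 : Num.sqrt 2 != 0 :> R by rewrite gt_eqF// sqrtr_gt0.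
have := integrableZl measurableT c (@integrable_normal_pdf R 0 (Num.sqrt 2)).
apply: le_integrable => //.
  apply/measurable_EFinP; apply: measurable_funM => //.
  exact: measurable_normal_pdf.
move=> x _; rewrite -EFinM !abse_EFin lee_fin normrM.
rewrite (ger0_norm (normal_pdf_ge0 _ _ _)) normrM (ger0_norm (normal_pdf_ge0 _ _ _)).
rewrite normal_pdf01E /normal_pdf (negbTE s20) /c.
rewrite (@ger0_norm _ (_ / _)); last by rewrite divr_ge0 ?normal_peak_ge0.
rewrite [leRHS]mulrA (divfK (lt0r_neq0 (normal_peak_gt0 s20))) mulrCA ler_wpM2l ?normal_peak_ge0//.
rewrite /normal_fun subr0 sqr_sqrtr//.
have -> : - x ^+ 2 / (2 *+ 2) = - (x ^+ 2 / 2) + x ^+ 2 / 4 by field.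
rewrite expRD mulrC ler_wpM2l ?expR_ge0//.
apply: le_trans (expR_ge1Dx _).
have := sqr_ge0 (`|x| / 2 - 1); rewrite -(real_normK (num_real x)); nra.
Qed.

Lemma cvgy_normal_pdf01 : g x @[x --> +oo] --> (0 : R).
Proof.
(* Expanding (x - 1)^2 >= 0 gives - x^2/2 <= 1/2 - x. *)
apply: (@squeeze_cvgr _ _ _ _ (fun=> 0) (fun x => normal_peak 1 * expR (1 / 2) * expR (- x))).
- near=> x; rewrite normal_pdf_ge0/= normal_pdf01E -mulrA ler_wpM2l ?normal_peak_ge0//.
  by rewrite -expRD ler_expR; have := sqr_ge0 (x - 1); nra.
- exact: cvg_cst.
- rewrite -[X in _ --> X](mulr0 (normal_peak 1 * expR (1 / 2))).
  by apply: cvgMr; exact: cvgr_expR.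
Unshelve. all: by end_near. Qed.

Definition normal_char (c : R) := \int[mu]_x (g x * cos (c * x)).

Let mg : measurable_fun setT g.
Proof. exact: measurable_normal_pdf. Qed.

Lemma integrable_normal_trig (f : R -> R) (M : R) :
  measurable_fun [set: measurableTypeR R] f -> (forall x, `|f x| <= M) ->
  mu.-integrable setT (EFin \o (fun x => g x * f x)).
Proof.
move=> mf fM; have := integrableZl measurableT M (@integrable_normal_pdf R 0 1).
apply: le_integrable => //.
  by apply/measurable_EFinP; apply: measurable_funM.
move=> x _; rewrite -EFinM !abse_EFin lee_fin !normrM mulrC ler_wpM2r//.
by rewrite (le_trans (fM x))// ler_norm.
Qed.

Let mcos c : measurable_fun [set: measurableTypeR R] (fun x : R => cos (c * x)).
Proof.
apply: (measurableT_comp (f := cos)); last exact: measurable_funM.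
by apply: continuous_measurable_fun; exact: continuous_cos.
Qed.

Let msin c : measurable_fun [set: measurableTypeR R] (fun x : R => sin (c * x)).
Proof.
apply: (measurableT_comp (f := sin)); last exact: measurable_funM.
by apply: continuous_measurable_fun; exact: continuous_sin.
Qed.

Let int_xgsin c : mu.-integrable setT (EFin \o (fun x => x * g x * sin (c * x))).
Proof.
apply: le_integrable integrable_id_normal_pdf01 => //.
  by apply/measurable_EFinP; apply: measurable_funM => //; exact: measurable_funM.
move=> x _; rewrite !abse_EFin lee_fin normrM ler_piMr//.
by rewrite ler_norml sin_geN1 sin_le1.
Qed.

(** Since g' = - x g, the difference of the two integrands is, up to sign, the derivative of g(x)
    sin(c x), which vanishes at both infinities. *)
Lemma normal_sin_by_parts (c : R) :
  \int[mu]_x (x * g x * sin (c * x)) = c * normal_char c.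
Proof.
have intc := integrable_normal_trig (mcos c) (fun x => cos_max (c * x)).
apply/eqP; rewrite -subr_eq0 /normal_char -RintegralZl//.
rewrite -opprB oppr_eq0; apply/eqP.
rewrite -RintegralB//; last exact: (integrableZl measurableT c intc).
have dF (x : R) : is_derive x 1 (fun x => g x * sin (c * x))
    (c * (g x * cos (c * x)) - x * g x * sin (c * x)).
  have dg := is_derive_normal_pdf01 x.
  apply: is_derive_eq; rewrite /GRing.scale/=; lra.
have cg : continuous g by apply: continuous_normal_pdf; exact: oner_neq0.
have Fy : g x * sin (c * x) @[x --> +oo] --> (0 : R).
  apply: (@squeeze_cvgr _ _ _ _ (fun x => - g x) g).
  - near=> x; rewrite -ler_norml normrM ger0_norm ?normal_pdf_ge0//.
    by rewrite ler_piMr ?normal_pdf_ge0// ler_norml sin_geN1 sin_le1.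
  - by rewrite -[X in _ --> X]oppr0; apply: cvgN; exact: cvgy_normal_pdf01.
  - exact: cvgy_normal_pdf01.
apply: (Rintegral_derivative_eq0 _ dF).
- move=> x; apply: differentiable_continuous; apply/derivable1_diffP.
  have dg := is_derive_normal_pdf01 x.
  exact: ex_derive.
- exact: (integrableB measurableT (integrableZl measurableT c intc) (int_xgsin c)).
- exact: Fy.
- apply/cvgNy_compNP; rewrite (_ : _ \o _ = (fun x => - (g x * sin (c * x)))).
    have FN : - (g x * sin (c * x)) @[x --> +oo] --> (- 0 : R) by exact: cvgN.
    by rewrite oppr0 in FN.
  by apply/funext => x /=; rewrite !normal_pdf01E sqrrN !mulrN sinN mulrN.
Unshelve. all: by end_near. Qed.

(* Differentiating under the integral and integrating by parts give the ODE
   f' = - c f, whose solution with f 0 = 1 is the Gaussian. *)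
Lemma is_derive_normal_char (c : R) : is_derive c 1 normal_char (- c * normal_char c).
Proof.
pose f (c x : R) := g x * cos (c * x).
have df (y x : R) : is_derive y 1 (f ^~ x) (- (x * g x * sin (y * x))).
  by apply: is_derive_eq; rewrite /GRing.scale/=; lra.
have Ic : `]c - 1, c + 1[%classic c by rewrite /= in_itv/=; lra.
have fG : forall (y : R) x, `]c - 1, c + 1[%classic y -> setT x ->
    `|partial1of2 f y x| <= `|x * g x|.
  move=> y x _ _; rewrite partial1of2E (@derive_val _ _ _ _ _ _ _ (df y x)).
  by rewrite normrN normrM ler_piMr// ler_norml sin_geN1 sin_le1.
have intf (y : R) : `]c - 1, c + 1[%classic y -> mu.-integrable setT (EFin \o f y).
  by move=> _; exact: (integrable_normal_trig (mcos y) (fun x => cos_max (y * x))).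
have derf (y x : R) : `]c - 1, c + 1[%classic y -> setT x -> derivable (f ^~ x) y 1.
  by move=> _ _; have [] := df y x.
have G0 (x : R) : 0 <= `|x * g x| by [].
have intG : mu.-integrable setT (EFin \o (fun x : R => `|x * g x|)).
  exact: (integrable_norm integrable_id_normal_pdf01).
split.
  exact: (@derivable_under_integral _ _ _ mu f setT measurableT _ _ _ Ic intf derf _ G0 intG fG).
have := @differentiation_under_integral _ _ _ mu f setT measurableT _ _ _ Ic intf derf _ G0 intG fG.
rewrite derive1E => ->; rewrite mulNr -normal_sin_by_parts -mulN1r -RintegralZl//.
  by apply: eq_Rintegral => x _; rewrite partial1of2E (@derive_val _ _ _ _ _ _ _ (df c x)) mulN1r.
Qed.

Lemma normal_charE (c : R) : normal_char c = expR (- (c ^+ 2 / 2)).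
Proof.
(* The second factor is the integrating factor of f' = - c f. *)
pose F c := normal_char c * expR (c ^+ 2 / 2).
have dF (x : R) : is_derive x 1 F 0.
  have dn := is_derive_normal_char x.
  by apply: is_derive_eq; rewrite /GRing.scale/=; lra.
have := is_derive_0_is_cst c 0 dF; rewrite /F expr0n/= mul0r expR0 mulr1.
have -> : normal_char 0 = 1.
  rewrite /normal_char; under eq_Rintegral do rewrite mul0r cos0 mulr1.
  by rewrite /Rintegral integral_normal_pdf.
move=> H; apply: (mulIf (lt0r_neq0 (expR_gt0 (c ^+ 2 / 2)))).
by rewrite H -expRD addNr expR0.
Qed.

End gaussian_characteristic_function.

(** * Integration on the torus *)

Section lebesgue_change_of_variable.
Context {R : realType}.
Local Notation mu := (@lebesgue_measure R).

Lemma lebesgue_measure_shift (c : R) (A : set (measurableTypeR R)) : measurable A ->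
  pushforward mu (fun x : measurableTypeR R => x + c : measurableTypeR R) A = mu A.
Proof.
have ms : measurable_fun setT (fun x : measurableTypeR R => x + c : measurableTypeR R).
  exact: measurable_funD.
move=> mA; apply/esym/lebesgue_measure_unique => //= _ [[a b]] _ <-.
rewrite /pushforward/=.
rewrite (_ : _ @^-1` _ = `]a - c, b - c]%classic); last first.
  by apply/seteqP; split => x /=; rewrite !in_itv/= ltrBlDr lerBrDr.
by rewrite !lebesgue_measure_itv/= !lte_fin ltrD2r; case: ifP => // _; rewrite -!EFinB; congr EFin; ring.
Qed.

Lemma ge0_integral_shift (c : R) (f : measurableTypeR R -> \bar R) :
  measurable_fun [set: measurableTypeR R] f -> (forall x, 0 <= f x)%E ->
  (\int[mu]_x f (x + c)%R = \int[mu]_x f x)%E.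
Proof.
move=> mf f0.
have ms : measurable_fun setT (fun x : measurableTypeR R => x + c : measurableTypeR R).
  exact: measurable_funD.
rewrite -(@ge0_integral_pushforward _ _ _ _ R _ ms mu setT f)//.
by apply: eq_measure_integral => //= A mA _; exact: lebesgue_measure_shift.
Qed.

Lemma ge0_integral_itv_shift (a b c : R) (f : measurableTypeR R -> \bar R) :
  measurable_fun [set: measurableTypeR R] f -> (forall x, 0 <= f x)%E ->
  (\int[mu]_(x in `[a, b[) f (x + c)%R = \int[mu]_(x in `[(a + c)%R, (b + c)%R[) f x)%E.
Proof.
move=> mf f0; rewrite [RHS]integral_mkcond -(ge0_integral_shift c).
- rewrite integral_mkcond; apply: eq_integral => x _.
  by rewrite !patchE !mem_setE !in_itv/= lerD2r ltrD2r.
- apply: (measurable_restrictT _ _).1 => //; exact: measurable_funTS.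
- by move=> x; apply: erestrict_ge0.
Qed.

End lebesgue_change_of_variable.

Section fractional_part.
Context {R : realType}.

Definition fracp (x : R) : R := x - (Num.floor x)%:~R.

Lemma fracp_itv x : 0 <= fracp x < 1.
Proof.
rewrite /fracp; have /andP[h1 h2] := floor_itv x.
by rewrite subr_ge0 h1/= ltrBlDl; move: h2; rewrite intrD.
Qed.

Lemma fracp_id x : 0 <= x < 1 -> fracp x = x.
Proof.
move=> xI; rewrite /fracp (_ : Num.floor x = 0) ?subr0//.
by apply: floor_def; rewrite add0r.
Qed.

Lemma fracpDz x (z : int) : fracp (x + z%:~R) = fracp x.
Proof.
rewrite /fracp floorDrz ?intr_int// intrD intrKfloor; ring.
Qed.

Lemma measurable_fracp : measurable_fun [set: measurableTypeR R] (fracp : measurableTypeR R -> measurableTypeR R).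
Proof.
move=> _ Y mY; rewrite setTI.
(* On each interval [z, z + 1[ the map is the translation by - z. *)
rewrite (_ : _ @^-1` _ = \bigcup_(z in [set: int])
   (`[z%:~R, (z + 1)%:~R[ `&` (fun x : measurableTypeR R => x - z%:~R : measurableTypeR R) @^-1` Y)).
  apply: countable_bigcupT_measurable => [|z]; first exact: countableP.
  apply: measurableI; first exact: measurable_itv.
  rewrite -[X in measurable X]setTI.
  have m : measurable_fun setT (fun x : measurableTypeR R => x - z%:~R : measurableTypeR R).
    exact: measurable_funB.
  exact: m.
apply/seteqP; split => [x /= Yx|x [z _ [/=]]].
  by exists (Num.floor x) => //; split => //=; rewrite in_itv/= floor_itv.
by rewrite in_itv/= => zx; rewrite /fracp (floor_def zx).
Qed.

End fractional_part.

Section uniform_rotation.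
Context {R : realType}.
Local Notation mu := (@lebesgue_measure R).
Local Notation U := (uniform_prob (@ltr01 R)).

Lemma ge0_integral_uniform_prob01 (f : measurableTypeR R -> \bar R) :
  (forall x, 0 <= f x)%E -> measurable_fun [set: measurableTypeR R] f ->
  (\int[U]_x f x = \int[mu]_(x in `[0%R, 1%R[) f x)%E.
Proof.
move=> f0 mf; rewrite integral_itv_bndo_bndc; last exact: measurable_funTS.
have h0 (x : R) : 0 <= uniform_pdf 0 1 x by apply: uniform_pdf_ge0.
have mh : measurable_fun setT (uniform_pdf 0 1 : R -> R) by exact: measurable_uniform_pdf.
have h1 : (\int[mu]_x (uniform_pdf 0 1 x)%:E = 1)%E by rewrite integral_uniform_pdf1.
transitivity (\int[density_prob h0 mh h1]_x f x)%E.
  by apply: eq_measure_integral.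
rewrite ge0_integral_density_prob//.
rewrite [RHS]integral_mkcond; apply: eq_integral => x _.
rewrite patchE mem_setE in_itv/= /uniform_pdf.
by case: ifP => _; rewrite ?mule0// subr0 invr1 mule1.
Qed.

(** Once y is reduced to [0, 1[, the shifted interval [y, 1 + y[ is cut at 1, and its second piece
    [1, 1 + y[ is brought back to [0, y[ by periodicity. *)
Lemma ge0_integral_uniform_rot (y : R) (f : measurableTypeR R -> \bar R) :
  (forall x, 0 <= f x)%E -> measurable_fun [set: measurableTypeR R] f ->
  (\int[U]_x f (fracp (x + y)) = \int[U]_x f x)%E.
Proof.
move=> f0 mf.
have fracD (x z : R) : fracp (x + z) = fracp (x + fracp z).
  by rewrite [fracp z]/fracp addrA -mulrNz fracpDz.
wlog yI : y / 0 <= y < 1.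
  move=> /(_ _ (fracp_itv y)) <-; apply: eq_integral => x _; congr f; exact: fracD.
pose g (x : measurableTypeR R) := f (fracp x).
have mg : measurable_fun [set: measurableTypeR R] g.
  exact: (measurableT_comp mf measurable_fracp).
have g0 x : (0 <= g x)%E by exact: f0.
rewrite !ge0_integral_uniform_prob01//; last first.
  by apply: (measurableT_comp mg); exact: measurable_funD.
have [y0 y1] := andP yI.
have spl (a b c : R) : a <= b <= c ->
    (\int[mu]_(x in `[a, c[) g x = \int[mu]_(x in `[a, b[) g x + \int[mu]_(x in `[b, c[) g x)%E.
  move=> /andP[ab bc]; rewrite -ge0_integral_setU//=.
  - by rewrite -itv_bndbnd_setU ?bnd_simp.
  - exact: measurable_funTS.
  - by apply/disj_setPS => x /= []; rewrite !in_itv/= => /andP[_ +] /andP[+ _]; rewrite ltNge => /negP.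
transitivity (\int[mu]_(x in `[0%R, 1%R[) g (x + y)%R)%E; first by [].
rewrite (ge0_integral_itv_shift 0 1 y)// add0r (spl _ 1); last by rewrite (ltW y1) lerDl.
have := ge0_integral_itv_shift 0 y 1 mg g0; rewrite add0r [(y + 1)%R]addrC => <-.
under [X in (_ + X)%E]eq_integral do rewrite /g -[1%R]/(1%:~R) fracpDz -/(g _).
rewrite addeC -spl; last by rewrite y0 ltW.
by apply: eq_integral => x; rewrite inE/= in_itv/= => xI; rewrite /g fracp_id.
Qed.

End uniform_rotation.

Lemma product_probability_setT d1 d2 (T1 : measurableType d1) (T2 : measurableType d2)
    (R : realType) (P : probability T1 R) (Q : probability T2 R) :
  (P \x Q)%E setT = 1%E.
Proof.
rewrite -setXTT [LHS]product_measure1E//.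
rewrite [X in (_ * X)%E](@probability_setT _ _ _ Q) mule1.
exact: (@probability_setT _ _ _ P).
Qed.

Lemma bounded_integrable d (T : measurableType d) (R : realType) (P : probability T R)
    (f : T -> R) (M : R) : measurable_fun setT f -> (forall x, `|f x| <= M) ->
  P.-integrable setT (EFin \o f).
Proof.
move=> mf fM; apply: measurable_bounded_integrable => //.
  apply: (@le_lt_trans _ _ 1%E); last exact: ltry.
  by rewrite [leLHS](@probability_setT _ _ _ P).
by exists M; split; [exact: num_real|move=> x Mx z _; exact: (le_trans (fM _) (ltW Mx))].
Qed.

Section product_probability.
Context d1 d2 (T1 : measurableType d1) (T2 : measurableType d2) (R : realType).
Variables (P : probability T1 R) (Q : probability T2 R).

Definition prod_probability := (P \x Q)%E.

HB.instance Definition _ := Measure.on prod_probability.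

HB.instance Definition _ := Measure_isProbability.Build _ _ _ prod_probability
  (product_probability_setT P Q).

Lemma Rintegral_prod_probability (f : T1 * T2 -> R) (M : R) :
  measurable_fun setT f -> (forall x, `|f x| <= M) ->
  \int[prod_probability]_x f x = \int[P]_x \int[Q]_y f (x, y).
Proof.
move=> mf fM.
have intf : (P \x Q)%E.-integrable setT (EFin \o f) := bounded_integrable prod_probability mf fM.
rewrite /Rintegral [X in fine X](_ : _ = \int[P \x Q]_x (EFin \o f) x)%E//.
rewrite -integral12_prod_meas1//; congr fine; apply: eq_integral => x _.
rewrite fineK//; apply: integrable_fin_num => //.
apply: (bounded_integrable Q (M := M)) => //.
by apply: (measurableT_comp mf); exact: measurable_pair1.
Qed.

End product_probability.

Section tuple_integrals.
Context {R : realType}.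
Local Notation cube n := (n.-tuple (measurableTypeR R)).
Local Notation U := (uniform_prob (@ltr01 R)).

Lemma measurable_cons_pair n :
  measurable_fun setT (fun z : measurableTypeR R * cube n => [tuple of z.1 :: z.2] : cube n.+1).
Proof. exact: measurable_cons. Qed.

Lemma measurable_mktuple n d (T : measurableType d) (f : 'I_n -> T -> measurableTypeR R) :
  (forall i, measurable_fun setT (f i)) ->
  measurable_fun setT (fun x => [tuple f i x | i < n] : cube n).
Proof.
move=> mf; apply/measurable_fun_tnthP => i.
by rewrite (_ : _ \o _ = f i)//; apply/funext => x /=; rewrite tnth_mktuple.
Qed.

Lemma ge0_integral_torusS n (f : cube n.+1 -> \bar R) :
  (forall x, 0 <= f x)%E -> measurable_fun setT f ->
  (\int[torus_measure n.+1]_x f x = \int[U]_x \int[torus_measure n]_y f [tuple of x :: y])%E.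
Proof.
move=> f0 mf; rewrite /=.
rewrite ge0_integral_distribution//.
rewrite [LHS](@fubini_tonelli1 _ _ _ _ R U (torus_measure n) (f \o cube_cons))//.
  by apply: (measurableT_comp mf); exact: measurable_cons_pair.
by move=> x; exact: f0.
Qed.

(** Translation on the torus. The fractional part brings the result back to the unit cube, because
    functions on tuples are not assumed periodic. *)
Definition torus_shift n (y x : cube n) : cube n := [tuple fracp (tnth x i + tnth y i) | i < n].

Lemma torus_shift_cons n (a b : R) (x y : cube n) :
  torus_shift [tuple of b :: y] [tuple of a :: x] = [tuple of fracp (a + b) :: torus_shift y x].
Proof.
apply: eq_from_tnth => i; rewrite tnth_mktuple.
case: (unliftP ord0 i) => [j|] ->; last by rewrite !tnth0.
by rewrite !tnthS tnth_mktuple.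
Qed.

Lemma measurable_torus_shift2 n d (T : measurableType d) (X Y : T -> cube n) :
  measurable_fun setT X -> measurable_fun setT Y ->
  measurable_fun setT (fun z => torus_shift (Y z) (X z)).
Proof.
move=> mX mY; apply: measurable_mktuple => i.
apply: (measurableT_comp measurable_fracp); apply: measurable_funD.
  exact: (measurable_fun_tnthP _).1.
exact: (measurable_fun_tnthP _).1.
Qed.

Lemma ge0_integral_torus_shift n (y : cube n) (f : cube n -> \bar R) :
  (forall x, 0 <= f x)%E -> measurable_fun setT f ->
  (\int[torus_measure n]_x f (torus_shift y x) = \int[torus_measure n]_x f x)%E.
Proof.
elim: n => [|n IH] in y f *.
  by move=> f0 mf; apply: eq_integral => x _; rewrite [torus_shift y x]tuple0 [x]tuple0.
case/tupleP: y => b y f0 mf.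
have msh : measurable_fun setT (fun x : cube n.+1 => f (torus_shift [tuple of b :: y] x)).
  by apply: (measurableT_comp mf); exact: measurable_torus_shift2.
rewrite !ge0_integral_torusS//.
pose g (a : measurableTypeR R) := (\int[torus_measure n]_z f [tuple of a :: z])%E.
transitivity (\int[U]_a g (fracp (a + b)))%E; last first.
  rewrite (ge0_integral_uniform_rot b (f := g))//.
    by move=> a; apply: integral_ge0 => z _.
  apply: (@measurable_fun_fubini_tonelli_F _ _ _ _ _ (torus_measure n) (fun z => f [tuple of z.1 :: z.2])) => //.
  by apply: (measurableT_comp mf); exact: measurable_cons_pair.
apply: eq_integral => a _.
under eq_integral do rewrite torus_shift_cons.
apply: (IH y (fun z => f [tuple of fracp (a + b) :: z])) => //.
by apply: (measurableT_comp mf); apply: measurable_cons.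
Qed.

End tuple_integrals.

Section tuple_product_probability.
Context {R : realType}.
Local Notation cube n := (n.-tuple (measurableTypeR R)).
Variable P0 : probability (measurableTypeR R) R.

Definition tuple_step {n : nat} (P : probability (cube n) R) : probability (cube n.+1) R :=
  distribution (prod_probability P0 P) cube_cons.

Fixpoint tuple_power (n : nat) : probability (cube n) R :=
  match n with
  | 0 => dirac ([tuple] : cube 0)
  | m.+1 => tuple_step (tuple_power m)
  end.

Lemma Rintegral_tuple_powerS n (f : cube n.+1 -> R) (M : R) :
  measurable_fun setT f -> (forall x, `|f x| <= M) ->
  \int[tuple_power n.+1]_x f x = \int[P0]_x \int[tuple_power n]_y f [tuple of x :: y].
Proof.
move=> mf fM.
have mfc : measurable_fun setT (f \o cube_cons).
  by apply: (measurableT_comp mf); exact: measurable_cons_pair.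
have fcM z : `|(f \o cube_cons) z| <= M by exact: fM.
rewrite -(Rintegral_prod_probability P0 (tuple_power n) mfc fcM).
rewrite /Rintegral/= integral_distribution//; first exact/measurable_EFinP.
exact: (bounded_integrable (prod_probability P0 (tuple_power n)) mfc fcM).
Qed.

End tuple_product_probability.

Section trigonometric_monomials.
Context {R : realType} {n : nat}.
Local Notation cube := (n.-tuple (measurableTypeR R)).

Definition trig (i : 'rV[int]_n * bool) (x : 'rV[R]_n) : R :=
  if i.2 then cos (2 * pi * dotk i.1 x) else sin (2 * pi * dotk i.1 x).

Definition row_of_cube (x : cube) : 'rV[R]_n := \row_i tnth x i.

Definition cube_trig i (x : cube) := trig i (row_of_cube x).

Lemma trig_le1 i x : `|trig i x| <= 1.
Proof.
rewrite /trig; case: i.2; first exact: cos_max.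
by rewrite ler_norml sin_geN1 sin_le1.
Qed.

Lemma cosD_int (x : R) (z : int) : cos (x + 2 * pi * z%:~R) = cos x.
Proof.
have H (m : nat) y : cos (y + 2 * pi * m%:R) = cos y :> R.
  elim: m y => [|m IH] y; first by rewrite mulr0 addr0.
  rewrite (_ : _ + _ = (y + pi *+ 2) + 2 * pi * m%:R); last by rewrite -natr1; ring.
  by rewrite IH cosD2pi.
case: z => m; first exact: H.
rewrite -[in RHS](subrK (2 * pi * m.+1%:R) x) H; congr cos.
by rewrite NegzE mulrNz mulrN.
Qed.

Lemma sinD_int (x : R) (z : int) : sin (x + 2 * pi * z%:~R) = sin x.
Proof.
rewrite -!cosBpihalf -(cosD_int (x - _) z); congr cos; ring.
Qed.

(** The integer parts discarded by the shift change k.x by an integer, which 1-periodic monomials do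
    not see. *)
Lemma dotk_torus_shift k (x y : cube) : exists z : int,
  dotk k (row_of_cube x) = dotk k (row_of_cube (torus_shift y x)) - dotk k (row_of_cube y) + z%:~R.
Proof.
exists (\sum_i k 0 i * Num.floor (tnth x i + tnth y i)).
rewrite /dotk -sumrB rmorph_sum -big_split/=.
apply: eq_bigr => i _; rewrite !mxE tnth_mktuple /fracp intrM; ring.
Qed.

(** Addition formulas for x = (x + y) - y; the sign distinguishes cos(A - B) from sin(A - B).
    Writing the monomial at the shifted point is what allows [coef_convolution] to use the
    invariance of the measure. *)
Lemma cube_trig_shift k b (x y : cube) :
  cube_trig (k, b) x =
  cube_trig (k, true) y * cube_trig (k, b) (torus_shift y x) +
  cube_trig (k, false) y * ((if b then 1 else -1) * cube_trig (k, ~~ b) (torus_shift y x)).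
Proof.
rewrite /cube_trig /trig/=.
have [z ->] := dotk_torus_shift k x y.
set X := dotk k _; set Y := dotk k _.
rewrite (_ : 2 * pi * (X - Y + z%:~R) = (2 * pi * X - 2 * pi * Y) + 2 * pi * z%:~R); last ring.
case: b => /=; first by rewrite cosD_int cosB; ring.
by rewrite sinD_int sinB; ring.
Qed.

Lemma measurable_dotk (k : 'rV[int]_n) :
  measurable_fun [set: cube] (fun x : cube => dotk k (row_of_cube x)).
Proof.
rewrite /dotk; apply: measurable_sum => i; apply: measurable_funM => //.
rewrite (_ : (fun x => _) = (fun x : cube => tnth x i)); first exact: measurable_tnth.
by apply/funext => x; rewrite mxE.
Qed.

Lemma measurable_cube_trig i : measurable_fun [set: cube] (cube_trig i).
Proof.
have m : measurable_fun [set: cube] (fun x : cube => 2 * pi * dotk i.1 (row_of_cube x)).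
  by apply: measurable_funM => //; exact: measurable_dotk.
rewrite /cube_trig /trig; case: i.2.
  apply: (measurableT_comp (f := cos)) => //.
  by apply: continuous_measurable_fun; exact: continuous_cos.
apply: (measurableT_comp (f := sin)) => //.
by apply: continuous_measurable_fun; exact: continuous_sin.
Qed.

Definition coef (g : cube -> R) i := \int[torus_measure n]_x (g x * cube_trig i x).

End trigonometric_monomials.

(** Hoelder's inequality against the constant 1, whose norm is 1 for a probability. *)
Lemma Lnorm1_le d (T : measurableType d) (R : realType) (P : probability T R)
    (f : T -> R) (p : R) : 1 < p -> measurable_fun setT f ->
  ('N[P]_1[EFin \o f] <= 'N[P]_(p%:E)[EFin \o f])%E.
Proof.
move=> p1 mf; have p0 : 0 < p by apply: lt_trans p1.
pose q := (1 - p^-1)^-1.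
have ip1 : p^-1 < 1 by rewrite invf_lt1.
have q0 : 0 < q by rewrite invr_gt0 subr_gt0.
have pq : p^-1 + q^-1 = 1 by rewrite invrK addrC subrK.
have := hoelder P mf (@measurable_cst _ _ T R setT 1) p0 q0 pq.
rewrite (_ : (f \* cst 1)%R = f); last by apply/funext => x /=; rewrite mulr1.
move=> /le_trans; apply.
rewrite (_ : 'N[P]_(q%:E)[EFin \o cst 1%R] = 1)%E ?mule1//.
rewrite (_ : EFin \o cst 1%R = cst 1%E)// Lnorm_cst1.
by rewrite [X in (X `^ _)%E](@probability_setT _ _ _ P) poweR1r.
Qed.

Lemma le_fine_abs (R : realDomainType) (x : \bar R) : (`|fine x|%:E <= `|x|)%E.
Proof. by case: x => [x| |] //=; rewrite normr0 leey. Qed.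

Section convolution.
Context {R : realType} {n : nat} {dO} {O : measurableType dO} (P : probability O R).
Local Notation cube := (n.-tuple (measurableTypeR R)).
Local Notation tor := (@torus_measure R n).
Variable Y : O -> cube.
Hypothesis mY : measurable_fun setT Y.
Variable m : 'rV[int]_n -> R.
Hypothesis cosY : forall k, \int[P]_w cube_trig (k, true) (Y w) = m k.
Hypothesis sinY : forall k, \int[P]_w cube_trig (k, false) (Y w) = 0.
Variables (p : R) (g : cube -> R).
Hypothesis p1 : 1 < p.
Hypothesis mg : measurable_fun setT g.
Hypothesis gp : ('N[tor]_(p%:E)[EFin \o g] < +oo)%E.

Lemma integral_torus_shift (y : cube) (f : cube -> \bar R) : measurable_fun setT f ->
  (\int[tor]_x f (torus_shift y x) = \int[tor]_x f x)%E.
Proof.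
move=> mf; rewrite integralE [RHS]integralE.
congr (_ - _)%E; rewrite -[RHS](ge0_integral_torus_shift y)//.
- by apply: eq_integral => x _; rewrite !funepos.unlock.
- exact: measurable_funepos.
- by apply: eq_integral => x _; rewrite !funeneg.unlock.
- exact: measurable_funeneg.
Qed.

Let G (z : cube * O) := g (torus_shift (Y z.2) z.1).

Let mG : measurable_fun setT G.
Proof.
apply: (measurableT_comp mg); apply: measurable_torus_shift2 => //.
exact: (measurableT_comp mY).
Qed.

Let int_g : tor.-integrable setT (EFin \o g).
Proof.
apply/integrableP; split; first exact/measurable_EFinP.
by have := le_lt_trans (Lnorm1_le tor p1 mg) gp; rewrite Lnorm1.
Qed.

Let int_G : (tor \x P)%E.-integrable setT (EFin \o G).
Proof.
apply/integrable21ltyP; first exact/measurable_EFinP.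
under eq_integral => w _.
  rewrite (_ : \int[tor]_x _ = \int[tor]_x `|(EFin \o g) x|)%E.
    over.
  rewrite -(integral_torus_shift (Y w) (f := fun x => `|(g x)%:E|%E))//.
  by apply: (measurableT_comp (f := abse)) => //; exact/measurable_EFinP.
rewrite integral_cst// [X in (_ * X)%E](@probability_setT _ _ _ P) mule1.
by case/integrableP: int_g.
Qed.

(** The expectation of g(x + Y). At the points x where the inner function is not integrable, which
    form a null set, [fine] gives the value 0. *)
Definition convolution (x : cube) := fine (\int[P]_w (G (x, w))%:E)%E.

Lemma measurable_convolution : measurable_fun setT convolution.
Proof.
apply: (measurableT_comp (f := fine)) => //.
exact: (measurable_fubini_F int_G).
Qed.

(** For fixed x this is Jensen's inequality, in the form of [Lnorm1_le] for [P]; Tonelli and the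
    invariance of the torus measure under shifts then remove the translation. *)
Lemma Lnorm_convolution :
  ('N[tor]_(p%:E)[EFin \o convolution] <= 'N[tor]_(p%:E)[EFin \o g])%E.
Proof.
have p0 : 0 < p by apply: lt_trans p1.
rewrite unlock; apply: gt0_ler_poweR.
- by rewrite invr_ge0 ltW.
- by rewrite in_itv/= leey andbT integral_ge0// => x _; rewrite poweR_ge0.
- by rewrite in_itv/= leey andbT integral_ge0// => x _; rewrite poweR_ge0.
have mGp : measurable_fun setT (fun z => `|(G z)%:E| `^ p)%E.
  apply: (measurableT_comp (measurable_poweR _)); apply: measurableT_comp => //.
  exact/measurable_EFinP.
apply: (@le_trans _ _ (\int[tor]_x \int[P]_w (`|(G (x, w))%:E| `^ p))%E).
  apply: ge0_le_integral => //.
  - by move=> x _; exact: poweR_ge0.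
  - apply: (measurableT_comp (measurable_poweR _)); apply: measurableT_comp => //.
    by apply/measurable_EFinP; exact: measurable_convolution.
  - apply: (@measurable_fun_fubini_tonelli_F _ _ _ _ _ P (fun z => (`|(G z)%:E| `^ p)%E)) => //.
    by move=> z; exact: poweR_ge0.
  move=> x _.
  have mGx : measurable_fun setT (fun w => G (x, w)).
    by apply: (measurableT_comp mG); exact: measurable_pair1.
  rewrite [leRHS](_ : _ = ('N[P]_(p%:E)[EFin \o (fun w => G (x, w))] `^ p)%E); last first.
    by rewrite powR_Lnorm ?gt_eqF.
  apply: gt0_ler_poweR; first exact: ltW.
  - by rewrite in_itv/= leey andbT.
  - by rewrite in_itv/= leey andbT Lnorm_ge0.
  apply: le_trans (Lnorm1_le P p1 mGx).
  rewrite Lnorm1; apply: le_trans (le_fine_abs _) _.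
  by apply: le_abse_integral => //; exact/measurable_EFinP.
rewrite (@fubini_tonelli _ _ _ _ R tor P (fun z => `|(G z)%:E| `^ p)%E)//=.
rewrite (eq_integral (fun=> \int[tor]_x (`|(EFin \o g) x| `^ p)))%E.
  by rewrite integral_cst// [X in (_ * X)%E](@probability_setT _ _ _ P) mule1.
move=> w _.
rewrite -(integral_torus_shift (Y w) (f := fun x => `|(g x)%:E| `^ p)%E)//.
apply: (measurableT_comp (measurable_poweR _)); apply: measurableT_comp => //.
exact/measurable_EFinP.
Qed.

(** By Fubini and invariance, the coefficient is the mean over w of coefficients of [g] against the
    monomial shifted back by [Y w]. The terms that would mix cosines and sines carry a sine of [Y]
    and vanish by [sinY]. *)
Lemma coef_convolution k b : coef convolution (k, b) = m k * coef g (k, b).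
Proof.
set i := (k, b); pose H (z : cube * O) := G z * cube_trig i z.1.
have mtr j : measurable_fun setT (cube_trig j : cube -> R) := measurable_cube_trig j.
have mH : measurable_fun setT H.
  by apply: measurable_funM => //; exact: (measurableT_comp (mtr i)).
have int_H : (tor \x P)%E.-integrable setT (EFin \o H).
  apply: le_integrable int_G => //; first exact/measurable_EFinP.
  move=> z _; rewrite !abse_EFin lee_fin normrM ler_piMr//; exact: trig_le1.
have int_gt j : tor.-integrable setT (EFin \o (fun x => g x * cube_trig j x)).
  apply: le_integrable int_g => //.
    by apply/measurable_EFinP; exact: measurable_funM.
  move=> z _; rewrite !abse_EFin lee_fin normrM ler_piMr//; exact: trig_le1.
have int_tY j : P.-integrable setT (EFin \o (fun w => cube_trig j (Y w))).
  apply: (bounded_integrable P (M := 1)); first exact: (measurableT_comp (mtr j)).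
  by move=> w; exact: trig_le1.
have E1 : (\int[tor]_x (convolution x * cube_trig i x)%:E = \int[tor]_x \int[P]_w (H (x, w))%:E)%E.
  apply: ae_eq_integral => //.
  - apply/measurable_EFinP; apply: measurable_funM => //; exact: measurable_convolution.
  - exact: (measurable_fubini_F int_H).
  have := ae_integrable1 int_G; apply: filterS => x intx _.
  rewrite EFinM /convolution fineK; last exact: integrable_fin_num.
  by rewrite -integralZr.
have E2 w : (\int[tor]_x (H (x, w))%:E =
    (cube_trig (k, true) (Y w) * coef g i +
     cube_trig (k, false) (Y w) * ((if b then 1 else -1) * coef g (k, ~~ b)))%:E)%E.
  pose f (x : cube) := cube_trig (k, true) (Y w) * (g x * cube_trig i x) +
    cube_trig (k, false) (Y w) * ((if b then 1 else -1) * (g x * cube_trig (k, ~~ b) x)).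
  rewrite (eq_integral (fun x => (f (torus_shift (Y w) x))%:E)); last first.
    move=> x _; rewrite /H /G/= /f /i (cube_trig_shift k b x (Y w)); congr EFin.
    ring.
  rewrite (integral_torus_shift (Y w) (f := EFin \o f)); last first.
    apply/measurable_EFinP; apply: measurable_funD; apply: measurable_funM => //.
      exact: measurable_funM.
    by apply: measurable_funM => //; exact: measurable_funM.
  rewrite /f; under eq_integral do rewrite /= EFinD.
  rewrite integralD//=.
  - under eq_integral do rewrite EFinM.
    rewrite integralZl//; last exact: int_gt.
    under [X in (_ + X)%E]eq_integral do rewrite mulrA EFinM.
    rewrite integralZl//; last exact: int_gt.
    rewrite EFinD mulrA !EFinM /coef /Rintegral !fineK//;
      apply: integrable_fin_num => //; exact: int_gt.
  - exact: (integrableZl measurableT _ (int_gt i)).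
  - exact: (integrableZl measurableT _ (integrableZl measurableT _ (int_gt (k, ~~ b)))).
rewrite {1}/coef /Rintegral E1 (Fubini int_H).
under eq_integral do rewrite E2 EFinD.
rewrite integralD//=.
- under eq_integral do rewrite EFinM.
  rewrite integralZr//; last exact: int_tY.
  under [X in (_ + X)%E]eq_integral do rewrite EFinM.
  rewrite integralZr//; last exact: int_tY.
  have F j : (\int[P]_w (cube_trig j (Y w))%:E = (\int[P]_w cube_trig j (Y w))%:E)%E.
    by rewrite /Rintegral fineK//; apply: integrable_fin_num => //; exact: int_tY.
  by rewrite !F cosY sinY mul0e adde0.
- exact: (integrableZr measurableT _ (int_tY (k, true))).
- exact: (integrableZr measurableT _ (int_tY (k, false))).
Qed.

End convolution.

(** * The Bessel kernel *)

Section reflection.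
Context {R : realType}.
Local Notation mu := (@lebesgue_measure R).

Lemma ge0_integral_oppr (f : measurableTypeR R -> \bar R) :
  measurable_fun [set: measurableTypeR R] f -> (forall x, 0 <= f x)%E ->
  (\int[mu]_x f (- x)%R = \int[mu]_x f x)%E.
Proof.
move=> mf f0.
have ms : measurable_fun setT (fun x : measurableTypeR R => - x : measurableTypeR R).
  exact: measurableT_comp.
rewrite -(@ge0_integral_pushforward _ _ _ _ R _ ms mu setT f)//.
by apply: eq_measure_integral => //= A mA _; exact: lebesgue_measureN.
Qed.

Lemma integral_odd (f : measurableTypeR R -> \bar R) :
  measurable_fun [set: measurableTypeR R] f -> mu.-integrable setT f ->
  (forall x, f (- x)%R = - f x)%E -> (\int[mu]_x f x = 0)%E.
Proof.
move=> mf intf fN; rewrite integralE.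
rewrite -(ge0_integral_oppr (f := f^\+%E))//; last exact: measurable_funepos.
rewrite (eq_integral (fun x => f^\- x)%E (fun x => f^\+ (- x)%R)%E); last first.
  by move=> x _; rewrite funepos.unlock funeneg.unlock fN.
by rewrite subee//; apply: integrable_neg_fin_num.
Qed.

End reflection.

Section density_expectation.
Context {R : realType}.
Local Notation mu := (@lebesgue_measure R).
Variable h : R -> R.
Hypothesis h0 : forall x, 0 <= h x.
Hypothesis mh : measurable_fun setT h.
Hypothesis h1 : (\int[mu]_x (h x)%:E = 1)%E.

Lemma Rintegral_density_prob (f : measurableTypeR R -> R) (M : R) :
  measurable_fun setT f -> (forall x, `|f x| <= M) ->
  \int[density_prob h0 mh h1]_x f x = \int[mu]_x (f x * h x).
Proof.
move=> mf fM; set nu := density_prob h0 mh h1.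
have int_h : mu.-integrable setT (EFin \o h).
  apply/integrableP; split; first exact/measurable_EFinP.
  under eq_integral do rewrite /= ger0_norm//.
  by rewrite h1 ltry.
have int_fh : mu.-integrable setT (EFin \o (fun x => f x * h x)).
  have := integrableZl measurableT M int_h; apply: le_integrable => //.
    by apply/measurable_EFinP; exact: measurable_funM.
  move=> x _; rewrite -EFinM !abse_EFin lee_fin !normrM ler_wpM2r//.
  by rewrite (le_trans (fM x))// ler_norm.
have int_f : nu.-integrable setT (EFin \o f) by exact: (bounded_integrable nu mf fM).
have int_M : nu.-integrable setT (EFin \o cst M).
  by apply: (bounded_integrable nu (M := `|M|)) => //; exact: measurable_cst.
(* Adding the bound M makes the integrand nonnegative, as [ge0_integral_density_prob] requires. *)
have E : \int[nu]_x (f x + M) = \int[mu]_x (f x * h x + M * h x).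
  rewrite /Rintegral ge0_integral_density_prob//.
  - by congr fine; apply: eq_integral => x _; rewrite -EFinM mulrDl.
  - by move=> x; rewrite lee_fin -lerBlDr sub0r; have := fM x; rewrite ler_norml => /andP[].
  - by apply/measurable_EFinP; exact: measurable_funD.
move: E; rewrite RintegralD// RintegralD//; last first.
  exact: (integrableZl measurableT M int_h).
rewrite RintegralZl// (_ : \int[mu]_x h x = 1) ?mulr1; last by rewrite /Rintegral h1.
rewrite (_ : \int[nu]_x cst M x = M); first exact: addIr.
by rewrite Rintegral_cst// [X in fine X](@probability_setT _ _ _ nu) mulr1.
Qed.

End density_expectation.

Section gaussian_vector.
Context {R : realType}.
Local Notation mu := (@lebesgue_measure R).
Local Notation cube n := (n.-tuple (measurableTypeR R)).

Definition std_normal : probability (measurableTypeR R) R :=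
  density_prob (@normal_pdf_ge0 R 0 1) (measurable_normal_pdf 0 1) (integral_normal_pdf 0 1).

Let mcos c : measurable_fun [set: measurableTypeR R] (fun x : R => cos (c * x)).
Proof.
apply: (measurableT_comp (f := cos)); last exact: measurable_funM.
by apply: continuous_measurable_fun; exact: continuous_cos.
Qed.

Let msin c : measurable_fun [set: measurableTypeR R] (fun x : R => sin (c * x)).
Proof.
apply: (measurableT_comp (f := sin)); last exact: measurable_funM.
by apply: continuous_measurable_fun; exact: continuous_sin.
Qed.

Let sin_max (x : R) : `|sin x| <= 1.
Proof. by rewrite ler_norml sin_geN1 sin_le1. Qed.

Lemma std_normal_cos (c : R) : \int[std_normal]_x cos (c * x) = expR (- (c ^+ 2 / 2)).
Proof.
rewrite (Rintegral_density_prob _ _ _ (M := 1))//; last by move=> x; exact: cos_max.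
by rewrite -normal_charE; apply: eq_Rintegral => x _; rewrite mulrC.
Qed.

Lemma std_normal_sin (c : R) : \int[std_normal]_x sin (c * x) = 0.
Proof.
rewrite (Rintegral_density_prob _ _ _ (M := 1))//.
have mf : measurable_fun [set: measurableTypeR R] (fun x => sin (c * x) * normal_pdf 0 1 x).
  by apply: measurable_funM => //; exact: measurable_normal_pdf.
rewrite /Rintegral integral_odd//.
- exact/measurable_EFinP.
- have := integrable_normal_trig (msin c) (fun x => sin_max (c * x)).
  by apply: eq_integrable => // x _; rewrite /= mulrC.
- by move=> x; rewrite mulrN sinN !normal_pdf01E sqrrN mulNr EFinN.
Qed.

Definition dotc n (c : 'I_n -> R) (x : cube n) : R := \sum_i c i * tnth x i.

Lemma measurable_dotc n (c : 'I_n -> R) : measurable_fun setT (dotc c).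
Proof.
apply: measurable_sum => i; apply: measurable_funM => //; exact: measurable_tnth.
Qed.

(** The two integrals are computed together because the addition formulas that split off the first
    coordinate couple them. *)
Lemma gaussian_vector_char n (c : 'I_n -> R) :
  \int[tuple_power std_normal n]_x cos (dotc c x) = expR (- (\sum_i c i ^+ 2 / 2)) /\
  \int[tuple_power std_normal n]_x sin (dotc c x) = 0.
Proof.
elim: n c => [|n IH] c.
  rewrite !big_ord0 oppr0 expR0; split.
    rewrite (@eq_Rintegral _ _ _ _ _ (cst 1)); last by move=> x _; rewrite /dotc big_ord0 cos0.
    rewrite Rintegral_cst// [X in fine X](@probability_setT _ _ _ (tuple_power std_normal 0)) mulr1//.
  rewrite (@eq_Rintegral _ _ _ _ _ (cst 0)); last by move=> x _; rewrite /dotc big_ord0 sin0.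
  by rewrite Rintegral_cst// mul0r.
have mc m (e : 'I_m -> R) : measurable_fun setT (fun x => cos (dotc e x)).
  apply: (measurableT_comp (f := cos)); last exact: measurable_dotc.
  by apply: continuous_measurable_fun; exact: continuous_cos.
have ms m (e : 'I_m -> R) : measurable_fun setT (fun x => sin (dotc e x)).
  apply: (measurableT_comp (f := sin)); last exact: measurable_dotc.
  by apply: continuous_measurable_fun; exact: continuous_sin.
pose c' (i : 'I_n) : R := c (lift ord0 i).
have dotS (x : R) (y : cube n) : dotc c [tuple of x :: y] = c ord0 * x + dotc c' y.
  by rewrite /dotc big_ord_recl tnth0; congr (_ + _); apply: eq_bigr => i _; rewrite tnthS.
have [IHc IHs] := IH c'.
have Ic M : (tuple_power std_normal n).-integrable setT (EFin \o (fun y => M * cos (dotc c' y))).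
  apply: (bounded_integrable (tuple_power std_normal n) (M := `|M|)).
    by apply: measurable_funM => //; exact: mc.
  by move=> y; rewrite normrM ler_piMr// cos_max.
have Is M : (tuple_power std_normal n).-integrable setT (EFin \o (fun y => M * sin (dotc c' y))).
  apply: (bounded_integrable (tuple_power std_normal n) (M := `|M|)).
    by apply: measurable_funM => //; exact: ms.
  by move=> y; rewrite normrM ler_piMr.
have Ic1 : (tuple_power std_normal n).-integrable setT (EFin \o (fun y => cos (dotc c' y))).
  by apply: eq_integrable (Ic 1) => // y _; rewrite /= mul1r.
have Is1 : (tuple_power std_normal n).-integrable setT (EFin \o (fun y => sin (dotc c' y))).
  by apply: eq_integrable (Is 1) => // y _; rewrite /= mul1r.
have Nc M : std_normal.-integrable setT (EFin \o (fun x : R => cos (M * x))).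
  by apply: (bounded_integrable std_normal (M := 1)) => // x; exact: cos_max.
have Ns M : std_normal.-integrable setT (EFin \o (fun x : R => sin (M * x))).
  by apply: (bounded_integrable std_normal (M := 1)).
split.
  rewrite (Rintegral_tuple_powerS _ _ (M := 1))//; last by move=> x; exact: cos_max.
  transitivity (\int[std_normal]_x (cos (c ord0 * x) * expR (- (\sum_i c' i ^+ 2 / 2)))).
    apply: eq_Rintegral => x _; under eq_Rintegral do rewrite dotS cosD.
    by rewrite RintegralB// !RintegralZl// IHc IHs mulr0 subr0.
  by rewrite RintegralZr// std_normal_cos -expRD big_ord_recl opprD.
rewrite (Rintegral_tuple_powerS _ _ (M := 1))//.
transitivity (\int[std_normal]_x (sin (c ord0 * x) * expR (- (\sum_i c' i ^+ 2 / 2)))).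
  apply: eq_Rintegral => x _; under eq_Rintegral do rewrite dotS sinD.
  by rewrite RintegralD// !RintegralZl// IHc IHs mulr0 addr0.
by rewrite RintegralZr// std_normal_sin mul0r.
Qed.

End gaussian_vector.

Section log_gamma.
Context {R : realType}.
Local Notation mu := (@lebesgue_measure R).
Variable al : R.
Hypothesis al0 : 0 < al.

(* Unnormalized density of the logarithm of a Gamma(al) variable; taking the
   logarithm makes the scaling by [1 + c] in [loggamma_laplace] a translation. *)
Definition loggamma_fun (v : R) := expR (al * v - expR v).

Lemma measurable_loggamma_fun : measurable_fun [set: measurableTypeR R] loggamma_fun.
Proof.
by apply: (measurableT_comp (f := expR)) => //; apply: measurable_funB.
Qed.

Lemma integrable_loggamma_fun : mu.-integrable setT (EFin \o loggamma_fun).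
Proof.
(* The dominating function is C al exp (- al |v|), of which [i1] and [i2] bring the parts v >= 0 and
   v < 0. The constant results from completing the square: exp v >= v^2/2 >= 2 al v - 2 al^2 for v
   >= 0. *)
pose C := expR (2 * al ^+ 2) / al.
have i1 := integrableZl measurableT C (integrable_exponential_pdf al0).
have i2 : mu.-integrable setT (fun x : R => C%:E * (exponential_pdf al (- x))%:E)%E.
  apply: integrableZl => //; apply/integrableP; split.
    apply/measurable_EFinP; apply: (measurableT_comp (f := exponential_pdf al)) => //.
    exact: measurable_exponential_pdf.
  have mf : measurable_fun [set: measurableTypeR R] (fun x : R => `|(exponential_pdf al x)%:E|)%E.
    apply: (measurableT_comp (f := abse)) => //; apply/measurable_EFinP.
    exact: measurable_exponential_pdf.
  rewrite (ge0_integral_oppr mf)//.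
  by case/integrableP: (integrable_exponential_pdf al0).
have := integrableD measurableT i1 i2; apply: le_integrable => //.
  by apply/measurable_EFinP; exact: measurable_loggamma_fun.
move=> v _; rewrite -!EFinM -EFinD !abse_EFin lee_fin /loggamma_fun.
rewrite (ger0_norm (expR_ge0 _)).
have C0 : 0 <= C by rewrite divr_ge0 ?expR_ge0// ltW.
have e0 x : 0 <= exponential_pdf al x by apply: exponential_pdf_ge0; exact: ltW.
apply: le_trans (ler_norm _); rewrite -mulrDr.
have H : expR (al * v - expR v) <= C * (al * expR (- (al * `|v|))).
  rewrite /C mulrA divfK ?gt_eqF// -expRD ler_expR.
  have [v0|v0] := lerP 0 v.
    have := expR_ge1Dxn 1 v0; have := sqr_ge0 (2 * al - v).
    by rewrite ger0_norm//= (_ : 2`! = 2)%N//; nra.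
  have := expR_ge0 v; rewrite ltr0_norm//; have := sqr_ge0 al; nra.
apply: (le_trans H); rewrite ler_wpM2l//.
have [v0|v0] := lerP 0 v.
  rewrite ger0_norm// exponential_pdfE//.
  by rewrite -[leLHS]addr0 lerD// mulNr.
rewrite ltr0_norm// addrC exponential_pdfE ?oppr_ge0 ?(ltW v0)//.
by rewrite -[leLHS]addr0 lerD// mulNr.
Qed.

Definition loggamma_mass := \int[mu]_v loggamma_fun v.

Lemma loggamma_massE : (\int[mu]_v (loggamma_fun v)%:E = loggamma_mass%:E)%E.
Proof.
rewrite /loggamma_mass /Rintegral fineK//.
by apply: integrable_fin_num => //; exact: integrable_loggamma_fun.
Qed.

Lemma loggamma_mass_gt0 : 0 < loggamma_mass.
Proof.
rewrite -lte_fin -loggamma_massE.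
(* On [0, 1] the integrand is at least exp (- e), because al v >= 0 and exp v <= e. *)
apply: (@lt_le_trans _ _ (\int[mu]_(v in `[0%R, 1%R]) (expR (- expR 1))%:E)%E).
  rewrite integral_cst//= lebesgue_measure_itv/= lte_fin ltr01 oppr0 adde0 mule1.
  by rewrite lte_fin expR_gt0.
rewrite [leLHS]integral_mkcond; apply: ge0_le_integral => //.
- by move=> v _; apply: erestrict_ge0 => x _; rewrite lee_fin expR_ge0.
- by apply: (measurable_restrictT _ _).1 => //; exact: measurable_cst.
- by apply/measurable_EFinP; exact: measurable_loggamma_fun.
- move=> v _; rewrite patchE; case: ifP => [|_]; last by rewrite lee_fin expR_ge0.
  rewrite inE/= in_itv/= => /andP[v0 v1]; rewrite lee_fin ler_expR.
  by rewrite -[leLHS]add0r lerD ?mulr_ge0 ?(ltW al0)// lerN2 ler_expR.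
Qed.

Definition loggamma_pdf v := loggamma_mass^-1 * loggamma_fun v.

Lemma loggamma_pdf_ge0 v : 0 <= loggamma_pdf v.
Proof. by rewrite mulr_ge0 ?expR_ge0// invr_ge0 ltW// loggamma_mass_gt0. Qed.

Lemma measurable_loggamma_pdf : measurable_fun setT loggamma_pdf.
Proof. by apply: measurable_funM => //; exact: measurable_loggamma_fun. Qed.

Lemma integral_loggamma_pdf : (\int[mu]_v (loggamma_pdf v)%:E = 1)%E.
Proof.
under eq_integral do rewrite EFinM.
rewrite integralZl//; last exact: integrable_loggamma_fun.
by rewrite loggamma_massE -EFinM mulVf// lt0r_neq0// loggamma_mass_gt0.
Qed.

Definition loggamma : probability (measurableTypeR R) R :=
  density_prob loggamma_pdf_ge0 measurable_loggamma_pdf integral_loggamma_pdf.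

Lemma loggamma_laplace (c : R) : 0 <= c ->
  \int[loggamma]_v expR (- (c * expR v)) = (1 + c) `^ (- al).
Proof.
move=> c0; have c1 : 0 < 1 + c by lra.
have mf : measurable_fun [set: measurableTypeR R] (fun v => expR (- (c * expR v))).
  apply: (measurableT_comp (f := expR)) => //; apply: measurableT_comp => //.
  by apply: measurable_funM.
rewrite (Rintegral_density_prob _ _ _ (M := 1))//; last first.
  by move=> v; rewrite ger0_norm ?expR_ge0// -expR0 ler_expR oppr_le0 mulr_ge0// expR_ge0.
pose l := ln (1 + c).
pose g v := (1 + c) `^ (- al) * loggamma_pdf v.
have -> : \int[mu]_v (expR (- (c * expR v)) * loggamma_pdf v) =
    fine (\int[mu]_v (EFin \o g) (v + l)%R)%E.
  apply: (congr1 fine); apply: eq_integral => v _.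
  apply: (congr1 EFin); rewrite /g /loggamma_pdf /loggamma_fun mulrCA [RHS]mulrCA; congr (_ * _).
  have -> : expR (v + l) = expR v * (1 + c) by rewrite expRD lnK.
  rewrite /powR gt_eqF// -!expRD -/l; congr expR; ring.
rewrite (ge0_integral_shift l (f := EFin \o g)).
- rewrite /g; under eq_integral do rewrite /= EFinM.
  rewrite ge0_integralZl//.
  + by rewrite integral_loggamma_pdf mule1.
  + by apply/measurable_EFinP; exact: measurable_loggamma_pdf.
  + by move=> v _; rewrite lee_fin loggamma_pdf_ge0.
  + by rewrite lee_fin powR_ge0.
- by apply/measurable_EFinP; apply: measurable_funM => //; exact: measurable_loggamma_pdf.
- by move=> v; rewrite lee_fin mulr_ge0 ?powR_ge0 ?loggamma_pdf_ge0.
Qed.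

End log_gamma.

Section bessel_kernel.
Context {R : realType} {n : nat}.
Local Notation cube := (n.-tuple (measurableTypeR R)).
Variables (al lam : R).
Hypotheses (al0 : 0 < al) (lam0 : 0 <= lam).

(** The symbol of - Delta on the torus. *)
Definition bessel_base (k : 'rV[int]_n) : R := 4 * pi ^+ 2 * \sum_(i < n) (k 0 i)%:~R ^+ 2.

Lemma bessel_base_ge0 k : 0 <= bessel_base k.
Proof.
by apply: mulr_ge0; [rewrite mulr_ge0 ?sqr_ge0|apply: sumr_ge0 => i _; rewrite sqr_ge0].
Qed.

Definition kernel_prob := prod_probability (loggamma al0) (tuple_power (@std_normal R) n).

(* Gaussian subordination: conditionally on V, the characteristic function of
   [sqrt (2 * lam * exp V)] times a Gaussian vector at [2 * pi * k] is
   [exp (- lam * bessel_base k * exp V)], and averaging over the Gamma law of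
   [exp V] produces the symbol of [(I - lam Delta)^(- al)]. *)
Definition kernel_vec (w : measurableTypeR R * cube) : cube :=
  [tuple Num.sqrt (2 * lam * expR w.1) * tnth w.2 i | i < n].

Lemma measurable_kernel_vec : measurable_fun setT kernel_vec.
Proof.
apply: measurable_mktuple => i; apply: measurable_funM.
  apply: (measurableT_comp (f := fun x : measurableTypeR R => Num.sqrt x : measurableTypeR R)).
    by apply: continuous_measurable_fun; exact: sqrt_continuous.
  by apply: measurable_funM => //; apply: (measurableT_comp (f := expR)).
by apply: (measurableT_comp (f := fun x : cube => tnth x i)) => //; exact: measurable_tnth.
Qed.

Lemma dotk_kernel_vec (k : 'rV[int]_n) v (x : cube) :
  2 * pi * dotk k (row_of_cube (kernel_vec (v, x))) =
  dotc (fun i => 2 * pi * Num.sqrt (2 * lam * expR v) * (k 0 i)%:~R) x.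
Proof.
rewrite /dotk /dotc mulr_sumr; apply: eq_bigr => i _.
by rewrite mxE tnth_mktuple/=; ring.
Qed.

Let char (k : 'rV[int]_n) (v : R) :
  \sum_i (2 * pi * Num.sqrt (2 * lam * expR v) * (k 0 i)%:~R) ^+ 2 / 2 =
  lam * bessel_base k * expR v.
Proof.
rewrite /bessel_base mulr_sumr mulr_sumr mulr_suml; apply: eq_bigr => i _.
by rewrite !exprMn sqr_sqrtr ?mulr_ge0 ?expR_ge0//; field.
Qed.

Let mt (i : 'rV[int]_n * bool) : measurable_fun setT (fun w => cube_trig i (kernel_vec w)).
Proof. exact: (measurableT_comp (measurable_cube_trig i) measurable_kernel_vec). Qed.

Lemma kernel_cos k : \int[kernel_prob]_w cube_trig (k, true) (kernel_vec w) =
  (1 + lam * bessel_base k) `^ (- al).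
Proof.
rewrite (Rintegral_prod_probability _ _ (M := 1))//; last by move=> w; exact: trig_le1.
rewrite -(loggamma_laplace al0); last by rewrite mulr_ge0// bessel_base_ge0.
apply: eq_Rintegral => v _; rewrite -char.
rewrite -(gaussian_vector_char _).1; apply: eq_Rintegral => x _.
by rewrite /cube_trig /trig/= dotk_kernel_vec.
Qed.

Lemma kernel_sin k : \int[kernel_prob]_w cube_trig (k, false) (kernel_vec w) = 0.
Proof.
rewrite (Rintegral_prod_probability _ _ (M := 1))//; last by move=> w; exact: trig_le1.
rewrite (@eq_Rintegral _ _ _ _ _ (cst 0)) ?Rintegral_cst ?mul0r// => v _.
rewrite -[RHS](gaussian_vector_char
  (fun i => 2 * pi * Num.sqrt (2 * lam * expR v) * (k 0 i)%:~R)).2.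
by apply: eq_Rintegral => x _; rewrite /cube_trig /trig/= dotk_kernel_vec.
Qed.

End bessel_kernel.

(** * L^p bounds in terms of Fourier coefficients *)

Section riesz_fischer.
Context d (T : measurableType d) (R : realType) (P : probability T R).
Variables (p : R) (g : nat -> T -> R) (r : nat -> R) (S : R).
Hypothesis p1 : 1 < p.
Hypothesis mg : forall k, measurable_fun setT (g k).
Hypothesis gr : forall k, ('N[P]_(p%:E)[EFin \o g k] <= (r k)%:E)%E.
Hypothesis rS : forall n, \sum_(k < n) r k <= S.

Let p0 : 0 < p. Proof. exact: lt_trans p1. Qed.

Let G n x : R := \sum_(k < n) `|g k x|.

Let mG n : measurable_fun setT (G n).
Proof. by apply: measurable_sum => k; apply: measurableT_comp. Qed.

Let G0 n x : 0 <= G n x. Proof. by apply: sumr_ge0. Qed.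

Let ndG x : nondecreasing_seq (G ^~ x).
Proof. by apply/nondecreasing_seqP => n; rewrite /G big_ord_recr/= lerDl. Qed.

Let S0 : 0 <= S. Proof. by have := rS 0; rewrite big_ord0. Qed.

Let NG n : ('N[P]_(p%:E)[EFin \o G n] <= S%:E)%E.
Proof.
apply: (@le_trans _ _ (\sum_(k < n) r k)%:E); last by rewrite lee_fin.
elim: n => [|n IH].
  rewrite big_ord0 (_ : EFin \o G 0 = cst 0%E) ?Lnorm0 ?gt_eqF//.
  by apply/funext => x; rewrite /G/= big_ord0.
rewrite (_ : G n.+1 = (G n \+ (fun x => `|g n x|))%R); last first.
  by apply/funext => x; rewrite /G big_ord_recr.
have mgn : measurable_fun setT (fun x => `|g n x|) by exact: measurableT_comp.
apply: (le_trans (minkowski_EFin P (mG n) mgn (ltW p1))).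
rewrite big_ord_recr/= EFinD leeD// (le_trans _ (gr n))//.
rewrite [leLHS](_ : _ = 'N[P]_(p%:E)[abse \o (EFin \o g n)])%E//.
by rewrite Lnorm_abse.
Qed.

Let Gp n x : \bar R := ((G n x) `^ p)%:E.

Let mGp n : measurable_fun setT (Gp n).
Proof.
apply/measurable_EFinP.
by apply: (@measurableT_comp _ _ _ _ _ _ (fun x : R => x `^ p)) => //; exact: measurable_powR.
Qed.

Let ndGp x : nondecreasing_seq (Gp ^~ x).
Proof.
move=> m n mn; rewrite lee_fin ge0_ler_powR ?nnegrE ?(ltW p0)//.
exact: ndG.
Qed.

Let H x : \bar R := limn (Gp ^~ x).

Let GpH n x : (Gp n x <= H x)%E.
Proof.
rewrite /H (cvg_lim _ (ereal_nondecreasing_cvgn (ndGp x)))//.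
by apply: ereal_sup_ubound; exists n.
Qed.

Let H0 x : (0 <= H x)%E.
Proof. by apply: le_trans (GpH 0 x); rewrite lee_fin powR_ge0. Qed.

(** With [GpH], this dominates all partial sums by 1 + H, which is integrable because [P] is
    finite. *)
Let G1 n x : G n x <= 1 + G n x `^ p.
Proof.
have [Gn1|Gn1] := lerP (G n x) 1; first by rewrite (le_trans Gn1)// lerDl powR_ge0.
rewrite -[leLHS]add0r lerD// -[leLHS]powRr1// ler_powR// ltW//; exact: ltW.
Qed.

Let mH : measurable_fun setT H.
Proof.
apply: (emeasurable_fun_cvg Gp) => //.
by move=> x _; apply: ereal_nondecreasing_is_cvgn; exact: ndGp.
Qed.

Let int_H : (\int[P]_x H x <= (S `^ p)%:E)%E.
Proof.
rewrite monotone_convergence//; last by move=> n x _; rewrite lee_fin powR_ge0.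
apply: lime_le.
  apply: ereal_nondecreasing_is_cvgn => m n mn; apply: ge0_le_integral => //.
  - by move=> x _; rewrite lee_fin powR_ge0.
  - by move=> x _; exact: ndGp.
apply: nearW => n.
rewrite (_ : (\int[P]_x Gp n x)%E = ('N[P]_(p%:E)[EFin \o G n] `^ p)%E); last first.
  rewrite powR_Lnorm ?gt_eqF//; apply: eq_integral => x _.
  by rewrite /Gp/= ger0_norm// -poweR_EFin.
rewrite -poweR_EFin; apply: gt0_ler_poweR => //; first exact: ltW.
- by rewrite in_itv/= leey andbT Lnorm_ge0.
- by rewrite in_itv/= leey andbT lee_fin.
Qed.

Let ae_cvg : {ae P, forall x, setT x -> (H x < +oo)%E}.
Proof.
have i : P.-integrable setT H.
  apply/integrableP; split => //.
  under eq_integral do rewrite gee0_abs//.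
  exact: le_lt_trans int_H (ltry _).
apply: filterS (integrable_ae measurableT i) => x /(_ Logic.I) Hx _.
by rewrite ltey_eq Hx.
Qed.

Let F n x : R := \sum_(k < n) g k x.

Let mF n : measurable_fun setT (F n).
Proof. exact: measurable_sum. Qed.

Let FG n x : `|F n x| <= G n x. Proof. exact: ler_norm_sum. Qed.

(** An upper limit is measurable whether or not the series converges; where [H] is finite it is the
    sum of the series ([cvgF]). *)
Let f x := fine (limn_esup (fun n => (F n x)%:E)).

Let mf : measurable_fun setT f.
Proof.
apply: (measurableT_comp (f := fine)) => //.
by apply: measurable_fun_limn_esup => n; exact/measurable_EFinP.
Qed.

Let cvgF x : (H x < +oo)%E -> F n x @[n --> \oo] --> f x.
Proof.
move=> Hx; pose M := fine (H x).
have HM : H x = M%:E by rewrite fineK// ge0_fin_numE.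
have GM n : G n x <= 1 + M.
  apply: le_trans (G1 n x) _; rewrite lerD2l -lee_fin -HM; exact: GpH.
have cG : cvgn (G ^~ x).
  apply: nondecreasing_is_cvgn; first exact: ndG.
  by exists (1 + M) => _ [n _ <-]; exact: GM.
have cF : cvgn (F ^~ x).
  rewrite (_ : F ^~ x = series (g ^~ x)); last first.
    by apply/funext => n; rewrite /series/= big_mkord.
  apply: normed_cvg; move: cG; rewrite (_ : G ^~ x = [normed series (g ^~ x)])//.
  by apply/funext => n; rewrite /normed_series_of /series/= big_mkord.
have cE : (F n x)%:E @[n --> \oo] --> (limn (F ^~ x))%:E.
  by apply: cvg_EFin => //; exact: nearW.
rewrite /f is_cvg_limn_esupE; last by apply/cvg_ex; exists (limn (F ^~ x))%:E.
by rewrite (cvg_lim _ cE).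
Qed.

(** Completeness of L^p: by Minkowski and monotone convergence the sum of the |g k| has a finite
    p-th moment, so the series converges absolutely almost everywhere. The last clause, used with
    trigonometric monomials, identifies the coefficients of the sum. *)
Lemma riesz_fischer : exists f : T -> R,
  [/\ measurable_fun setT f, ('N[P]_(p%:E)[EFin \o f] <= S%:E)%E &
      forall e : T -> R, measurable_fun setT e -> (forall x, `|e x| <= 1) ->
      \sum_(k < n) \int[P]_x (g k x * e x) @[n --> \oo] --> \int[P]_x (f x * e x)].
Proof.
exists f; split; first exact: mf.
  rewrite unlock.
  have := @gt0_ler_poweR R p^-1; rewrite invr_ge0 (ltW p0) => /(_ isT) mono.
  apply: (@le_trans _ _ ((S `^ p)%:E `^ p^-1)%E); last first.
    by rewrite poweR_EFin -powRrM mulfV ?gt_eqF// powRr1.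
  apply: mono.
  - by rewrite in_itv/= leey andbT integral_ge0// => x _; rewrite poweR_ge0.
  - by rewrite in_itv/= leey andbT lee_fin powR_ge0.
  apply: le_trans int_H; apply: ae_ge0_le_integral => //.
  - by move=> x _; exact: poweR_ge0.
  - apply: (measurableT_comp (measurable_poweR _)); apply: measurableT_comp => //.
    exact/measurable_EFinP.
  apply: filterS ae_cvg => x /(_ Logic.I) Hx _ /=.
  have HM : H x = (fine (H x))%:E by rewrite fineK// ge0_fin_numE.
  have M0 : 0 <= fine (H x) by rewrite -lee_fin -HM.
  have GM n : G n x <= fine (H x) `^ p^-1.
    have -> : G n x = (G n x `^ p) `^ p^-1.
      by rewrite -powRrM mulfV ?gt_eqF// powRr1.
    rewrite ge0_ler_powR ?nnegrE ?powR_ge0 ?invr_ge0 ?(ltW p0)//.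
    by rewrite -lee_fin -HM; exact: GpH.
  have fM : `|f x| <= fine (H x) `^ p^-1.
    apply: (cvgr_to_le (cvg_norm (cvgF Hx))).
    by apply: nearW => n; exact: le_trans (FG n x) (GM n).
  rewrite HM lee_fin; apply: (@le_trans _ _ ((fine (H x) `^ p^-1) `^ p)).
    by rewrite ge0_ler_powR ?nnegrE ?powR_ge0 ?(ltW p0).
  by rewrite -powRrM mulVf ?gt_eqF// powRr1.
move=> e me e1.
have int_D : P.-integrable setT (fun x => 1 + H x)%E.
  apply: integrableD => //.
    by apply: (bounded_integrable P (M := 1) (f := cst 1)) => // x; rewrite normr1.
  apply/integrableP; split => //.
  under eq_integral do rewrite gee0_abs//.
  exact: le_lt_trans int_H (ltry _).
have FD n x : (`|F n x * e x|%:E <= 1 + H x)%E.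
  apply: (@le_trans _ _ (1 + Gp n x)%E); last by rewrite leeD2l// GpH.
  rewrite -EFinD lee_fin; apply: le_trans (G1 n x); apply: le_trans (FG n x).
  by rewrite normrM ler_piMr.
have mfe n : measurable_fun setT (fun x => (F n x * e x)%:E).
  by apply/measurable_EFinP; exact: measurable_funM.
have mfe' : measurable_fun setT (fun x => (f x * e x)%:E).
  by apply/measurable_EFinP; exact: measurable_funM.
have cfe : {ae P, forall x, setT x -> (F n x * e x)%:E @[n --> \oo] --> (f x * e x)%:E}.
  apply: filterS ae_cvg => x /(_ Logic.I) Hx _.
  apply: cvg_EFin; first exact: nearW.
  by apply: cvgMl; exact: cvgF.
have [int_fe _ cvgi] := @dominated_convergence _ _ _ P _ measurableT
  (fun n x => (F n x * e x)%:E) (fun x => (f x * e x)%:E) (fun x => 1 + H x)%E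
  mfe mfe' cfe int_D (aeW _ (fun x n _ => FD n x)).
have int_ge k : P.-integrable setT (EFin \o (fun x => g k x * e x)).
  have int_g : P.-integrable setT (EFin \o g k).
    apply/integrableP; split; first exact/measurable_EFinP.
    have := le_lt_trans (le_trans (Lnorm1_le P p1 (mg k)) (gr k)) (ltry _).
    by rewrite Lnorm1.
  apply: le_integrable int_g => //.
    by apply/measurable_EFinP; exact: measurable_funM.
  by move=> x _; rewrite !abse_EFin lee_fin normrM ler_piMr.
have E n : (\int[P]_x (F n x * e x)%:E = (\sum_(k < n) \int[P]_x (g k x * e x))%:E)%E.
  under eq_integral do rewrite /F mulr_suml -sumEFin.
  rewrite integral_sum//; last by move=> k; exact: int_ge.
  rewrite -sumEFin; apply: eq_bigr => k _.
  by rewrite /Rintegral fineK//; apply: integrable_fin_num => //; exact: int_ge.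
have -> : (fun n => \sum_(k < n) \int[P]_x (g k x * e x)) =
    fine \o (fun n => \int[P]_x (F n x * e x)%:E)%E.
  by apply/funext => n /=; rewrite E.
by apply: fine_cvg; rewrite fineK//; exact: integrable_fin_num.
Qed.

End riesz_fischer.

Section coefficient_norm.
Context {R : realType} {n : nat}.
Local Notation cube := (n.-tuple (measurableTypeR R)).
Local Notation tor := (@torus_measure R n).
Local Notation seqn := ('rV[int]_n * bool -> R).
Variable p : R.
Hypothesis p1 : 1 < p.

(* [bnd a r]: [a] is the family of the Fourier coefficients (against cosines
   and sines) of a real function whose L^p norm is at most [r + e], for every
   [e > 0]. *)
Definition bnd (a : seqn) (r : R) := forall e, 0 < e -> exists g : cube -> R,
  [/\ measurable_fun setT g, ('N[tor]_(p%:E)[EFin \o g] <= (r + e)%:E)%E &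
      forall i, coef g i = a i].

Lemma bnd_ge0 a r : bnd a r -> 0 <= r.
Proof.
move=> h; apply/ler_addgt0Pr => e e0; have [g [_ + _]] := h e e0.
by move=> /(le_trans (Lnorm_ge0 _ _ _)); rewrite lee_fin.
Qed.

Lemma bnd_inf a r : (forall e, 0 < e -> bnd a (r + e)) -> bnd a r.
Proof.
move=> h e e0; have e20 : 0 < e / 2 by rewrite divr_gt0.
by have := h _ e20 _ e20; rewrite -addrA -splitr.
Qed.

Lemma bnd_le a r r' : r <= r' -> bnd a r -> bnd a r'.
Proof.
move=> rr' h e e0; have [g [mg gn gc]] := h e e0; exists g; split => //.
by apply: le_trans gn _; rewrite lee_fin lerD2r.
Qed.

Lemma Lp_integrable (g : cube -> R) : measurable_fun setT g ->
  ('N[tor]_(p%:E)[EFin \o g] < +oo)%E -> tor.-integrable setT (EFin \o g).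
Proof.
move=> mg gp; apply/integrableP; split; first exact/measurable_EFinP.
by have := le_lt_trans (Lnorm1_le tor p1 mg) gp; rewrite Lnorm1.
Qed.

Lemma integrable_mul_trig (g : cube -> R) i : tor.-integrable setT (EFin \o g) ->
  tor.-integrable setT (EFin \o (fun x => g x * cube_trig i x)).
Proof.
move=> int_g; have /integrableP[/measurable_EFinP mg _] := int_g.
apply: le_integrable int_g => //.
  by apply/measurable_EFinP; apply: measurable_funM => //; exact: measurable_cube_trig.
by move=> x _; rewrite !abse_EFin lee_fin normrM ler_piMr// trig_le1.
Qed.

Lemma bnd_ext a b r : (forall i, a i = b i) -> bnd a r -> bnd b r.
Proof.
move=> ab h e e0; have [g [mg gn gc]] := h e e0; exists g; split => // i.
by rewrite gc.
Qed.

Lemma bnd0 : bnd (fun=> 0) 0.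
Proof.
move=> e e0; exists (cst 0); split => //.
  rewrite (_ : EFin \o cst 0 = cst 0%E)// Lnorm0; last by rewrite eqe gt_eqF// (lt_trans _ p1).
  by rewrite lee_fin add0r ltW.
move=> i; rewrite /coef (@eq_Rintegral _ _ _ _ _ (cst 0)) ?Rintegral_cst ?mul0r//.
by move=> x _; rewrite mul0r.
Qed.

Lemma bndD a b r r' : bnd a r -> bnd b r' -> bnd (fun i => a i + b i) (r + r').
Proof.
move=> ha hb e e0; have e20 : 0 < e / 2 by rewrite divr_gt0.
have [g [mg gn gc]] := ha _ e20; have [h [mh hn hc]] := hb _ e20.
exists (g \+ h)%R; split; first exact: measurable_funD.
  apply: le_trans (minkowski_EFin _ mg mh (ltW p1)) _.
  apply: le_trans (leeD gn hn) _; rewrite -EFinD lee_fin.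
  by rewrite [in leRHS](splitr e) addrACA.
have ig := Lp_integrable mg (le_lt_trans gn (ltry _)).
have ih := Lp_integrable mh (le_lt_trans hn (ltry _)).
move=> i; rewrite -gc -hc /coef -RintegralD//; last 2 first.
  exact: integrable_mul_trig.
  exact: integrable_mul_trig.
by apply: eq_Rintegral => x _; rewrite /= mulrDl.
Qed.

Lemma bndZ c a r : bnd a r -> bnd (fun i => c * a i) (`|c| * r).
Proof.
have [->|c0] := eqVneq c 0.
  move=> _; rewrite normr0 mul0r; apply: bnd_ext bnd0 => i; by rewrite mul0r.
have c00 : 0 < `|c| by rewrite normr_gt0.
move=> ha e e0; have e20 : 0 < e / `|c| by rewrite divr_gt0.
have [g [mg gn gc]] := ha _ e20.
have p0 : 0 < p by apply: lt_trans p1.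
exists (fun x => c * g x); split; first exact: measurable_funM.
  rewrite [leLHS](_ : _ = `|c|%:E * 'N[tor]_p%:E[EFin \o g])%E.
    apply: (@le_trans _ _ (`|c|%:E * (r + e / `|c|)%:E)%E).
      by rewrite lee_wpmul2l// lee_fin.
    by rewrite -EFinM lee_fin mulrDr mulrCA divff ?mulr1// gt_eqF.
  rewrite unlock.
  rewrite (eq_integral (fun x => (`|c| `^ p)%:E * `|(EFin \o g) x| `^ p)%E); last first.
    by move=> x _; rewrite /= normrM powRM.
  rewrite ge0_integralZl//.
  - rewrite poweRM ?lee_fin ?powR_ge0//; last first.
      by apply: integral_ge0 => x _; exact: poweR_ge0.
    by rewrite poweR_EFin -powRrM mulfV ?gt_eqF// powRr1.
  - apply: (measurableT_comp (measurable_poweR _)); apply/measurable_EFinP.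
    exact: measurableT_comp.
  - by move=> x _; exact: poweR_ge0.
have ig := Lp_integrable mg (le_lt_trans gn (ltry _)).
move=> i; rewrite -gc /coef -RintegralZl//; last exact: integrable_mul_trig.
by apply: eq_Rintegral => x _; rewrite mulrA.
Qed.

Lemma bnd_coef a r i : bnd a r -> `|a i| <= r.
Proof.
move=> h; apply/ler_addgt0Pr => e e0; have [g [mg gn <-]] := h e e0.
have ig := Lp_integrable mg (le_lt_trans gn (ltry _)).
rewrite -lee_fin; apply: le_trans gn; apply: le_trans (Lnorm1_le tor p1 mg).
rewrite /coef Lnorm1 EFin_normr_Rintegral//; last exact: integrable_mul_trig.
have igt := integrable_mul_trig i ig.
apply: le_trans (le_abse_integral _ _ _) _ => //.
  by case/integrableP: igt.
apply: ge0_le_integral => //.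
- by apply: measurableT_comp => //; case/integrableP: igt.
- by apply: measurableT_comp => //; exact/measurable_EFinP.
- by move=> x _; rewrite /= lee_fin normrM ler_piMr// trig_le1.
Qed.

(** [riesz_fischer] is applied to nearly optimal functions for each [a k], the slack [e] being
    shared out as e / 2^(k + 1). Testing against the monomials identifies the coefficients of the
    sum with the limit [b]. *)
Lemma bnd_series (a : nat -> seqn) (r : nat -> R) (S : R) (b : seqn) :
  (forall k, bnd (a k) (r k)) -> (forall m, \sum_(k < m) r k <= S) ->
  (forall i, \sum_(k < m) a k i @[m --> \oo] --> b i) -> bnd b S.
Proof.
move=> ar rS ab e e0.
pose ek (k : nat) : R := e / (2 ^ k.+1)%:R.
have ek0 k : 0 < ek k by rewrite divr_gt0// ltr0n expn_gt0.
have [g gP] := choice (fun k => ar k (ek k) (ek0 k)).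
have ekS m : \sum_(k < m) ek k <= e.
  have -> : \sum_(k < m) ek k = e - e / (2 ^ m)%:R.
    elim: m => [|m IH]; first by rewrite big_ord0 expn0 divr1 subrr.
    rewrite big_ord_recr/= IH /ek expnS natrM; field; rewrite pnatr_eq0 expn_eq0//.
  by rewrite lerBlDr lerDl divr_ge0// ltW.
have rS' m : \sum_(k < m) (r k + ek k) <= S + e 
  by rewrite big_split; apply: lerD; [exact: rS|exact: ekS].
have [f [mf fn fe]] := @riesz_fischer _ _ R tor p g (fun k => r k + ek k) (S + e) p1
  (fun k => let: And3 h _ _ := gP k in h) (fun k => let: And3 _ h _ := gP k in h)
  rS'.
exists f; split => // i.
have := fe (cube_trig i) (measurable_cube_trig i) (fun x => trig_le1 i _).
rewrite (_ : (fun m => _) = (fun m => \sum_(k < m) a k i)).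
  by move=> h; exact: (cvg_unique _ h (ab i)).
apply/funext => m; apply: eq_bigr => k _; have [_ _ <-] := gP k; by [].
Qed.

(** Convolution with the law of [kernel_vec]. The bound is the same for every [lam], which makes the
    later estimates uniform in the scale [rho]. *)
Lemma bnd_kernel (al lam : R) a r : 0 < al -> 0 <= lam -> bnd a r ->
  bnd (fun i => (1 + lam * bessel_base i.1) `^ (- al) * a i) r.
Proof.
move=> al0 lam0 h e e0; have [g [mg gn gc]] := h e e0.
have gp := le_lt_trans gn (ltry _).
have mk := @measurable_kernel_vec R n lam.
pose K := @kernel_prob R n al al0.
exists (convolution K (kernel_vec lam) g); split.
- exact: (measurable_convolution K mk p1 mg gp).
- exact: le_trans (Lnorm_convolution K mk p1 mg gp) gn.
- move=> [k b]; rewrite -gc.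
  exact: (coef_convolution mk (@kernel_cos R n al lam al0 lam0) (@kernel_sin R n al lam al0) p1 mg gp k b).
Qed.

End coefficient_norm.

(** * Fractional powers of the resolvent *)

Lemma gt0_powRD (R : realType) (x r s : R) : 0 < x -> x `^ (r + s) = x `^ r * x `^ s.
Proof. by move=> x0; rewrite powRD// (gt_eqF x0) implybT. Qed.

Section binomial_series.
Context {R : realType}.
Variable g : R.
Hypothesis g01 : 0 <= g <= 1.

(* The coefficients of the power series of [(1 - x)^(g - 1)]. *)
Fixpoint negbin (k : nat) : R :=
  match k with
  | 0 => 1
  | j.+1 => negbin j * ((j.+1%:R - g) / j.+1%:R)
  end.

Lemma negbinS k : k.+1%:R * negbin k.+1 = (k.+1%:R - g) * negbin k.
Proof. by rewrite /=; field; rewrite nat1r pnatr_eq0. Qed.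

Lemma negbin_ge0 k : 0 <= negbin k.
Proof.
elim: k => [|k IH] //=; rewrite mulr_ge0// divr_ge0// subr_ge0.
by apply: (@le_trans _ _ 1); [case/andP: g01|rewrite ler1n].
Qed.

Lemma negbin_decr k : negbin k.+1 <= negbin k.
Proof.
rewrite /= ler_piMr ?negbin_ge0// ler_pdivrMr ?ltr0n// mul1r lerBlDr lerDl.
by case/andP: g01.
Qed.

Lemma negbin_le1 k : negbin k <= 1.
Proof. by elim: k => [|k IH] //; exact: le_trans (negbin_decr k) IH. Qed.

Let F n x : R := \sum_(k < n.+1) negbin k * x ^+ k.
Let dF n x : R := \sum_(k < n.+1) k%:R * negbin k * x ^+ k.-1.

Let FS n x : F n.+1 x = F n x + negbin n.+1 * x ^+ n.+1.
Proof. by rewrite /F big_ord_recr. Qed.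

Let dFS n x : dF n.+1 x = dF n x + n.+1%:R * negbin n.+1 * x ^+ n.
Proof. by rewrite /dF big_ord_recr. Qed.

Let is_derive_F n (x : R) : is_derive x 1 (F n) (dF n x).
Proof.
elim: n => [|n IH].
  rewrite (_ : F 0 = cst 1); last first.
    by apply/funext => y; rewrite /F big_ord_recr big_ord0/= add0r mulr1.
  have -> : dF 0 x = 0 by rewrite /dF big_ord_recr big_ord0/= !mul0r addr0.
  exact: is_derive_cst.
have d c : is_derive x 1 (fun y : R => c * y ^+ n.+1) (n.+1%:R * c * x ^+ n).
  have := is_deriveM (is_derive_cst c x (1 : R)) (is_deriveX n.+1 (is_derive_id x (1 : R))).
  rewrite (_ : cst c * _ = (fun y : R => c * y ^+ n.+1)); last first.
    by apply/funext => y; rewrite !fctE.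
  by move=> h; apply: is_derive_eq; rewrite /GRing.scale/=; ring.
rewrite (_ : F n.+1 = (F n + (fun y => negbin n.+1 * y ^+ n.+1))); last first.
  by apply/funext => y; rewrite FS.
by rewrite dFS; apply: is_deriveD.
Qed.

(* Up to the last term, the partial sums solve the equation of
   [(1 - x)^(g - 1)]; so [F n x * (1 - x)^(1 - g)] is almost constant. *)
Let F_ode n x : (1 - x) * dF n x = (1 - g) * F n x - n.+1%:R * negbin n.+1 * x ^+ n.
Proof.
elim: n => [|n IH].
  by rewrite /dF /F !big_ord_recr !big_ord0 /=; field.
rewrite dFS FS mulrDr IH (negbinS n.+1) !exprS -[n.+2%:R]natr1; ring.
Qed.

Lemma cvg_negbin_bound (D x : R) : 0 < x < 1 ->
  D * (n.+1%:R * x ^+ n.+1) @[n --> \oo] --> (0 : R).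
Proof.
move=> /andP[x0 x1]; pose t := - ln x.
have t0 : 0 < t by rewrite oppr_gt0 ln_lt0// x0.
rewrite -[X in _ --> X](mulr0 D); apply: cvgMr.
(* With x = exp (- t), the inequality exp ((n + 1) t) >= ((n + 1) t)^2 / 2 bounds the term by a
   multiple of 1 / (n + 1). *)
apply: (@squeeze_cvgr _ _ _ _ (fun=> 0) (fun n => 2 / t ^+ 2 * n.+1%:R^-1)).
- near=> n; rewrite mulr_ge0 ?exprn_ge0 ?(ltW x0)//=.
  have -> : x ^+ n.+1 = (expR (n.+1%:R * t))^-1.
    by rewrite -expRN /t mulrN opprK expRM_natl lnK.
  have n0 : (0 : R) < n.+1%:R by rewrite ltr0n.
  have h : (n.+1%:R * t) ^+ 2 / 2 <= expR (n.+1%:R * t).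
    apply: le_trans (@expR_ge1Dxn _ _ 1 _); first by rewrite lerDr.
    by rewrite mulr_ge0// ltW.
  have h0 : 0 < (n.+1%:R * t) ^+ 2 / 2 by rewrite divr_gt0// exprn_gt0// mulr_gt0.
  apply: (@le_trans _ _ (n.+1%:R * ((n.+1%:R * t) ^+ 2 / 2)^-1)).
    rewrite ler_wpM2l//; rewrite lef_pV2 ?posrE ?expR_gt0//.
  rewrite le_eqVlt; apply/orP; left; apply/eqP; field.
  by rewrite !gt_eqF.
- exact: cvg_cst.
- rewrite -[X in _ --> X](mulr0 (2 / t ^+ 2)); apply: cvgMr.
  exact: cvg_harmonic.
Unshelve. all: by end_near. Qed.

Lemma cvg_negbin_series (x : R) : 0 < x < 1 -> F n x @[n --> \oo] --> (1 - x) `^ (g - 1).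
Proof.
move=> x01; have [x0 x1] := andP x01; have [g0 g1] := andP g01.
have h1 : 0 < 1 - x by rewrite subr_gt0.
suff : F n x * (1 - x) `^ (1 - g) @[n --> \oo] --> (1 : R).
  move=> h.
  have -> : (fun n => F n x) = (fun n => F n x * (1 - x) `^ (1 - g) * (1 - x) `^ (g - 1)).
    apply/funext => n; rewrite -mulrA -gt0_powRD//.
    by rewrite addrA subrK subrr powRr0 mulr1.
  by rewrite -[X in _ --> X]mul1r; apply: cvgMl.
(* [D] bounds (1 - c)^(- g) at the intermediate point c < x of the mean value theorem, applied below
   to [E] on [0, x]; there E 0 = 1 and only the last term of [F_ode] is left in the derivative. *)
pose D := (1 - x) `^ (- g).
apply/cvgrPdist_le => e e0.
have /cvgr0_norm_le/(_ e e0) := cvg_negbin_bound D x01.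
apply: filterS => n; apply: le_trans.
pose E y := F n y * (1 - y) `^ (1 - g).
pose dE y : R := - (n.+1%:R * negbin n.+1 * y ^+ n * (1 - y) `^ (- g)).
have dEP (y : R) : y < 1 -> is_derive y 1 E (dE y).
  move=> y1; have y10 : 0 < 1 - y by rewrite subr_gt0.
  have d1 : is_derive y 1 (fun y : R => 1 - y) (- 1).
    by have := is_deriveB (is_derive_cst (1 : R) y (1 : R)) (is_derive_id y (1 : R)); rewrite sub0r.
  have d2 : is_derive y 1 ((fun u : R => u `^ (1 - g)) \o (fun y : R => 1 - y))
      ((1 - g) * (1 - y) `^ (1 - g - 1) * - 1).
    by apply: is_derive1_comp; exact: is_derive1_powR.
  have d3 := is_derive_F n y.
  have d4 : is_derive y 1 E (F n y * ((1 - g) * (1 - y) `^ (1 - g - 1) * - 1) +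
      (1 - y) `^ (1 - g) * dF n y) := is_deriveM d3 d2.
  suff <- : F n y * ((1 - g) * (1 - y) `^ (1 - g - 1) * - 1) +
      (1 - y) `^ (1 - g) * dF n y = dE y by exact: d4.
  rewrite /dE.
  have -> : (1 - y) `^ (1 - g) = (1 - y) * (1 - y) `^ (- g).
    by rewrite gt0_powRD// powRr1// ltW.
  have -> : 1 - g - 1 = - g by ring.
  have := F_ode n y; set X := dF n y; set Y := F n y => ode.
  rewrite [X in _ + X]mulrAC [(1 - y) * X]ode; ring.
have E0 : E 0 = 1.
  rewrite /E subr0 powR1 mulr1 /F big_ord_recl big1 ?addr0 ?expr0 ?mulr1//.
  by move=> i _; rewrite expr0n/= mulr0.
have H1 (y : R) : y \in `]0, x[ -> is_derive y 1 E (dE y).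
  by rewrite in_itv/= => /andP[_ yx]; apply: dEP; exact: lt_trans x1.
have H2 : {within `[0, x], continuous E}.
  apply: derivable_within_continuous => y; rewrite in_itv/= => /andP[_ yx].
  by have [] := dEP y (le_lt_trans yx x1).
have [c] := MVT x0 H1 H2; rewrite in_itv/= => /andP[c0 cx].
rewrite E0 subr0 -/(E x) distrC => ->; rewrite /dE.
move: (negbin n.+1) (negbin_ge0 n.+1) (negbin_le1 n.+1) => b b0 b1; rewrite !normrM normrN !normrM.
have D0 : 0 <= D by exact: powR_ge0.
rewrite !(ger0_norm D0) (ger0_norm (powR_ge0 _ _)) !(ger0_norm (ltW x0)) !normrX.
rewrite (ger0_norm (ltW x0)) (ger0_norm (ltW c0)) ger0_norm// (ger0_norm b0).
rewrite exprSr !mulrA ler_wpM2r ?(ltW x0)//.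
rewrite [leRHS](_ : _ = n.+1%:R * 1 * x ^+ n * D); last by ring.
apply: ler_pM => //.
- by rewrite !mulr_ge0 ?exprn_ge0 ?(ltW c0).
- exact: powR_ge0.
- apply: ler_pM; rewrite ?mulr_ge0 ?exprn_ge0 ?(ltW c0)//.
    by rewrite ler_wpM2l.
  by rewrite lerXn2r ?nnegrE ?(ltW c0) ?(ltW x0)// ltW.
- have cx1 : 0 < 1 - c by rewrite subr_gt0 (lt_trans cx).
  rewrite /D !powRN lef_pV2 ?posrE ?powR_gt0//.
  by rewrite ge0_ler_powR ?nnegrE ?(ltW h1) ?(ltW cx1)// lerB// ltW.
Qed.

End binomial_series.

Section multipliers.
Context {R : realType} {n : nat}.
Local Notation seqn := ('rV[int]_n * bool -> R).
Variable p : R.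
Hypothesis p1 : 1 < p.

Definition bes (i : 'rV[int]_n * bool) : R := 1 + bessel_base i.1.

Lemma bes_ge1 i : 1 <= bes i.
Proof. by rewrite lerDl bessel_base_ge0. Qed.

Lemma bes_gt0 i : 0 < bes i.
Proof. exact: lt_le_trans (bes_ge1 i). Qed.

Lemma bnd_bessel (al : R) (a : seqn) r : 0 <= al -> bnd p a r ->
  bnd p (fun i => bes i `^ (- al) * a i) r.
Proof.
rewrite le_eqVlt => /predU1P[<-|al0] h.
  by apply: bnd_ext h => i; rewrite oppr0 powRr0 mul1r.
by apply: bnd_ext (bnd_kernel p1 al0 ler01 h) => i; rewrite mul1r.
Qed.

Variable rho : R.
Hypothesis rho0 : 0 < rho.

Let z i := rho * bes i.
Let q i := (1 + z i)^-1.

Let z0 i : 0 < z i. Proof. by rewrite mulr_gt0// bes_gt0. Qed.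

Let z1 i : 0 < 1 + z i. Proof. by rewrite addr_gt0// z0. Qed.

Let q01 i : 0 < q i < 1.
Proof. by rewrite invr_gt0 z1 invf_lt1 ?z1// ltrDl z0. Qed.

(** With b the symbol of - Delta, 1 + rho (1 + b) = (1 + rho) (1 + lam b) for lam = rho / (1 + rho).
    The multiplier is thus a kernel symbol times (1 + rho)^(- al) <= 1. *)
Lemma bnd_resolvent_pow (al : R) (a : seqn) r : 0 <= al -> bnd p a r ->
  bnd p (fun i => q i `^ al * a i) r.
Proof.
rewrite le_eqVlt => /predU1P[<-|al0] h.
  by apply: bnd_ext h => i; rewrite powRr0 mul1r.
have lam0 : 0 <= rho / (1 + rho) by rewrite divr_ge0 ?addr_ge0 ?(ltW rho0).
have r10 : 0 < 1 + rho by rewrite addr_gt0.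
have := bndZ p1 ((1 + rho) `^ (- al)) (bnd_kernel p1 al0 lam0 h).
have c1 : `|(1 + rho) `^ (- al)| <= 1.
  rewrite ger0_norm ?powR_ge0// powRN invf_le1 ?powR_gt0//.
  by rewrite -[leLHS](powRr0 (1 + rho)) ler_powR ?(ltW al0)// lerDl ltW.
move=> /(bnd_le (r' := r)) h2; apply: (bnd_ext _ (h2 _)).
  move=> i; rewrite mulrA -powRM ?(ltW r10)//; last first.
    by rewrite addr_ge0// mulr_ge0// bessel_base_ge0.
  congr (_ * _); rewrite /q -(powR_inv1 (ltW (z1 i))) -powRrM mulN1r; congr (_ `^ _).
  by rewrite /z /bes; field; rewrite gt_eqF.
by rewrite ler_piMl// (bnd_ge0 h).
Qed.

(* The power series of [(1 - x)^g] has absolutely summable coefficients: they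
   are the increments of the decreasing sequence [negbin g]. *)
Lemma bnd_1Bresolvent_pow (g : R) (a : seqn) r : 0 <= g <= 1 -> bnd p a r ->
  bnd p (fun i => (1 - q i) `^ g * a i) (2 * r).
Proof.
move=> g01 h; have r0 := bnd_ge0 h.
pose c k : R := if k is j.+1 then negbin g j.+1 - negbin g j else 1.
have hk k : bnd p (fun i => c k * (q i `^ k%:R * a i)) (`|c k| * r).
  by apply: bndZ => //; exact: bnd_resolvent_pow.
apply: (bnd_series p1 hk).
- move=> m; rewrite -mulr_suml ler_wpM2r//.
  (* The absolute values telescope from [negbin g 0 = 1], and the initial coefficient adds 1: this
     is the constant 2 of the lemma. *)
  have E l : \sum_(k < l.+1) `|c k| = 2 - negbin g l.
    elim: l => [|l IH]; first by rewrite big_ord_recr big_ord0/= normr1; ring.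
    rewrite big_ord_recr/= IH ler0_norm; first by ring.
    by rewrite subr_le0; exact: negbin_decr.
  case: m => [|m]; first by rewrite big_ord0.
  by rewrite E lerBlDr lerDl negbin_ge0.
- move=> i; have qi := q01 i.
  have q0 : 0 <= q i by case/andP: qi => /ltW.
  have E m : \sum_(k < m) c k * (q i `^ k%:R * a i) = (\sum_(k < m) c k * q i ^+ k) * a i.
    by rewrite mulr_suml; apply: eq_bigr => k _; rewrite powR_mulrn// mulrA.
  under eq_cvg do rewrite E.
  apply: cvgMl.
  rewrite -(cvg_shiftn 2)/=.
  pose SA m := \sum_(k < m.+1) negbin g k * q i ^+ k.
  pose SC m := \sum_(k < m) c k * q i ^+ k.
  have SAS m : SA m.+1 = SA m + negbin g m.+1 * q i ^+ m.+1 by rewrite /SA big_ord_recr.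
  have SCS m : SC m.+1 = SC m + c m * q i ^+ m by rewrite /SC big_ord_recr.
  have cS m : c m.+1 = negbin g m.+1 - negbin g m by [].
  (* Summation by parts: the series of increments is (1 - q) times that of (1 - q)^(g - 1), up to a
     boundary term tending to 0. *)
  have E2 (m : nat) : SC (m + 2)%N = (1 - q i) * SA m + negbin g m.+1 * q i ^+ m.+1.
    rewrite addn2; elim: m => [|m IH].
      by rewrite /SC /SA !big_ord_recr !big_ord0/= ; ring.
    rewrite SCS IH SAS cS (exprS _ m.+1); ring.
  under eq_cvg do rewrite -/(SC _) E2.
  have q1 : 0 < 1 - q i by case/andP: qi => _; rewrite subr_gt0.
  have -> : (1 - q i) `^ g = (1 - q i) * (1 - q i) `^ (g - 1) + 0.
    rewrite addr0 -[X in X * _](powRr1 (ltW q1)) -gt0_powRD//.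
    by congr (_ `^ _); ring.
  apply: cvgD; first by apply: cvgMr; exact: cvg_negbin_series.
  apply: (@squeeze_cvgr _ _ _ _ (fun=> 0) (fun m => q i ^+ m.+1)).
  + apply: nearW => m; apply/andP; split; first by rewrite mulr_ge0 ?negbin_ge0 ?exprn_ge0.
    by apply: ler_piMl; [rewrite exprn_ge0|exact: negbin_le1].
  + exact: cvg_cst.
  + rewrite (cvg_shiftS (fun m => q i ^+ m)); apply: cvg_expr.
    by rewrite ger0_norm//; case/andP: qi.
Qed.

(* With [z = rho * bes] and [q = 1 / (1 + z)], the identity used is
   [z^g = (1 - q)^g * q^(s - g) * (q^(1 - s) + (1 - q)^(1 - s) * z^s)]. *)
Lemma bnd_moment (s g : R) (a : seqn) (A B : R) : 0 < s <= 1 -> 0 <= g <= s ->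
  bnd p a A -> bnd p (fun i => (rho * bes i) `^ s * a i) B ->
  bnd p (fun i => (rho * bes i) `^ g * a i) (2 * (A + 2 * B)).
Proof.
move=> /andP[s0 s1] /andP[g0 gs] hA hB.
have h1 : bnd p (fun i => q i `^ (1 - s) * a i) A.
  by apply: bnd_resolvent_pow => //; rewrite subr_ge0.
have h2 : bnd p (fun i => (1 - q i) `^ (1 - s) * (z i `^ s * a i)) (2 * B).
  by apply: bnd_1Bresolvent_pow => //; rewrite subr_ge0 s1/= lerBlDr lerDl ltW.
have h3 := bndD p1 h1 h2.
have h4 : bnd p _ _ := bnd_resolvent_pow (al := s - g) _ h3.
have h5 := bnd_1Bresolvent_pow (g := g) _ (h4 _).
apply: (bnd_ext _ (h5 _ _)) => [i||]; last 2 first.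
- by rewrite g0 (le_trans gs).
- by rewrite subr_ge0.
have zi := ltW (z0 i); have qi : 0 <= q i by have /andP[/ltW] := q01 i.
have E : 1 - q i = z i * q i by rewrite /q; field; rewrite gt_eqF// z1.
have q0 : 0 < q i by have /andP[] := q01 i.
have qz : q i * (1 + z i) = 1 by rewrite mulVf// gt_eqF// z1.
rewrite E -[rho * bes i]/(z i) !(powRM _ zi qi).
rewrite (_ : _ * (_ * _) = z i `^ g * (q i `^ g * q i `^ (s - g) * q i `^ (1 - s)) *
  (1 + z i `^ (1 - s) * z i `^ s) * a i); last by ring.
rewrite -!gt0_powRD//.
rewrite (_ : g + (s - g) + (1 - s) = 1); last by ring.
by rewrite subrK !powRr1// -[X in X * a i = _]mulrA qz mulr1.
Qed.

End multipliers.

(** * Bochner integrals *)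

Section norm_of_coefficients.
Context {R : realType} {n : nat}.
Local Notation seqn := ('rV[int]_n * bool -> R).
Variable p : R.
Hypothesis p1 : 1 < p.

(* [inf set0 = 0], so that [nrm a] is meaningful only when [fincoef a]. *)
Definition fincoef (a : seqn) := exists r, bnd p a r.
Definition nrm (a : seqn) : R := inf [set r | bnd p a r].

Let lb (a : seqn) : has_lbound [set r | bnd p a r].
Proof. by exists 0 => r /bnd_ge0. Qed.

Lemma nrm_le a r : bnd p a r -> nrm a <= r.
Proof. by move=> h; apply: ge_inf. Qed.

Lemma nrm_ge0 a : 0 <= nrm a.
Proof.
have [[r h]|h] := pselect (fincoef a).
  by apply: lb_le_inf; [exists r|move=> x /bnd_ge0].
rewrite /nrm (_ : [set r | bnd p a r] = set0) ?inf0//.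
by apply/seteqP; split => // r hr; apply: h; exists r.
Qed.

Lemma bnd_nrm a : fincoef a -> bnd p a (nrm a).
Proof.
move=> [r h]; apply: bnd_inf => e e0.
have [|x hx xe] := @inf_adherent _ [set r | bnd p a r] e e0; first by split; [exists r|exact: lb].
exact: bnd_le (ltW xe) hx.
Qed.

Lemma fincoef0 : fincoef (fun=> 0).
Proof. by exists 0; exact: bnd0. Qed.

Lemma fincoefD a b : fincoef a -> fincoef b -> fincoef (fun i => a i + b i).
Proof. by move=> [r ha] [s hb]; exists (r + s); exact: bndD. Qed.

Lemma fincoefZ c a : fincoef a -> fincoef (fun i => c * a i).
Proof. by move=> [r ha]; exists (`|c| * r); exact: bndZ. Qed.

Lemma fincoefB a b : fincoef a -> fincoef b -> fincoef (fun i => a i - b i).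
Proof.
move=> ha hb; have := fincoefD ha (fincoefZ (- 1) hb).
by rewrite (_ : (fun i => a i + -1 * b i) = (fun i => a i - b i))//; apply/funext => i; rewrite mulN1r.
Qed.

Lemma nrmD a b : fincoef a -> fincoef b -> nrm (fun i => a i + b i) <= nrm a + nrm b.
Proof. by move=> ha hb; apply: nrm_le; apply: bndD => //; exact: bnd_nrm. Qed.

Lemma nrm0 : nrm (fun=> 0) = 0.
Proof. by apply/eqP; rewrite eq_le nrm_ge0 andbT; apply: nrm_le; exact: bnd0. Qed.

Lemma nrmN a : nrm (fun i => - a i) = nrm a.
Proof.
have H b : nrm (fun i => - b i) <= nrm b.
  have [h|h] := pselect (fincoef b).
    apply: nrm_le; rewrite -[nrm b]mul1r -normr1 -normrN.
    by apply: bnd_ext (bndZ p1 (- 1) (bnd_nrm h)) => i; rewrite mulN1r.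
  rewrite [leLHS](_ : _ = 0) ?nrm_ge0//.
  rewrite /nrm (_ : [set r | _] = set0) ?inf0//.
  apply/seteqP; split => // r hr; apply: h; exists (`|- 1| * r).
  by apply: bnd_ext (bndZ p1 (- 1) hr) => i; rewrite mulN1r opprK.
apply/eqP; rewrite eq_le H/=; apply: le_trans (H _).
by rewrite (_ : (fun i => - - a i) = a)//; apply/funext => i; rewrite opprK.
Qed.

Lemma nrmBC a b : nrm (fun i => a i - b i) = nrm (fun i => b i - a i).
Proof. by rewrite -nrmN; congr nrm; apply/funext => i; rewrite opprB. Qed.

Lemma nrmB_triangle a b c : fincoef a -> fincoef b -> fincoef c ->
  nrm (fun i => a i - b i) <= nrm (fun i => a i - c i) + nrm (fun i => b i - c i).
Proof.
move=> ha hb hc; rewrite [X in _ + X]nrmBC.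
apply: le_trans (nrmD (fincoefB ha hc) (fincoefB hc hb)).
by rewrite le_eqVlt; apply/orP; left; apply/eqP; congr nrm; apply/funext => i; ring.
Qed.

Lemma ler_nrmB a b : fincoef a -> fincoef b -> `|nrm a - nrm b| <= nrm (fun i => a i - b i).
Proof.
have H c d : fincoef c -> fincoef d -> nrm c - nrm d <= nrm (fun i => c i - d i).
  move=> hc hd; rewrite lerBlDr; apply: le_trans (nrmD (fincoefB hc hd) hd).
  by rewrite le_eqVlt; apply/orP; left; apply/eqP; congr nrm; apply/funext => i; ring.
move=> ha hb; rewrite ler_norml H// andbT lerNl opprB nrmBC; exact: H.
Qed.

Lemma le_coef_nrm a i : fincoef a -> `|a i| <= nrm a.
Proof. by move=> /bnd_nrm h; exact: (bnd_coef p1 i h). Qed.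

(** A subsequence starting at [m] is telescoped and summed by [bnd_series]. In the sum of the bounds
    [E m] occurs once and every later error at most twice; the thresholds d / 2^(j + 2) make the
    later ones contribute at most d. *)
Lemma bnd_cauchy (a : nat -> seqn) (E : nat -> R) (b : seqn) m :
  (forall j k, bnd p (fun i => a k i - a j i) (E k + E j)) ->
  E k @[k --> \oo] --> (0 : R) -> (forall i, a k i @[k --> \oo] --> b i) ->
  bnd p (fun i => b i - a m i) (E m).
Proof.
move=> aE E0 ab; apply: bnd_inf => d d0.
have d2 (j : nat) : 0 < d / (2 ^ j.+2)%:R by rewrite divr_gt0// ltr0n expn_gt0.
have /choice[N NP] : forall j, exists N, forall k, (N <= k)%N -> E k <= d / (2 ^ j.+2)%:R.
  move=> j; move/cvgrPdist_le : E0 => /(_ _ (d2 j))[N _ HN]; exists N => k Nk.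
  by have := HN k Nk; rewrite sub0r normrN; apply: le_trans; exact: ler_norm.
pose f := fix f j := if j is l.+1 then maxn (f l).+1 (N l) else m.
have fS j : (f j < f j.+1)%N by rewrite /= leq_maxl.
have fE j : E (f j.+1) <= d / (2 ^ j.+2)%:R by apply: NP; rewrite /= leq_maxr.
have fj j : (j <= f j)%N.
  by elim: j => // j IH; apply: leq_ltn_trans IH _; exact: fS.
have E0' k : 0 <= E k by have := bnd_ge0 (aE k k); rewrite -mulr2n pmulrn_lge0.
apply: (bnd_series p1 (fun k => aE (f k) (f k.+1))).
- move=> l.
  suff: \sum_(k < l) (E (f k.+1) + E (f k)) + E (f l) <= E m + d - d / (2 ^ l)%:R.
    have := E0' (f l); have : 0 <= d / (2 ^ l)%:R by rewrite divr_ge0// ltW.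
    by move=> h1 h2 h3; lra.
  elim: l => [|l IH]; first by rewrite big_ord0 expn0 divr1 addrK add0r.
  rewrite big_ord_recr; have := fE l; rewrite !expnS !natrM.
  have -> : d / (2 * (2 * (2 ^ l)%:R)) = d / (2 ^ l)%:R / 4.
    by field; rewrite pnatr_eq0 expn_eq0.
  have -> : d / (2 * (2 ^ l)%:R) = d / (2 ^ l)%:R / 2.
    by field; rewrite pnatr_eq0 expn_eq0.
  move: (E (f l.+1)) (d / (2 ^ l)%:R) IH => e D IH h.
  change (\sum_(i < l) (E (f i.+1) + E (f i)) + (e + E (f l)) + e <= E m + d - D / 2).
  by lra.
- move=> i.
  have E1 l : \sum_(k < l) (a (f k.+1) i - a (f k) i) = a (f l) i - a m i.
    elim: l => [|l IH]; first by rewrite big_ord0 subrr.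
    by rewrite big_ord_recr IH/=; ring.
  under eq_cvg do rewrite E1.
  apply: cvgB; last exact: cvg_cst.
  apply: (cvg_comp f (a ^~ i) _ (ab i)).
  apply/cvgnyPge => A; near=> k; apply: leq_trans (fj k); near: k.
  exact: nbhs_infty_ge.
Unshelve. all: by end_near. Qed.

End norm_of_coefficients.

Section simple_functions.
Context {R : realType} {n : nat}.
Local Notation mu := (@lebesgue_measure R).
Local Notation seqn := ('rV[int]_n * bool -> R).
Variable p : R.
Hypothesis p1 : 1 < p.
Local Notation nrm := (nrm p).
Local Notation fincoef := (fincoef p).

(** A list lends itself to induction. Its sets may overlap, as in [simple_fun]. *)
Definition simple_value (s : seq (set (measurableTypeR R) * seqn)) (t : R) : seqn :=
  fun i => \sum_(x <- s) \1_(x.1) t * x.2 i.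

Definition simple_data (s : seq (set (measurableTypeR R) * seqn)) :=
  foldr (fun x Q => [/\ measurable x.1, fincoef x.2 & Q]) True s.

Lemma simple_value_cons x s t i :
  simple_value (x :: s) t i = \1_(x.1) t * x.2 i + simple_value s t i.
Proof. by rewrite /simple_value big_cons. Qed.

Lemma fincoef_simple s t : simple_data s -> fincoef (simple_value s t).
Proof.
elim: s => [_|x s IH [mx fx /IH fs]].
  rewrite (_ : simple_value [::] t = (fun=> 0)); first exact: fincoef0.
  by apply/funext => i; rewrite /simple_value big_nil.
rewrite (_ : simple_value _ t = (fun i => \1_(x.1) t * x.2 i + simple_value s t i)).
  by apply: fincoefD => //; exact: fincoefZ.
by apply/funext => i; rewrite simple_value_cons.
Qed.

Lemma simple_split x s (c : seqn) t :
  (fun i => c i + simple_value (x :: s) t i) =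
  if t \in x.1 then (fun i => (c i + x.2 i) + simple_value s t i)
  else (fun i => c i + simple_value s t i).
Proof.
apply/funext => i; rewrite simple_value_cons indicE; case: (t \in x.1) => /=.
  by rewrite mul1r addrA.
by rewrite mul0r add0r.
Qed.

Lemma measurable_nrm_simple s (c : seqn) : simple_data s ->
  measurable_fun [set: measurableTypeR R] (fun t => nrm (fun i => c i + simple_value s t i)).
Proof.
elim: s c => [|x s IH] c.
  move=> _; rewrite (_ : (fun t => _) = cst (nrm c)); first exact: measurable_cst.
  apply/funext => t; congr nrm; apply/funext => i.
  by rewrite /simple_value big_nil addr0.
move=> [mx fx fs].
rewrite (_ : (fun t => _) = (fun t => if t \in x.1 then nrm (fun i => (c i + x.2 i) + simple_value s t i)
  else nrm (fun i => c i + simple_value s t i))); last first.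
  by apply/funext => t; rewrite simple_split; case: ifP.
apply: measurable_fun_ifT; [|exact: IH|exact: IH].
apply: (measurable_fun_bool true); rewrite setTI (_ : _ @^-1` _ = x.1)//.
by apply/seteqP; split => t; [exact: set_mem|exact: mem_set].
Qed.

Lemma measurable_simple s i : simple_data s ->
  measurable_fun [set: measurableTypeR R] (fun t => simple_value s t i).
Proof.
elim: s => [|x s IH].
  move=> _; rewrite (_ : (fun t => _) = cst 0); first exact: measurable_cst.
  by apply/funext => t; rewrite /simple_value big_nil.
move=> [mx fx fs].
under eq_fun do rewrite simple_value_cons.
by apply: measurable_funD; [apply: measurable_funM => //; exact: measurable_indic|exact: IH].
Qed.

(** The constant [c] and the weight [eta] are generalized for the induction: [eta] is split along
    the first set of the list, and on that set the corresponding coefficients are absorbed into [c].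
    Overlapping sets are thereby treated without a disjoint normal form and without loss in the
    bound. *)
Lemma integral_simple s (eta : measurableTypeR R -> R) (c : seqn) : simple_data s -> fincoef c ->
  mu.-integrable setT (EFin \o eta) ->
  [/\ mu.-integrable setT (EFin \o (fun t => `|eta t| * nrm (fun i => c i + simple_value s t i))),
      forall i, mu.-integrable setT (EFin \o (fun t => eta t * (c i + simple_value s t i))) &
      bnd p (fun i => \int[mu]_t (eta t * (c i + simple_value s t i)))
        (\int[mu]_t (`|eta t| * nrm (fun i => c i + simple_value s t i)))].
Proof.
elim: s eta c => [|x s IH] eta c.
  move=> _ fc ieta.
  have s0 t i : c i + simple_value [::] t i = c i by rewrite /simple_value big_nil addr0.
  have E1 : (fun t => `|eta t| * nrm (fun i => c i + simple_value [::] t i)) = (fun t => `|eta t| * nrm c).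
    by apply/funext => t; congr (_ * nrm _); apply/funext => i; rewrite s0.
  have E2 i : (fun t => eta t * (c i + simple_value [::] t i)) = (fun t => eta t * c i).
    by apply/funext => t; rewrite s0.
  have iab : mu.-integrable setT (EFin \o (fun t => `|eta t|)) by exact: (integrable_norm ieta).
  rewrite E1; split.
  - exact: (integrableZr measurableT (nrm c) iab).
  - by move=> i; rewrite E2; exact: (integrableZr measurableT (c i) ieta).
  - rewrite RintegralZr//.
    apply: (@bnd_le _ _ p _ (`|\int[mu]_t eta t| * nrm c)).
      by rewrite ler_wpM2r ?nrm_ge0// le_normr_Rintegral.
    apply: bnd_ext (bndZ p1 (\int[mu]_t eta t) (bnd_nrm fc)) => i.
    by rewrite E2 RintegralZr.
move=> [mx fx fs] fc ieta.
pose e1 t := eta t * \1_(x.1) t; pose e2 t := eta t * \1_(~` x.1) t.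
have ie A : measurable A -> mu.-integrable setT (EFin \o (fun t => eta t * \1_A t)).
  move=> mA; have /integrableP[/measurable_EFinP meta _] := ieta.
  apply: le_integrable ieta => //.
    by apply/measurable_EFinP; apply: measurable_funM => //; exact: measurable_indic.
  move=> t _; rewrite !abse_EFin lee_fin normrM ler_piMr// indicE.
  by case: (_ \in _) => /=; rewrite ?normr1 ?normr0.
have [h1 h2 h3] := IH e1 _ fs (fincoefD p1 fc fx) (ie _ mx).
have [k1 k2 k3] := IH e2 _ fs fc (ie _ (measurableC mx)).
have eE t : (t \in ~` x.1) = ~~ (t \in x.1) by rewrite in_setC.
have F1 : (fun t => `|eta t| * nrm (fun i => c i + simple_value (x :: s) t i)) =
   ((fun t => `|e1 t| * nrm (fun i => (c i + x.2 i) + simple_value s t i)) \+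
   (fun t => `|e2 t| * nrm (fun i => c i + simple_value s t i)))%R.
  apply/funext => t; rewrite simple_split /e1 /e2 /= !indicE eE.
  case: (t \in x.1) => /=; first by rewrite mulr1 mulr0 normr0 mul0r addr0.
  by rewrite mulr0 mulr1 normr0 mul0r add0r.
have F2 i : (fun t => eta t * (c i + simple_value (x :: s) t i)) =
   ((fun t => e1 t * ((c i + x.2 i) + simple_value s t i)) \+
   (fun t => e2 t * (c i + simple_value s t i)))%R.
  apply/funext => t; rewrite simple_value_cons /e1 /e2 /= !indicE eE.
  by case: (t \in x.1) => /=; ring.
split.
- rewrite F1; exact: (integrableD measurableT h1 k1).
- by move=> i; rewrite F2; exact: (integrableD measurableT (h2 i) (k2 i)).
- rewrite F1 RintegralD//; apply: bnd_ext (bndD p1 h3 k3) => i.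
  by rewrite F2 RintegralD.
Qed.

End simple_functions.

Lemma dominated_Rintegral {disp} {T : measurableType disp} {R : realType}
    (m : {measure set T -> \bar R}) (f_ : nat -> T -> R) (f g : T -> R) :
  (forall n, measurable_fun setT (f_ n)) ->
  (forall x, f_ n x @[n --> \oo] --> f x) ->
  m.-integrable setT (EFin \o g) -> (forall n x, `|f_ n x| <= g x) ->
  m.-integrable setT (EFin \o f) /\
  (\int[m]_x f_ n x) @[n --> \oo] --> \int[m]_x f x.
Proof.
move=> mf cf ig fg.
have mf' : measurable_fun setT f.
  by apply: (measurable_fun_cvg mf) => x _; exact: cf.
have cf' : {ae m, forall x, setT x -> (f_ n x)%:E @[n --> \oo] --> (f x)%:E}.
  by apply: aeW => x _; apply: cvg_EFin (cf x); exact: nearW.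
have [intf _ cvgi] := @dominated_convergence _ _ _ m _ measurableT
  (fun n => EFin \o f_ n) (EFin \o f) (EFin \o g)
  (fun n => proj2 (measurable_EFinP setT (f_ n)) (mf n)) (proj2 (measurable_EFinP setT f) mf')
  cf'
  ig (aeW _ (fun x n _ => fg n x)).
split => //; apply: fine_cvg; rewrite /Rintegral fineK; first exact: cvgi.
exact: integrable_fin_num.
Qed.

Section bochner_integral.
Context {R : realType} {n : nat}.
Local Notation mu := (@lebesgue_measure R).
Local Notation seqn := ('rV[int]_n * bool -> R).
Local Notation dataset := (seq (set (measurableTypeR R) * seqn)).
Variable p : R.
Hypothesis p1 : 1 < p.
Local Notation nrm := (nrm p).
Local Notation fincoef := (fincoef p).
Local Notation simple_data := (simple_data p).

Lemma simple_data_cat (s s' : dataset) : simple_data s -> simple_data s' ->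
  simple_data (s ++ s').
Proof. by move=> h h'; elim: s h => // x s IH [? ? /IH ?]. Qed.

Lemma simple_value_cat (s s' : dataset) t i :
  simple_value (s ++ s') t i = simple_value s t i + simple_value s' t i.
Proof. by rewrite /simple_value big_cat. Qed.

Definition simple_scale (c : R) (s : dataset) : dataset :=
  [seq (x.1, fun i => c * x.2 i) | x <- s].

Lemma simple_data_scale c s : simple_data s -> simple_data (simple_scale c s).
Proof. by elim: s => // x s IH [? ? /IH ?]; split => //; exact: fincoefZ. Qed.

Lemma simple_value_scale c s t i :
  simple_value (simple_scale c s) t i = c * simple_value s t i.
Proof.
rewrite /simple_value big_map mulr_sumr; apply: eq_bigr => x _ /=.
by rewrite mulrCA.
Qed.

Definition simple_restrict (A : set (measurableTypeR R)) (s : dataset) : dataset :=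
  [seq (x.1 `&` A, x.2) | x <- s].

Lemma simple_data_restrict A s : measurable A -> simple_data s ->
  simple_data (simple_restrict A s).
Proof. by move=> mA; elim: s => // x s IH [? ? /IH ?]; split => //; exact: measurableI. Qed.

Lemma simple_value_restrict A s t i :
  simple_value (simple_restrict A s) t i = \1_A t * simple_value s t i.
Proof.
rewrite /simple_value big_map mulr_sumr; apply: eq_bigr => x _ /=.
by rewrite indicI /= mulrCA mulrA.
Qed.

Section limit_of_simple.
Variables (s_ : nat -> dataset) (a : R -> seqn).
Hypothesis s_data : forall k, simple_data (s_ k).
Hypothesis a_fin : forall t, fincoef (a t).
Hypothesis s_cvg : forall t,
  nrm (fun i => simple_value (s_ k) t i - a t i) @[k --> \oo] --> (0 : R).

Lemma measurable_nrmB (s : dataset) : simple_data s ->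
  measurable_fun [set: measurableTypeR R] (fun t => nrm (fun i => simple_value s t i - a t i)).
Proof.
move=> hs; apply: (@measurable_fun_cvg _ _ _ setT
  (fun k t => nrm (fun i => simple_value s t i - simple_value (s_ k) t i))).
  move=> k; have := measurable_nrm_simple (fun=> 0)
    (simple_data_cat hs (simple_data_scale (- 1) (s_data k))).
  apply: eq_measurable_fun => t _; congr nrm; apply/funext => i.
  by rewrite add0r simple_value_cat simple_value_scale mulN1r.
move=> t _; apply/cvgrPdist_le => e e0.
have /cvgrPdist_le/(_ e e0) := s_cvg t; apply: filterS => k; rewrite sub0r normrN => h.
apply: le_trans (ler_nrmB _ _ _) _ => //;
  [by apply: fincoefB => //; exact: fincoef_simple|by apply: fincoefB => //; exact: fincoef_simple|].
rewrite (_ : (fun i => _) = (fun i => simple_value (s_ k) t i - a t i)).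
  by apply: le_trans h; exact: ler_norm.
by apply/funext => i; ring.
Qed.

Lemma measurable_nrm : measurable_fun [set: measurableTypeR R] (fun t => nrm (a t)).
Proof.
have := @measurable_nrmB [::] I.
apply: eq_measurable_fun => t _; rewrite -[RHS](nrmN p1); congr nrm; apply/funext => i.
by rewrite /simple_value big_nil sub0r.
Qed.

Lemma measurable_limit_simple i : measurable_fun [set: measurableTypeR R] (fun t => a t i).
Proof.
apply: (@measurable_fun_cvg _ _ _ setT (fun k t => simple_value (s_ k) t i)).
  by move=> k; exact: (measurable_simple i (s_data k)).
move=> t _; apply/cvgrPdist_le => e e0.
have /cvgrPdist_le/(_ e e0) := s_cvg t; apply: filterS => k; rewrite sub0r normrN distrC => h.
apply: le_trans (le_coef_nrm (a := fun i => simple_value (s_ k) t i - a t i) p1 i _) _.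
  by apply: fincoefB => //; exact: fincoef_simple.
by apply: le_trans h; exact: ler_norm.
Qed.

Variable eta : measurableTypeR R -> R.
Hypothesis ieta : mu.-integrable setT (EFin \o eta).
Hypothesis ietag : mu.-integrable setT (EFin \o (fun t => `|eta t| * nrm (a t))).

Let err k t := nrm (fun i => simple_value (s_ k) t i - a t i).
Let D k : set (measurableTypeR R) := [set t | err k t <= nrm (a t)].
(* Cutting the approximants off where their error exceeds [nrm (a t)] provides
   the domination needed to pass to the limit. *)
Let s' k := simple_restrict (D k) (s_ k).
Let err' k t := nrm (fun i => simple_value (s' k) t i - a t i).

Let mD k : measurable (D k).
Proof.
rewrite -[D k]setTI (_ : D k = (fun t => err k t <= nrm (a t)) @^-1` [set true]).
  by apply: measurable_fun_ler => //; [exact: measurable_nrmB|exact: measurable_nrm].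
by apply/seteqP; split.
Qed.

Let s'_data k : simple_data (s' k).
Proof. exact: simple_data_restrict. Qed.

Let err'E k t : err' k t = if t \in D k then err k t else nrm (a t).
Proof.
rewrite /err' /err; case: ifPn => tD.
  by congr nrm; apply/funext => i; rewrite simple_value_restrict indicE tD mul1r.
rewrite -[RHS](nrmN p1); congr nrm; apply/funext => i.
by rewrite simple_value_restrict indicE (negbTE tD) mul0r sub0r.
Qed.

Let err'_le k t : err' k t <= nrm (a t).
Proof. by rewrite err'E; case: ifPn => // /set_mem. Qed.

Let err'_le2 k t : err' k t <= err k t.
Proof.
rewrite err'E; case: ifPn => // /negP h; apply: ltW; rewrite ltNge; apply/negP => h2.
by apply: h; apply/mem_set.
Qed.

Let err'_cvg t : err' k t @[k --> \oo] --> (0 : R).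
Proof.
apply: (@squeeze_cvgr _ _ _ _ (fun=> 0) (err ^~ t)) (s_cvg t).
  by near=> k; rewrite nrm_ge0 err'_le2.
exact: cvg_cst.
Unshelve. all: by end_near. Qed.

Let meta : measurable_fun [set: measurableTypeR R] eta.
Proof. by case/integrableP : ieta => /measurable_EFinP. Qed.

Let E k := \int[mu]_t (`|eta t| * err' k t).

Let int_err' k : mu.-integrable setT (EFin \o (fun t => `|eta t| * err' k t)).
Proof.
have h := ietag; apply: le_integrable h => //.
  apply/measurable_EFinP; apply: measurable_funM; first exact: measurableT_comp.
  exact: measurable_nrmB.
move=> t _; rewrite !abse_EFin lee_fin !normrM ler_wpM2l//.
by rewrite !ger0_norm ?nrm_ge0.
Qed.

Let E_cvg : E k @[k --> \oo] --> (0 : R).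
Proof.
have [|||_] := @dominated_Rintegral _ _ _ mu (fun k t => `|eta t| * err' k t) (fun=> 0) _ _ _ ietag _.
- move=> k; apply: measurable_funM; first exact: measurableT_comp.
  exact: measurable_nrmB.
- move=> t; rewrite -[X in _ --> X](mulr0 `|eta t|); apply: cvgMr; exact: err'_cvg.
- move=> k t; rewrite normrM normr_id ger0_norm ?nrm_ge0// ler_wpM2l//.
- by rewrite Rintegral_cst ?mul0r.
Qed.

Let S k i := \int[mu]_t (eta t * simple_value (s' k) t i).

Lemma bochner_integrable i : mu.-integrable setT (EFin \o (fun t => eta t * a t i)).
Proof.
have h := ietag; apply: le_integrable h => //.
  by apply/measurable_EFinP; apply: measurable_funM => //; exact: measurable_limit_simple.
move=> t _; rewrite !abse_EFin lee_fin !normrM normr_id ler_wpM2l//.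
by rewrite [leRHS]ger0_norm ?nrm_ge0// le_coef_nrm.
Qed.

Let nrm_s' k t : nrm (simple_value (s' k) t) <= 2 * nrm (a t).
Proof.
have := ler_nrmB p1 (fincoef_simple p1 t (s'_data k)) (a_fin t).
move=> /(le_trans (ler_norm _)); have := err'_le k t; rewrite /err'.
by set x := nrm (fun i => _); lra.
Qed.

Let S_cvg i : S k i @[k --> \oo] --> \int[mu]_t (eta t * a t i).
Proof.
have i2 : mu.-integrable setT (EFin \o (fun t => 2 * (`|eta t| * nrm (a t)))).
  exact: (integrableZl measurableT 2 ietag).
have [|||//] := @dominated_Rintegral _ _ _ mu (fun k t => eta t * simple_value (s' k) t i)
   (fun t => eta t * a t i) _ _ _ i2 _.
- move=> k; apply: measurable_funM => //; exact: (measurable_simple _ (s'_data k)).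
- move=> t; apply: cvgMr; apply/cvgrPdist_le => e e0.
  have /cvgrPdist_le/(_ e e0) := @err'_cvg t; apply: filterS => k; rewrite sub0r normrN distrC => h.
  apply: le_trans (le_coef_nrm (a := fun i => simple_value (s' k) t i - a t i) p1 i _) _.
    by apply: fincoefB => //; exact: fincoef_simple.
  by apply: le_trans h; exact: ler_norm.
- move=> k t; rewrite normrM mulrCA ler_wpM2l//.
  by apply: le_trans (nrm_s' k t); apply: le_coef_nrm => //; exact: fincoef_simple.
Qed.

(** The integrals [S k] of the truncated approximants obey this bound and are Cauchy with errors
    [E k], so that [bnd_cauchy] transfers it to the limit. The factor 2 is that of [nrm_s']: an
    approximant has norm at most that of [a t] plus an error cut off at the same size. *)
Lemma bochner_bnd : bnd p (fun i => \int[mu]_t (eta t * a t i))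
  (2 * \int[mu]_t (`|eta t| * nrm (a t))).
Proof.
have bS k : bnd p (S k) (2 * \int[mu]_t (`|eta t| * nrm (a t))).
  have [h1 h2 h3] := integral_simple p1 (s'_data k) (fincoef0 p1) ieta.
  apply: (bnd_ext _ (bnd_le _ h3)) => [i|].
    by apply: eq_Rintegral => t _; rewrite add0r.
  rewrite -RintegralZl//; apply: le_Rintegral => //; first exact: (integrableZl measurableT 2 ietag).
  move=> t _; rewrite mulrCA ler_wpM2l//; apply: le_trans (nrm_s' k t).
  by rewrite le_eqVlt; apply/orP; left; apply/eqP; congr nrm; apply/funext => i; rewrite add0r.
have bSS j k : bnd p (fun i => S k i - S j i) (E k + E j).
  have [h1 h2 h3] := integral_simple p1 (simple_data_cat (s'_data k)
    (simple_data_scale (- 1) (s'_data j))) (fincoef0 p1) ieta.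
  have iS l i : mu.-integrable setT (EFin \o (fun t => eta t * simple_value (s' l) t i)).
    have [_ /(_ i) h _] := integral_simple p1 (s'_data l) (fincoef0 p1) ieta.
    apply: eq_integrable h => // t _; by rewrite /= add0r.
  apply: (bnd_ext _ (bnd_le _ h3)) => [i|].
    rewrite /S -RintegralB//; apply: eq_Rintegral => t _.
    by rewrite add0r simple_value_cat simple_value_scale mulN1r mulrBr.
  rewrite /E -RintegralD//; apply: le_Rintegral => //.
    exact: (integrableD measurableT (int_err' k) (int_err' j)).
  move=> t _; rewrite -mulrDr ler_wpM2l//.
  apply: le_trans (nrmB_triangle p1 (fincoef_simple p1 t (s'_data k))
    (fincoef_simple p1 t (s'_data j)) (a_fin t)).
  rewrite le_eqVlt; apply/orP; left; apply/eqP; congr nrm; apply/funext => i.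
  by rewrite add0r simple_value_cat simple_value_scale mulN1r.
have bE m := bnd_cauchy p1 m bSS E_cvg S_cvg.
apply: bnd_inf => e e0.
move/cvgrPdist_le : E_cvg => /(_ e e0)[N _ /(_ N (leqnn _))]; rewrite sub0r normrN => hN.
apply: bnd_ext (bnd_le _ (bndD p1 (bS N) (bE N))) => [i|]; first by rewrite addrC subrK.
by rewrite lerD2l; apply: le_trans hN; exact: ler_norm.
Qed.

End limit_of_simple.

End bochner_integral.

(** * A smooth step *)

Section smooth_step.
Context {R : realType}.

(** Derivation of exp (- 1/x) brings out powers of 1/x; with the exponent [k] the family is stable
    under derivation up to linear combinations ([is_derive_flat]). *)
Definition flat (k : nat) (x : R) : R := if 0 < x then x^-1 ^+ k * expR (- x^-1) else 0.

Lemma flat_gt0 k x : 0 < x -> 0 < flat k x.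
Proof. by move=> x0; rewrite /flat x0 mulr_gt0 ?exprn_gt0 ?invr_gt0// expR_gt0. Qed.

Lemma flat_le0 k x : x <= 0 -> flat k x = 0.
Proof. by move=> x0; rewrite /flat ltNge x0. Qed.

Lemma flat_ge0 k x : 0 <= flat k x.
Proof. by have [/flat_le0->//|/(flat_gt0 k)/ltW] := leP x 0. Qed.

(** The term of order k + 2 of the exponential series leaves two spare powers of x, so that
    difference quotients at 0 are at most a multiple of |x|. *)
Lemma flat_le_sqr k x : flat k x <= (k.+2)`!%:R * x ^+ 2.
Proof.
have [x0|x0] := leP x 0; first by rewrite flat_le0// mulr_ge0// sqr_ge0.
have f0 : (0 : R) < (k.+2)`!%:R by rewrite ltr0n fact_gt0.
have h : x^-1 ^+ k.+2 / (k.+2)`!%:R <= expR x^-1.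
  apply: le_trans (@expR_ge1Dxn _ _ k.+1 _); first by rewrite lerDr.
  by rewrite invr_ge0 ltW.
rewrite /flat x0 expRN ler_pdivrMr ?expR_gt0//.
apply: (@le_trans _ _ ((k.+2)`!%:R * x ^+ 2 * (x^-1 ^+ k.+2 / (k.+2)`!%:R))); last first.
  by rewrite ler_wpM2l// mulr_ge0// ?sqr_ge0// ltW.
rewrite le_eqVlt; apply/orP; left; apply/eqP; rewrite !exprS; field.
by rewrite !gt_eqF.
Qed.

Lemma is_derive_flat (k : nat) (x : R) : is_derive x 1 (flat k) (flat k.+2 x - k%:R * flat k.+1 x).
Proof.
have [x0|x0|->] := ltgtP x 0.
- rewrite !flat_le0 ?(ltW x0)// mulr0 subr0.
  apply: near_eq_is_derive (is_derive_cst (0 : R) x (1 : R)).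
  near=> y; rewrite flat_le0//; near: y; apply: filterS (lt_nbhsl x0); by move=> y /ltW.
- rewrite /flat x0.
  have dV : is_derive x 1 (fun y : R => y^-1) (- x ^- 2).
    have := is_deriveV (lt0r_neq0 x0) (is_derive_id x (1 : R)).
    by rewrite /GRing.scale/= mulr1.
  have dN : is_derive x 1 (fun y : R => - y^-1) (x ^- 2).
    by have := is_deriveN dV; rewrite opprK.
  have dE : is_derive x 1 (expR \o (fun y : R => - y^-1)) (expR (- x^-1) * x ^- 2).
    exact: is_derive1_comp.
  have dX : is_derive x 1 (fun y : R => y^-1 ^+ k) (k%:R * x^-1 ^+ k.-1 * - x ^- 2).
    have := is_deriveX k dV.
    rewrite (_ : _ ^+ k = (fun y : R => y^-1 ^+ k)); last by apply/funext => y; rewrite fctE.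
    move=> h; apply: is_derive_eq; by rewrite /GRing.scale/=; ring.
  have dM : is_derive x 1 (fun y : R => y^-1 ^+ k * expR (- y^-1)) _ := is_deriveM dX dE.
  apply: near_eq_is_derive (is_derive_eq dM _).
  + by near=> y; rewrite ifT//; near: y; exact: lt_nbhsr.
  + rewrite /GRing.scale/=; case: k {dX dM} => [|k]; rewrite ?expr0 /= -?exprVn !exprS; ring.
- rewrite !flat_le0// mulr0 subr0.
  have h : (fun h : R => h^-1 *: (flat k (h *: 1 + 0) - flat k 0)) @ 0^' --> (0 : R).
    apply/cvgr0Pnorm_le => e e0.
    have f0 : (0 : R) < (k.+2)`!%:R by rewrite ltr0n fact_gt0.
    near=> y.
    have y0 : y != 0 by near: y; exact: nbhs_dnbhs_neq.
    rewrite (flat_le0 _ (lexx 0)) subr0 addr0 /GRing.scale/= mulr1 normrM normfV.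
    rewrite (ger0_norm (flat_ge0 _ _)) mulrC ler_pdivrMr ?normr_gt0//.
    apply: le_trans (flat_le_sqr _ _) _.
    rewrite -real_normK ?num_real// exprS expr1 mulrA ler_wpM2r// mulrC -ler_pdivlMr//.
    near: y; apply: dnbhs0_le; by rewrite divr_gt0.
  split; [by apply/cvg_ex; exists 0; exact: h|exact: cvg_lim h].
Unshelve. all: by end_near. Qed.

Definition flat_denom (x : R) := flat 0 x + flat 0 (1 - x).

Lemma flat_denom_gt0 x : 0 < flat_denom x.
Proof.
rewrite /flat_denom; have [x0|x0] := leP x 0.
  by rewrite ltr_wpDl ?flat_ge0// flat_gt0// subr_gt0 (le_lt_trans x0).
by rewrite ltr_wpDr ?flat_ge0// flat_gt0.
Qed.

(* A class of functions stable under derivation, which contains the quotient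
   defining [smooth_step]: its elements are therefore infinitely derivable. *)
Inductive smooth_class : (R -> R) -> Prop :=
| smooth_flat k : smooth_class (flat k)
| smooth_inv : smooth_class (fun x => (flat_denom x)^-1)
| smooth_cst c : smooth_class (fun=> c)
| smooth_add f g : smooth_class f -> smooth_class g -> smooth_class (fun x => f x + g x)
| smooth_mul f g : smooth_class f -> smooth_class g -> smooth_class (fun x => f x * g x)
| smooth_affine f a b : smooth_class f -> smooth_class (fun x => f (a * x + b)).

Lemma is_derive_affine (f : R -> R) (a b x df : R) : is_derive (a * x + b) 1 f df ->
  is_derive x 1 (fun x => f (a * x + b)) (df * a).
Proof.
move=> h.
have d1 : is_derive x 1 (fun y : R => a * y + b) a.
  have := is_deriveD (is_deriveM (is_derive_cst a x (1 : R)) (is_derive_id x (1 : R)))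
    (is_derive_cst b x (1 : R)).
  by move=> g; apply: is_derive_eq; rewrite /GRing.scale/=; ring.
exact: (@is_derive1_comp _ f (fun y : R => a * y + b) x _ _ h d1).
Qed.

Lemma smooth_class_derive f : smooth_class f ->
  exists2 f', smooth_class f' & forall x : R, is_derive x 1 f (f' x).
Proof.
elim=> {f}.
- move=> k; exists (fun x => flat k.+2 x + (- k%:R) * flat k.+1 x).
    by apply: smooth_add; [exact: smooth_flat|apply: smooth_mul; [exact: smooth_cst|exact: smooth_flat]].
  by move=> x; rewrite mulNr; exact: is_derive_flat.
- pose D' x := flat 2 x + (-1) * flat 2 ((-1) * x + 1).
  have sD' : smooth_class D'.
    apply: smooth_add; first exact: smooth_flat.
    apply: smooth_mul; first exact: smooth_cst.
    by apply: smooth_affine; exact: smooth_flat.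
  exists (fun x => ((-1) * D' x) * ((flat_denom x)^-1 * (flat_denom x)^-1)).
    by apply: smooth_mul; apply: smooth_mul => //; [exact: smooth_cst|exact: smooth_inv|exact: smooth_inv].
  move=> x.
  have d1 : is_derive x 1 flat_denom (D' x).
    have h0 := is_derive_flat 0 x; have h1 := is_derive_affine (is_derive_flat 0 (-1 * x + 1)).
    have := is_deriveD h0 h1.
    rewrite (_ : _ + _ = flat_denom); last first.
      by apply/funext => y; rewrite /flat_denom/= !fctE; congr (_ + flat 0 _); ring.
    by move=> h; apply: is_derive_eq; rewrite /D' !mul0r !subr0; ring.
  have := is_deriveV (lt0r_neq0 (flat_denom_gt0 x)) d1.
  move=> h; apply: is_derive_eq; rewrite /GRing.scale/= exprS expr1 invfM; ring.
- by move=> c; exists (fun=> 0); [exact: smooth_cst|move=> x; exact: is_derive_cst].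
- move=> f g sf [f' sf' df] sg [g' sg' dg].
  exists (fun x => f' x + g' x); first exact: smooth_add.
  by move=> x; exact: (is_deriveD (df x) (dg x)).
- move=> f g sf [f' sf' df] sg [g' sg' dg].
  exists (fun x => f x * g' x + g x * f' x).
    by apply: smooth_add; exact: smooth_mul.
  by move=> x; exact: (is_deriveM (df x) (dg x)).
- move=> f a b sf [f' sf' df]; exists (fun x => f' (a * x + b) * a).
    by apply: smooth_mul; [exact: smooth_affine|exact: smooth_cst].
  by move=> x; exact: is_derive_affine.
Qed.

Lemma smooth_class_derive1 f : smooth_class f -> smooth_class (f^`())%classic.
Proof.
move=> /smooth_class_derive[f' sf' df].
by rewrite (_ : (f^`())%classic = f')//; apply/funext => x; rewrite derive1E derive_val.
Qed.

Lemma smooth_class_is_derive f (x : R) : smooth_class f -> is_derive x 1 f ((f^`())%classic x).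
Proof.
by move=> /smooth_class_derive[f' sf' /(_ x) df]; rewrite derive1E derive_val.
Qed.

Lemma smooth_class_derivable f n (x : R) : smooth_class f -> derivable ((f^`(n))%classic) x 1.
Proof.
move=> sf; suff : smooth_class ((f^`(n))%classic) by move=> /smooth_class_derive[f' _ /(_ x)[]].
by elim: n => [|n IH]; rewrite ?derive1n0 ?derive1nS//; exact: smooth_class_derive1.
Qed.

Lemma smooth_class_continuous f : smooth_class f -> continuous f.
Proof.
move=> sf x; apply: differentiable_continuous; apply/derivable1_diffP.
by have [] := smooth_class_is_derive x sf.
Qed.

(** The affine change maps [1/4, 3/4] onto [0, 1]. The step is therefore already constant near 0 and
    near 1, which leaves the margin needed to obtain test functions from intervals touching 0 or
    T. *)
Definition smooth_step (x : R) := flat 0 (2 * x - 1 / 2) * (flat_denom (2 * x - 1 / 2))^-1.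

Lemma smooth_class_step : smooth_class smooth_step.
Proof.
apply: (@smooth_affine (fun y => flat 0 y * (flat_denom y)^-1) 2 (- (1 / 2))).
by apply: smooth_mul; [exact: smooth_flat|exact: smooth_inv].
Qed.

Lemma smooth_step0 x : x <= 1 / 4 -> smooth_step x = 0.
Proof. by move=> h; rewrite /smooth_step flat_le0 ?mul0r//; lra. Qed.

Lemma smooth_step1 x : 3 / 4 <= x -> smooth_step x = 1.
Proof.
rewrite /smooth_step /flat_denom => h; set y := 2 * x - 1 / 2.
have y1 : 1 <= y by rewrite /y; lra.
by rewrite (@flat_le0 0 (1 - y)) ?subr_le0// addr0 divff// gt_eqF// flat_gt0//; lra.
Qed.

Lemma smooth_step_ge0 x : 0 <= smooth_step x.
Proof. by rewrite mulr_ge0 ?flat_ge0// invr_ge0 ltW// flat_denom_gt0. Qed.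

Lemma smooth_step_le1 x : smooth_step x <= 1.
Proof.
rewrite /smooth_step; set y := 2 * x - 1 / 2.
by rewrite ler_pdivrMr ?flat_denom_gt0// mul1r /flat_denom lerDl flat_ge0.
Qed.

Lemma derive_smooth_step0 x : (x < 1 / 4) || (3 / 4 < x) -> (smooth_step^`())%classic x = 0.
Proof.
move=> h; rewrite derive1E; apply: derive_val.
have [x0|x1] := orP h.
- apply: near_eq_is_derive (is_derive_cst (0 : R) x (1 : R)).
  near=> y; rewrite smooth_step0//; near: y; apply: filterS (lt_nbhsl x0).
  by move=> y; lra.
- apply: near_eq_is_derive (is_derive_cst (1 : R) x (1 : R)).
  near=> y; rewrite smooth_step1//; near: y; apply: filterS (lt_nbhsr x1).
  by move=> y; lra.
Unshelve. all: by end_near. Qed.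

Lemma derive_smooth_step_bounded :
  exists2 K, 0 < K & forall x, `|(smooth_step^`())%classic x| <= K.
Proof.
have cS := smooth_class_continuous (smooth_class_derive1 smooth_class_step).
have [|c _ hc] := @EVT_max R (fun x => `|(smooth_step^`())%classic x|) 0 1 ler01.
  apply: continuous_subspaceT => x; apply: continuous_comp; first exact: cS.
  exact: norm_continuous.
exists (1 + `|(smooth_step^`())%classic c|); first by rewrite ltr_pwDl.
move=> x; have [x01|] := boolP (x \in `[0, 1]).
  by apply: le_trans (hc x x01) _; rewrite lerDr.
rewrite in_itv/= => h; rewrite derive_smooth_step0 ?normr0 ?addr_ge0//.
by move: h; rewrite negb_and -!ltNge => /orP[]?; apply/orP; [left|right]; lra.
Qed.

End smooth_step.

(** * Bessel norms and Fourier coefficients *)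

(* No measurability is required: the integral of a nonnegative function is a
   supremum. The functions [t |-> bessel_norm mu p (u t)] are compared in this
   way. *)
Lemma le_ge0_integral {disp} {T : measurableType disp} {R : realType}
    (m : {measure set T -> \bar R}) (D : set T) (f g : T -> \bar R) :
  (forall x, D x -> 0 <= f x)%E -> (forall x, D x -> f x <= g x)%E ->
  (\int[m]_(x in D) f x <= \int[m]_(x in D) g x)%E.
Proof.
move=> f0 fg; have g0 x : D x -> (0 <= g x)%E by move=> Dx; exact: le_trans (f0 x Dx) (fg x Dx).
rewrite !ge0_integralE//; apply: le_ereal_sup => _ [h hf <-]; exists h => // x.
apply: le_trans (hf x) _; rewrite !patchE; case: ifPn => // /set_mem; exact: fg.
Qed.

Lemma le_Lnorm {disp} {T : measurableType disp} {R : realType}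
    (m : {measure set T -> \bar R}) (p : R) (f g : T -> \bar R) : 0 < p ->
  (forall x, `|f x| <= `|g x|)%E -> ('N[m]_p%:E[f] <= 'N[m]_p%:E[g])%E.
Proof.
move=> p0 fg; have p'0 : 0 <= p^-1 by rewrite invr_ge0 ltW.
have I0 h : (0 <= \int[m]_x (`|h x| `^ p))%E by apply: integral_ge0 => x _; exact: poweR_ge0.
rewrite unlock; apply: gt0_ler_poweR => //; rewrite ?in_itv/= ?leey ?andbT//.
apply: le_ge0_integral => x _; first exact: poweR_ge0.
by apply: gt0_ler_poweR; rewrite ?in_itv/= ?leey ?andbT ?(ltW p0).
Qed.

Section trigonometric_test_functions.
Context {R : realType} {n : nat}.

Lemma is_derive_line (V : normedModType R) (f : V -> R) (x v : V) (g : R -> R) (df : R) :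
  (forall h : R, f (h *: v + x) = g h) -> is_derive (0 : R) 1 g df -> is_derive x v f df.
Proof.
move=> fg [dg <-].
have E : (fun h : R => h^-1 *: ((f \o shift x) (h *: v) - f x)) =
         (fun h : R => h^-1 *: ((g \o shift 0) (h *: 1) - g 0)).
  apply/funext => h /=; rewrite fg -(fg 0) scale0r add0r.
  by rewrite /GRing.scale/= mulr1 addr0.
split; first by rewrite /derivable E; exact: dg.
by rewrite /derive E.
Qed.

Lemma dotkD (k : 'rV[int]_n) (x y : 'rV[R]_n) : dotk k (x + y) = dotk k x + dotk k y.
Proof. by rewrite /dotk -big_split; apply: eq_bigr => i _; rewrite mxE mulrDr. Qed.

Lemma dotkZ (k : 'rV[int]_n) (c : R) (x : 'rV[R]_n) : dotk k (c *: x) = c * dotk k x.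
Proof. by rewrite /dotk mulr_sumr; apply: eq_bigr => i _; rewrite mxE mulrCA. Qed.

Lemma dotk_delta (k : 'rV[int]_n) j : dotk k (delta_mx 0 j) = (k 0 j)%:~R :> R.
Proof.
rewrite /dotk (bigD1 j)//= mxE !eqxx mulr1 big1 ?addr0// => i ij.
by rewrite mxE eqxx (negbTE ij) mulr0.
Qed.

Lemma dotkN (k : 'rV[int]_n) (x : 'rV[R]_n) : dotk (- k) x = - dotk k x.
Proof. by rewrite /dotk -sumrN; apply: eq_bigr => i _; rewrite mxE rmorphN mulNr. Qed.

Lemma continuous_dotk (k : 'rV[int]_n) : continuous (dotk k : 'rV[R]_n -> R).
Proof.
change (continuous (fun x : 'rV[R]_n => \sum_(i < n) (k 0 i)%:~R * x 0 i : R)).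
have H := @continuous_big R 'I_n +%R 0 xpredT (@add_continuous R).
apply: H => i _ x; apply: (@continuous_comp _ _ _ (fun M : 'rV[R]_n => M 0 i)).
  exact: coord_continuous.
exact: mulrl_continuous.
Qed.

(** Derivatives exchange cosine and sine; these combinations are stable under all iterated partial
    derivatives. *)
Let lincomb (k : 'rV[int]_n) (c c' : R) (x : 'rV[R]_n) :=
  c * trig (k, true) x + c' * trig (k, false) x.

Let is_derive_lincomb k c c' j (x : 'rV[R]_n) :
  is_derive x (delta_mx 0 j) (lincomb k c c')
    (lincomb k (2 * pi * (k 0 j)%:~R * c') (- (2 * pi * (k 0 j)%:~R * c)) x).
Proof.
pose w : R := 2 * pi * (k 0 j)%:~R; pose y := 2 * pi * dotk k x.
apply: (@is_derive_line _ _ _ _ (fun h => c * cos (w * h + y) + c' * sin (w * h + y))).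
  move=> h; rewrite /lincomb /trig /= dotkD dotkZ dotk_delta.
  by rewrite (_ : 2 * pi * _ = w * h + y)// /w /y; ring.
have dc : is_derive (0 : R) 1 (fun h => cos (w * h + y)) (- sin y * w).
  by apply: is_derive_affine; rewrite mulr0 add0r; exact: is_derive_cos.
have ds : is_derive (0 : R) 1 (fun h => sin (w * h + y)) (cos y * w).
  by apply: is_derive_affine; rewrite mulr0 add0r; exact: is_derive_sin.
have := is_deriveD (is_deriveM (is_derive_cst c (0 : R) (1 : R)) dc)
  (is_deriveM (is_derive_cst c' (0 : R) (1 : R)) ds).
move=> h; apply: is_derive_eq; rewrite /GRing.scale/= /lincomb /trig/= -/y -/w; ring.
Qed.

Let continuous_lincomb k c c' : continuous (lincomb k c c').
Proof.
have H x : {for x, continuous (fun y : 'rV[R]_n => 2 * pi * dotk k y : R)}.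
  by apply: continuous_comp; [exact: continuous_dotk|exact: mulrl_continuous].
have F (f : R -> R) (a : R) x : {for 2 * pi * dotk k x, continuous f} ->
    {for x, continuous (fun y : 'rV[R]_n => a * f (2 * pi * dotk k y) : R)}.
  move=> cf; apply: (@continuous_comp _ _ _ (fun y : 'rV[R]_n => f (2 * pi * dotk k y) : R)).
    exact: continuous_comp (H x) cf.
  exact: mulrl_continuous.
move=> x; apply: (@cvgD R R _ (nbhs x) _ _ _ _ _ (F cos c x _) (F sin c' x _)).
  exact: continuous_cos.
exact: continuous_sin.
Qed.

Lemma test_function_trig (i : 'rV[int]_n * bool) : test_function (trig i : 'rV[R]_n -> R).
Proof.
case: i => k b; split=> [x j|a].
  rewrite /trig /= dotkD dotk_delta mulrDr.
  by case: b; [exact: cosD_int|exact: sinD_int].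
have [c [c' ->]] : exists c c', partials a (trig (k, b)) = lincomb k c c'.
  elim: a => [|j a [c [c' IH]]].
    case: b; [exists 1; exists 0|exists 0; exists 1]; apply/funext => x /=;
    by rewrite /lincomb mul1r mul0r ?addr0 ?add0r.
  exists (2 * pi * (k 0 j)%:~R * c'), (- (2 * pi * (k 0 j)%:~R * c)).
  apply/funext => x; rewrite /= -/(partials a (trig (k, b))) IH.
  by have := is_derive_lincomb k c c' j x => -[].
split; first exact: continuous_lincomb.
by move=> x j; have [] := is_derive_lincomb k c c' j x.
Qed.

Lemma trigN (k : 'rV[int]_n) b (x : 'rV[R]_n) :
  trig (- k, b) x = (if b then 1 else -1) * trig (k, b) x.
Proof.
rewrite /trig/= dotkN mulrN; case: b => /=; first by rewrite cosN mul1r.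
by rewrite sinN mulN1r.
Qed.

End trigonometric_test_functions.

Section bessel_data.
Context {R : realType} {n : nat}.
Local Notation cube := (n.-tuple (measurableTypeR R)).
Local Notation tor := (@torus_measure R n).
Variable p : R.
Hypothesis p1 : 1 < p.

Implicit Types (u v : functional R n) (b : bool) (i : 'rV[int]_n * bool).

Definition part (b : bool) (z : R[i]) : R := if b then complex.Re z else complex.Im z.

Lemma partD b (z w : R[i]) : part b (z + w) = part b z + part b w.
Proof. by case: z w => [x y] [x' y']; case: b. Qed.

Lemma partN b (z : R[i]) : part b (- z) = - part b z.
Proof. by case: z => [x y]; case: b. Qed.

Lemma partB b (z w : R[i]) : part b (z - w) = part b z - part b w.
Proof. by rewrite partD partN. Qed.

Lemma part_real b (c : R) (z : R[i]) : part b ((c%:C)%C * z) = c * part b z.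
Proof. by case: z => [x y]; case: b => /=; rewrite mul0r ?subr0 ?addr0. Qed.

(* Recovering [u (trig i)] from [fourier u k] and [fourier u (- k)] uses this
   property, which is not automatic since a functional need not be linear. *)
Definition parity u := forall k, u (trig (- k, false)) = - u (trig (k, false)).

Lemma parity_distribution u : is_distribution u -> parity u.
Proof.
move=> [lin _] k.
have E : trig (- k, false) = (fun x => -1 * trig (k, false) x + 0 * trig (k, false) x) :> ('rV[R]_n -> R).
  by apply/funext => x; rewrite trigN mul0r addr0.
have E0 : (fun x => 0 * trig (k, false) x) = (fun x => -1 * trig (k, false) x + trig (k, false) x) :> ('rV[R]_n -> R).
  by apply/funext => x; rewrite mul0r mulN1r addNr.
have t0 := @test_function_trig R n (k, false).
have tN := @test_function_trig R n (- k, false).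
have z0 : u (fun x => 0 * trig (k, false) x) = 0.
  rewrite E0 lin//; case: (u _) => x y; apply/eqP; rewrite eq_complex/=.
  by rewrite !mul0r !mulN1r subr0 addr0 !addNr eqxx.
have := lin (-1) _ _ t0 tN.
rewrite (_ : (fun x => _) = (fun x => - 2 * trig (k, false) x)); last first.
  by apply/funext => x; rewrite trigN; ring.
have := lin 1 _ _ tN t0.
rewrite (_ : (fun x => _) = (fun x => 0 * trig (k, false) x)); last first.
  by apply/funext => x; rewrite trigN; ring.
rewrite z0; case: (u (trig (- k, false))) (u (trig (k, false))) => [x y] [x' y'].
move=> /eqP; rewrite eq_complex/= => /andP[/eqP h1 /eqP h2] _.
apply/eqP; rewrite eq_complex/=; apply/andP; split; apply/eqP; lra.
Qed.

Lemma parityB u v : parity u -> parity v -> parity (u - v).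
Proof. by move=> hu hv k; rewrite !fctE hu hv opprD. Qed.

(** The coefficients, against cosines and sines, of the real or imaginary part of (I - Delta)^(mu/2)
    u. *)
Definition bdata (mu : R) u b i : R := bes i `^ (mu / 2) * part b (u (trig i)).

Lemma bdataB mu u v b i : bdata mu (u - v) b i = bdata mu u b i - bdata mu v b i.
Proof. by rewrite /bdata !fctE partB mulrBr. Qed.

Lemma bdata_shift mu mu' u b i :
  bdata mu' u b i = bes i `^ ((mu' - mu) / 2) * bdata mu u b i.
Proof.
rewrite /bdata mulrA -gt0_powRD ?bes_gt0//.
by congr (_ `^ _ * _); field.
Qed.

Lemma part_distr_of_fun (f : cube -> R[i]) b i :
  part b (distr_of_fun f (trig i)) = coef (fun x => part b (f x)) i.
Proof.
rewrite /distr_of_fun /Cintegral /coef; case: b => /=; apply: eq_Rintegral => x _;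
by case: (f x) => y z; rewrite /cube_trig /row_of_cube /= !mulr0 ?subr0 ?add0r.
Qed.

Let evenT u k : u (trig (- k, true)) = u (trig (k, true)).
Proof. by congr u; apply/funext => x; rewrite trigN mul1r. Qed.

(** By parity the Fourier coefficients at k and - k are A - iB and A + iB, where the complex numbers
    A and B are the values at the cosine and at the sine. The identities at both frequencies
    therefore determine A and B separately. *)
Lemma is_bessel_part mu u (f : cube -> R[i]) :
  (forall b, tor.-integrable setT (EFin \o (fun x => part b (f x)))) -> parity u ->
  is_bessel mu u (distr_of_fun f) <-> (forall b i, coef (fun x => part b (f x)) i = bdata mu u b i).
Proof.
move=> intf pu; pose v : functional R n := distr_of_fun f.
have pv : parity v.
  have E b k : part b (v (trig (- k, false))) = part b (- v (trig (k, false))).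
    rewrite partN !part_distr_of_fun /coef -[RHS]mulN1r -RintegralZl//; last first.
      exact: integrable_mul_trig.
    by apply: eq_Rintegral => x _; rewrite /cube_trig trigN mulrCA.
  by move=> k; apply/eqP; rewrite eq_complex -[_ == _]/(part true _ == part true _);
    rewrite E -[X in _ && X]/(part false _ == part false _) E !eqxx.
have bE (k : 'rV[int]_n) b : bessel_symbol mu k = bes (k, b) `^ (mu / 2) :> R by [].
pose B (k : 'rV[int]_n) : R := bessel_symbol mu k.
have Ef k (w : functional R n) :
  fourier w k = w (trig (k, true)) - (0 +i* 1)%C * w (trig (k, false)) by [].
split=> [h b [k c]|h k]; last first.
  have E i : v (trig i) = ((B i.1)%:C)%C * u (trig i).
    have H b : part b (v (trig i)) = part b (((B i.1)%:C)%C * u (trig i)).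
      by rewrite part_distr_of_fun h part_real.
    by apply/eqP; rewrite eq_complex; apply/andP; split; apply/eqP; [exact: (H true)|exact: (H false)].
  by rewrite !Ef -/v !E mulrBr; congr (_ - _); rewrite mulrCA.
rewrite -part_distr_of_fun -/v /bdata -part_real; congr part.
have := h k; have := h (- k); rewrite !Ef -/v !evenT pv pu.
have -> : bessel_symbol mu (- k) = B k.
  rewrite /B /bessel_symbol (eq_bigr (fun j => (k 0 j)%:~R ^+ 2))// => j _.
  by rewrite mxE rmorphN sqrrN.
rewrite -[bes _ `^ _]/(B k) -/(B k).
have -> : v (trig (k, c)) = if c then v (trig (k, true)) else v (trig (k, false)) by case: c.
have -> : u (trig (k, c)) = if c then u (trig (k, true)) else u (trig (k, false)) by case: c.
move: (B k) (v (trig (k, true))) (v (trig (k, false))) (u (trig (k, true))) (u (trig (k, false))).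
move=> C [x y] [x' y'] [z t] [z' t'] /eqP; rewrite eq_complex/= => /andP[/eqP h1 /eqP h2].
move=> /eqP; rewrite eq_complex/= => /andP[/eqP h3 /eqP h4].
by case: c => /=; apply/eqP; rewrite eq_complex/=; apply/andP; split; apply/eqP; lra.
Qed.


Let bnd_is_bessel mu u (f : cube -> R[i]) b : parity u -> torus_Lp p f ->
  is_bessel mu u (distr_of_fun f) ->
  torus_Lnorm p f = (fine (torus_Lnorm p f))%:E /\
  bnd p (bdata mu u b) (fine (torus_Lnorm p f)).
Proof.
move=> pu [mr mi fp] hb.
have mf c : measurable_fun setT (fun x => part c (f x)) by case: c.
have fle c : ('N[tor]_p%:E[EFin \o (fun x => part c (f x))] <= torus_Lnorm p f)%E.
  apply: le_Lnorm; first exact: lt_trans p1.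
  move=> x /=; rewrite lee_fin; case: (f x) => y z; rewrite /part /= [leRHS]ger0_norm ?sqrtr_ge0//.
  by case: c; rewrite -sqrtr_sqr ler_wsqrtr// ?lerDl ?lerDr sqr_ge0.
have intf c := Lp_integrable p1 (mf c) (le_lt_trans (fle c) fp).
have N0 : (0 <= torus_Lnorm p f)%E by exact: Lnorm_ge0.
have NE : torus_Lnorm p f = (fine (torus_Lnorm p f))%:E by rewrite fineK// ge0_fin_numE.
split=> // e e0; exists (fun x => part b (f x)); split => //.
  by apply: le_trans (fle b) _; rewrite NE lee_fin lerDl ltW.
by move=> i; exact: (proj1 (is_bessel_part mu intf pu) hb).
Qed.

Lemma nrm_le_bessel_norm mu u b : parity u ->
  ((nrm p (bdata mu u b))%:E <= bessel_norm mu p u)%E.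
Proof.
move=> pu; apply: le_ereal_inf_tmp => _ [f [fp hb] <-].
by have [-> h] := bnd_is_bessel b pu fp hb; rewrite lee_fin nrm_le.
Qed.

Lemma fincoef_bessel mu u b : parity u -> (bessel_norm mu p u < +oo)%E ->
  fincoef p (bdata mu u b).
Proof.
move=> pu /ereal_inf_lt[_ [f [fp hb] _] _].
by have [_ h] := bnd_is_bessel b pu fp hb; exists (fine (torus_Lnorm p f)).
Qed.

(** The factor 2 is the price of recombining the real and imaginary parts by |f| <= |Re f| + |Im
    f|. *)
Lemma bessel_norm_le mu u r : parity u -> (forall b, bnd p (bdata mu u b) r) ->
  (bessel_norm mu p u <= (2 * r)%:E)%E.
Proof.
move=> pu h; apply/lee_addgt0Pr => e e0; have e20 : 0 < e / 2 by rewrite divr_gt0.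
have [g1 [m1 n1 c1]] := h true _ e20; have [g2 [m2 n2 c2]] := h false _ e20.
pose f x := (g1 x +i* g2 x)%C.
have fe b : (fun x => part b (f x)) = if b then g1 else g2 by case: b.
have intf b : tor.-integrable setT (EFin \o (fun x => part b (f x))).
  rewrite fe; case: b; apply: (Lp_integrable p1) => //.
    exact: le_lt_trans n1 (ltry _).
  exact: le_lt_trans n2 (ltry _).
have fN : (torus_Lnorm p f <= (2 * r + e)%:E)%E.
  have n1' : measurable_fun setT (fun x => `|g1 x|) by exact: measurableT_comp.
  have n2' : measurable_fun setT (fun x => `|g2 x|) by exact: measurableT_comp.
  have := minkowski_EFin tor n1' n2' (ltW p1).
  have E (g : cube -> R) : ('N[tor]_p%:E[EFin \o (fun x => `|g x|%R)] = 'N[tor]_p%:E[EFin \o g])%E.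
    by rewrite unlock; congr (_ `^ _)%E; apply: eq_integral => x _; rewrite /= normr_id.
  rewrite !E => h1; rewrite (_ : 2 * r + e = (r + e / 2) + (r + e / 2)); last by field.
  rewrite EFinD; apply: le_trans (leeD n1 n2); apply: le_trans h1.
  apply: le_Lnorm; first exact: lt_trans p1.
  move=> x /=; rewrite lee_fin ger0_norm ?sqrtr_ge0// [leRHS]ger0_norm ?addr_ge0//.
  rewrite -[leRHS]ger0_norm ?addr_ge0// -sqrtr_sqr ler_wsqrtr// sqrrD !real_normK ?num_real//.
  by rewrite lerD2r lerDl mulrn_wge0// mulr_ge0.
apply: le_trans (fN); apply: ereal_inf_lbound; exists f => //; split.
  by split => //; exact: le_lt_trans fN (ltry _).
apply/(is_bessel_part mu intf pu) => b i; rewrite fe.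
by case: b; [rewrite c1|rewrite c2].
Qed.

End bessel_data.

(** * Averages in time *)

Section cutoff.
Context {R : realType}.
Local Notation mu := (@lebesgue_measure R).

(** This is [smooth_step ((r - a) / l)], in the form expected by [smooth_affine]. *)
Definition cutoff (a l r : R) : R := smooth_step (l^-1 * r + - (a / l)).

(** The derivative of [cutoff]: for l > 0, a smooth weight of integral 1 supported in [a, a + l]. *)
Definition bump (a l r : R) : R := (smooth_step^`())%classic (l^-1 * r + - (a / l)) * l^-1.

Lemma smooth_class_cutoff a l : smooth_class (cutoff a l).
Proof. by apply: smooth_affine; exact: smooth_class_step. Qed.

Lemma is_derive_cutoff (a l r : R) : is_derive r 1 (cutoff a l) (bump a l r).
Proof. by apply: is_derive_affine; apply: smooth_class_is_derive; exact: smooth_class_step. Qed.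

Lemma continuous_bump a l : continuous (bump a l).
Proof.
have -> : bump a l = ((cutoff a l)^`())%classic.
  by apply/funext => r; rewrite derive1E; have [_ ->] := is_derive_cutoff a l r.
by apply: smooth_class_continuous; apply: smooth_class_derive1; exact: smooth_class_cutoff.
Qed.

Section positive_length.
Variables a l : R.
Hypothesis l0 : 0 < l.

Let argE r : l^-1 * r + - (a / l) = (r - a) / l. Proof. by field; rewrite gt_eqF. Qed.

Lemma cutoff0 r : r <= a + l / 4 -> cutoff a l r = 0.
Proof.
move=> h; rewrite /cutoff argE smooth_step0// ler_pdivrMr//; lra.
Qed.

Lemma cutoff1 r : a + 3 / 4 * l <= r -> cutoff a l r = 1.
Proof.
move=> h; rewrite /cutoff argE smooth_step1// ler_pdivlMr//; lra.
Qed.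

Lemma bump0 r : (r < a + l / 4) || (a + 3 / 4 * l < r) -> bump a l r = 0.
Proof.
move=> h; rewrite /bump argE derive_smooth_step0 ?mul0r//.
by case/orP: h => h; apply/orP; [left; rewrite ltr_pdivrMr//|right; rewrite ltr_pdivlMr//]; lra.
Qed.

Lemma bump_le K r : (forall x, `|((@smooth_step R)^`())%classic x| <= K) ->
  `|bump a l r| <= K / l * \1_(`[a, a + l]%classic) r.
Proof.
have al : a < a + l by rewrite ltrDl.
move=> hK; rewrite indicE; case: (boolP (r \in _)) => [_|]; last first.
  rewrite notin_setE/= in_itv/= => /negP; rewrite negb_and -!ltNge => h.
  rewrite bump0 ?normr0 ?mulr0//.
  by case/orP: h => h; apply/orP; [left|right]; lra.
by rewrite mulr1 normrM (@ger0_norm _ l^-1) ?invr_ge0 ?(ltW l0)// ler_wpM2r ?invr_ge0 ?(ltW l0).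
Qed.

Lemma Rintegral_bump : \int[mu]_r bump a l r = 1.
Proof.
have al : a < a + l by rewrite ltrDl.
transitivity (\int[mu]_(r in `[a, (a + l)%R]) bump a l r).
  rewrite [RHS]Rintegral_mkcond; apply: eq_Rintegral => r _; rewrite patchE.
  case: ifPn => //; rewrite notin_setE/= in_itv/= => /negP; rewrite negb_and -!ltNge => h.
  rewrite bump0//.
  by case/orP: h => h; apply/orP; [left|right]; lra.
rewrite /Rintegral (@continuous_FTC2 _ (bump a l) (cutoff a l))//=.
- by rewrite cutoff1 ?cutoff0 ?subr0//; lra.
- by apply: continuous_subspaceT; exact: continuous_bump.
- have cc := smooth_class_continuous (smooth_class_cutoff a l).
  split.
  + by move=> r _; have [] := is_derive_cutoff a l r.
  + by apply/cvg_at_right_filter; exact: cc.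
  + by apply/cvg_at_left_filter; exact: cc.
- by move=> r _; rewrite derive1E; have [_ ->] := is_derive_cutoff a l r.
Qed.

Lemma integrable_bump : mu.-integrable setT (EFin \o (bump a l : measurableTypeR R -> R)).
Proof.
have [K K0 hK] := @derive_smooth_step_bounded R.
have i1 : mu.-integrable setT (EFin \o (fun r => K / l * \1_(`[a, a + l]%classic) r)).
  exact: (integrableZl measurableT (K / l) (integrable_indic_itv a (a + l) true false)).
apply: le_integrable i1 => //.
  by apply/measurable_EFinP; apply: continuous_measurable_fun; exact: continuous_bump.
move=> r _; rewrite !abse_EFin lee_fin; apply: le_trans (bump_le r hK) _.
exact: ler_norm.
Qed.

End positive_length.

(** A single cutoff stays equal to 1 on the right; the difference has compact support because both
    steps rise from 0 to 1 inside [a, a + l]. *)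
Lemma cutoff_test_function (T a a' l : R) : 0 < l -> 0 <= a -> a + l <= T ->
  a <= a' -> a' + l / 2 <= a + l ->
  time_test_function T (fun r => cutoff a' (l / 2) r - cutoff a l r).
Proof.
move=> l0 a0 aT aa' a'l; have l20 : 0 < l / 2 by rewrite divr_gt0.
split.
  move=> n r; apply: smooth_class_derivable.
  have := smooth_add (smooth_class_cutoff a' (l / 2))
    (smooth_mul (smooth_cst (-1)) (smooth_class_cutoff a l)).
  rewrite (_ : (fun x => _) = (fun r => cutoff a' (l / 2) r - cutoff a l r))//.
  by apply/funext => x; rewrite mulN1r.
(* The cutoff of length l / 2 varies from a' + (l/2)/4 >= a + l/8 to a' + (3/4)(l/2) <= a + 7l/8,
   since a <= a' <= a + l/2. *)
exists (a + l / 8), (a + 7 / 8 * l); split; [by lra|by lra|].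
move=> r; rewrite in_itv/= negb_and -!ltNge => /orP[h|h].
  by rewrite !cutoff0 ?subr0//; lra.
by rewrite !cutoff1 ?subrr//; lra.
Qed.

Lemma cutoffB_le (a a' l r : R) : 0 < l -> a <= a' -> a' + l / 2 <= a + l ->
  `|cutoff a' (l / 2) r - cutoff a l r| <= 1 * \1_(`[a, a + l]%classic) r.
Proof.
move=> l0 aa' a'l; have l20 : 0 < l / 2 by rewrite divr_gt0.
rewrite mul1r indicE; case: (boolP (r \in _)) => [_|].
  have := smooth_step_ge0 ((l / 2)^-1 * r + - (a' / (l / 2))).
  have := smooth_step_le1 ((l / 2)^-1 * r + - (a' / (l / 2))).
  have := smooth_step_ge0 (l^-1 * r + - (a / l)); have := smooth_step_le1 (l^-1 * r + - (a / l)).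
  rewrite -/(cutoff a l r) -/(cutoff a' (l / 2) r) /= ler_norml => *; apply/andP; split; lra.
rewrite notin_setE/= in_itv/= => /negP; rewrite negb_and -!ltNge => /orP[h|h].
  by rewrite !cutoff0 ?subr0 ?normr0//; lra.
by rewrite !cutoff1 ?subrr ?normr0//; lra.
Qed.

Lemma derive1_cutoffB (a a' l l' r : R) :
  ((fun r => cutoff a' l' r - cutoff a l r)^`())%classic r = bump a' l' r - bump a l r.
Proof.
rewrite derive1E; apply: derive_val.
exact: (is_deriveB (is_derive_cutoff a' l' r) (is_derive_cutoff a l r)).
Qed.

Lemma measurable_cutoff (a l : R) :
  measurable_fun [set: measurableTypeR R] (cutoff a l : measurableTypeR R -> R).
Proof.
by apply: continuous_measurable_fun; exact: smooth_class_continuous (smooth_class_cutoff a l).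
Qed.

End cutoff.

Section time_integrals.
Context {R : realType} {n : nat}.
Local Notation mu := (@lebesgue_measure R).
Local Notation seqn := ('rV[int]_n * bool -> R).
Variable p : R.
Hypothesis p1 : 1 < p.
Variables (T m : R) (f : R -> functional R n).
Hypothesis fB : bochner_space T m p f.
Variable b : bool.

(** The extension by 0 outside ]0, T[ lets the integrals be taken over the whole line. *)
Definition time_data (f : R -> functional R n) (t : R) : seqn :=
  fun i => \1_(`]0, T[%classic) t * bdata m (f t) b i.

Let p0 : 0 < p. Proof. exact: lt_trans p1. Qed.

Let par t : t \in `]0, T[ -> parity (f t).
Proof. by move=> t0; have [[/(_ t t0) [h _] _] _] := fB; exact: parity_distribution. Qed.

Let time_dataE (g : R -> functional R n) t : t \in `]0, T[ -> time_data g t = bdata m (g t) b.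
Proof.
by move=> t0; apply/funext => i; rewrite /time_data indicE mem_set// mul1r.
Qed.

Let time_data0 (g : R -> functional R n) t : t \notin `]0, T[ -> time_data g t = (fun=> 0).
Proof.
move=> t0; apply/funext => i; rewrite /time_data indicE memNset ?mul0r//; exact/negP.
Qed.

Lemma fincoef_time_data t : fincoef p (time_data f t).
Proof.
have [t0|t0] := boolP (t \in `]0, T[); last by rewrite time_data0//; exact: fincoef0.
rewrite time_dataE//; have [[/(_ t t0)[_ h] _] _] := fB.
by apply: fincoef_bessel => //; exact: par.
Qed.

Lemma nrm_time_data_le t : t \in `]0, T[ ->
  ((nrm p (time_data f t))%:E <= bessel_norm m p (f t))%E.
Proof. by move=> t0; rewrite time_dataE//; apply: nrm_le_bessel_norm => //; exact: par. Qed.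

(** The given approximants converge in [bessel_norm], which dominates [nrm] of each of the two
    parts; their sets are cut by ]0, T[ to match the extension by 0. *)
Lemma time_data_simple : exists s_ : nat -> seq (set (measurableTypeR R) * seqn),
  (forall k, simple_data p (s_ k)) /\
  forall t, nrm p (fun i => simple_value (s_ k) t i - time_data f t i) @[k --> \oo] --> (0 : R).
Proof.
have [[_ [u_ u_simple u_cvg]] _] := fB.
have H k : exists s : seq (set (measurableTypeR R) * seqn), simple_data p s /\
    (forall t, parity (u_ k t)) /\ forall t, simple_value s t = time_data (u_ k) t.
  have [N [A [h [mA hB uE]]]] := u_simple k.
  have hP j : parity (h j) by have [/parity_distribution] := hB j.
  exists [seq (A j `&` `]0, T[%classic, bdata m (h j) b) | j <- enum 'I_N]; split.
    elim: (enum _) => // j s IH; split => //=; first by apply: measurableI; [exact: mA|exact: measurable_itv].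
    by apply: fincoef_bessel => //; have [_] := hB j.
  split=> t.
    move=> l; rewrite uE -sumrN; apply: eq_bigr => j _.
    by rewrite hP mulrN.
  apply/funext => i; rewrite /simple_value big_map /time_data uE /bdata.
  rewrite [RHS](_ : _ = \1_(`]0, T[%classic) t * (bes i `^ (m / 2) *
    \sum_(j <- enum 'I_N) \1_(A j) t * part b (h j (trig i)))); last first.
    congr (_ * (_ * _)); rewrite big_enum/=.
    elim/big_ind2 : _ => [|x x' y y' <- <-|j _]; [by case: b|exact: partD|exact: part_real].
  rewrite !mulr_sumr; apply: eq_bigr => j _ /=; rewrite indicI /bdata/=; ring.
have [s_ s_P] := choice H; exists s_; split; first by move=> k; have [] := s_P k.
move=> t; have [t0|t0] := boolP (t \in `]0, T[); last first.
  rewrite (_ : (fun k => _) = cst 0); first exact: cvg_cst.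
  apply/funext => k; have [_ [_ ->]] := s_P k; rewrite !time_data0//.
  by rewrite (_ : (fun i => _) = (fun=> 0)) ?nrm0//; apply/funext => i; rewrite subr0.
suff : (nrm p (fun i => simple_value (s_ k) t i - time_data f t i))%:E @[k --> \oo] --> 0%:E.
  by move/fine_cvg.
have cst0 : cst 0%E k @[k --> \oo] --> (0%E : \bar R) by exact: cvg_cst.
apply: (squeeze_cvge _ cst0 (u_cvg t t0)).
  near=> k; rewrite lee_fin nrm_ge0/=; have [_ [pk ->]] := s_P k.
  apply: le_trans (nrm_le_bessel_norm p1 m b (parityB (pk t) (par t0))).
  rewrite !time_dataE// lee_fin le_eqVlt; apply/orP; left; apply/eqP; congr nrm.
  by apply/funext => i; rewrite bdataB.
Unshelve. all: by end_near.
Qed.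

Let F := fine (bochner_norm T m p f).

Let bochner_fin : bochner_norm T m p f = F%:E.
Proof.
have [_ h] := fB; rewrite /F fineK// ge0_fin_numE//; exact: poweR_ge0.
Qed.

(** Hoelder in time over [a, a + l]: the indicator contributes l^(1 - 1/p), the weight contributes
    M, and the factor 2 is that of [bochner_bnd]. *)
Lemma bnd_time_integral (eta : measurableTypeR R -> R) (M a l : R) :
  0 <= l -> 0 <= M -> measurable_fun setT eta ->
  (forall t, `|eta t| <= M * \1_(`[a, a + l]%classic) t) ->
  (forall i, mu.-integrable setT (EFin \o (fun t => eta t * time_data f t i))) /\
  bnd p (fun i => \int[mu]_t (eta t * time_data f t i)) (2 * (M * l `^ (1 - p^-1) * F)).
Proof.
move=> l0 M0 meta etaM.
have [s_ [s_data s_cvg]] := time_data_simple.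
pose g t := nrm p (time_data f t).
have mg : measurable_fun [set: measurableTypeR R] g by exact: (measurable_nrm p1 s_data fincoef_time_data s_cvg).
have g0 t : 0 <= g t by exact: nrm_ge0.
pose J : set (measurableTypeR R) := `[a, a + l]%classic.
have i1 : mu.-integrable setT (EFin \o (fun t : measurableTypeR R => M * \1_J t)).
  exact: (integrableZl measurableT M (integrable_indic_itv a (a + l) true false)).
have ieta : mu.-integrable setT (EFin \o eta).
  apply: le_integrable i1 => //; first exact/measurable_EFinP.
  move=> t _; rewrite !abse_EFin lee_fin; apply: le_trans (etaM t) _; exact: ler_norm.
have gF : ('N[mu]_p%:E[EFin \o g] <= F%:E)%E.
  rewrite unlock -bochner_fin /bochner_norm.
  have -> : (\int[mu]_t (`|(EFin \o g) t| `^ p) = \int[mu]_(t in `]0%R, T[) (`|(EFin \o g) t| `^ p))%E.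
    rewrite [RHS]integral_mkcond; apply: eq_integral => t _; rewrite patchE; case: ifPn => //.
    move=> h; have h' : t \notin `]0, T[ by apply/negP => /mem_set; exact/negP.
    by rewrite /= /g (time_data0 _ h') nrm0// normr0 powR0// gt_eqF.
  have I0 (D : set (measurableTypeR R)) (h : R -> \bar R) : (0 <= \int[mu]_(t in D) (h t `^ p))%E.
    by apply: integral_ge0 => t _; exact: poweR_ge0.
  apply: gt0_ler_poweR; rewrite ?in_itv/= ?leey ?andbT ?invr_ge0 ?(ltW p0) ?I0//.
    by apply: integral_ge0 => t _; rewrite lee_fin powR_ge0.
  apply: le_ge0_integral => t t0; first by rewrite lee_fin powR_ge0.
  have := nrm_time_data_le t0; rewrite -/(g t) => h.
  have h0 : (0 <= bessel_norm m p (f t))%E by apply: le_trans h; rewrite lee_fin.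
  rewrite -poweR_EFin; apply: gt0_ler_poweR; rewrite ?in_itv/= ?leey ?andbT ?lee_fin ?(ltW p0)//.
  by rewrite ger0_norm.
pose q := (1 - p^-1)^-1.
have ip1 : p^-1 < 1 by rewrite invf_lt1.
have q0 : 0 < q by rewrite invr_gt0 subr_gt0.
have pq : p^-1 + q^-1 = 1 by rewrite invrK addrC subrK.
have mJ0 : measurable J by exact: measurable_itv.
have mJ : measurable_fun [set: measurableTypeR R] (\1_J : measurableTypeR R -> R).
  exact: measurable_indic.
have JN : ('N[mu]_q%:E[EFin \o \1_J] = (l `^ (1 - p^-1))%:E)%E.
  rewrite unlock (_ : (\int[mu]_t _ = l%:E)%E) ?poweR_EFin ?/q ?invrK//.
  transitivity (\int[mu]_t (\1_J t)%:E)%E.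
    apply: eq_integral => t _ /=; rewrite ger0_norm// indicE.
    by case: (t \in J) => /=; rewrite ?powR1// powR0// gt_eqF.
  rewrite integral_indic// setIT /= lebesgue_measure_itv/= lte_fin ltrDl.
  have [//|] := ltP 0 l; first by rewrite -EFinB addrC addKr.
  by move=> h; congr (_%:E); apply/eqP; rewrite eq_le h l0.
have gJ : (\int[mu]_t (g t * \1_J t)%:E <= (l `^ (1 - p^-1) * F)%:E)%E.
  have := hoelder mu mg mJ p0 q0 pq; rewrite Lnorm1 JN => h.
  apply: (@le_trans _ _ ('N[mu]_p%:E[EFin \o g] * (l `^ (1 - p^-1))%:E)%E).
    apply: le_trans h; rewrite le_eqVlt; apply/orP; left; apply/eqP.
    by apply: eq_integral => t _ /=; rewrite ger0_norm// mulr_ge0.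
  by rewrite mulrC EFinM lee_wpmul2r// lee_fin powR_ge0.
have mgJ : measurable_fun [set: measurableTypeR R] (fun t => g t * \1_J t) by exact: measurable_funM.
have igJ : mu.-integrable setT (EFin \o (fun t : measurableTypeR R => g t * \1_J t)).
  apply/integrableP; split; first exact/measurable_EFinP.
  apply: le_lt_trans (ltry (l `^ (1 - p^-1) * F)); apply: le_trans gJ.
  rewrite le_eqVlt; apply/orP; left; apply/eqP.
  by apply: eq_integral => t _ /=; rewrite ger0_norm// mulr_ge0.
have iMgJ : mu.-integrable setT (EFin \o (fun t : measurableTypeR R => M * (g t * \1_J t))).
  exact: (integrableZl measurableT M igJ).
have le1 t : `|eta t| * g t <= M * (g t * \1_J t).
  by rewrite [g t * _]mulrC mulrA ler_wpM2r.
have ietag : mu.-integrable setT (EFin \o (fun t => `|eta t| * nrm p (time_data f t))).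
  apply: le_integrable iMgJ => //.
    by apply/measurable_EFinP; apply: measurable_funM => //; exact: measurableT_comp.
  move=> t _; rewrite !abse_EFin lee_fin [leLHS]ger0_norm ?mulr_ge0 ?nrm_ge0//; apply: le_trans (le1 t) _.
  exact: ler_norm.
split; first by move=> i; exact: (bochner_integrable p1 s_data fincoef_time_data s_cvg).
apply: bnd_le (bochner_bnd p1 s_data fincoef_time_data s_cvg ieta ietag).
rewrite ler_wpM2l//; apply: (@le_trans _ _ (\int[mu]_t (M * (g t * \1_J t)))).
  by apply: le_Rintegral => // t _; exact: le1.
rewrite RintegralZl// -mulrA ler_wpM2l// -lee_fin; apply: le_trans gJ.
by rewrite /Rintegral fineK//; exact: integrable_fin_num.
Qed.

End time_integrals.

(** * Traces and their increments *)

Lemma half_powR_lt1 (R : realType) (x : R) : 0 < x -> 2^-1 `^ x < 1.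
Proof.
move=> x0; apply: (@lt_le_trans _ _ (1 `^ x)); last by rewrite powR1.
by apply: gt0_ltr_powR; rewrite ?nnegrE ?invr_ge0// invf_lt1 ?ltr1n.
Qed.

Section traces.
Context {R : realType} {n : nat}.
Local Notation mu := (@lebesgue_measure R).
Local Notation seqn := ('rV[int]_n * bool -> R).
Variables (s p beta T m : R) (u w : R -> functional R n).
Hypotheses (s0 : 0 < s) (s1 : s <= 1) (p1 : 1 < p).
Hypotheses (sp_beta : s / p < beta) (beta_s : beta < s).
Hypothesis u_calH : calH_space s T m p u.
Hypothesis w_trace : continuous_representative s T m p u w.
Variable K : R.
Hypothesis K0 : 0 < K.
Hypothesis stepK : forall x, `|((@smooth_step R)^`())%classic x| <= K.

Let v := dt s T m p u.
Let U := fine (bochner_norm T m p u).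
Let V := fine (bochner_norm T (m - 2 * s) p v).

Let uB : bochner_space T m p u. Proof. by have [] := u_calH. Qed.

Let vP : bochner_space T (m - 2 * s) p v /\ is_time_derivative T u v.
Proof.
have [_ [v0 v0B v0d]] := u_calH.
exact: (@xgetPex _ _ [set v | bochner_space T (m - 2 * s) p v /\ is_time_derivative T u v]
  (ex_intro _ v0 (conj v0B v0d))).
Qed.

Let p0 : 0 < p. Proof. exact: lt_trans p1. Qed.

Lemma calH_normE : calH_norm s T m p u = (U + V)%:E.
Proof.
have [_ hu] := uB; have [[_ hv] _] := vP.
by rewrite /calH_norm EFinD /U /V !fineK// ge0_fin_numE//; exact: poweR_ge0.
Qed.

Let UV0 : 0 <= U /\ 0 <= V.
Proof. by split; apply: fine_ge0; exact: poweR_ge0. Qed.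

Lemma part_Cintegral b (D : set (measurableTypeR R)) (f : R -> R[i]) :
  part b (Cintegral mu D f) = \int[mu]_(t in D) part b (f t).
Proof. by case: b. Qed.

Variable b : bool.

(** The distributional derivative is tested against the monomial of index [i]; the factor
    compensates for the difference 2 s between the orders in which [u] and [v] are measured. *)
Lemma integral_derivative_data (eta : R -> R) i : time_test_function T eta ->
  mu.-integrable setT (EFin \o (fun t => (eta^`())%classic t * time_data T m b u t i)) ->
  mu.-integrable setT (EFin \o (fun t => eta t * time_data T (m - 2 * s) b v t i)) ->
  \int[mu]_t ((eta^`())%classic t * time_data T m b u t i) =
  - (bes i `^ s * \int[mu]_t (eta t * time_data T (m - 2 * s) b v t i)).
Proof.
move=> heta int1 int2; have [_ hv] := vP.
have := congr1 (part b) (hv eta (trig i) heta (test_function_trig i)).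
rewrite partN !part_Cintegral => h.
have E (m' : R) (e : R -> R) (f : R -> functional R n) :
    mu.-integrable setT (EFin \o (fun t => e t * time_data T m' b f t i)) ->
    \int[mu]_t (e t * time_data T m' b f t i) = bes i `^ (m' / 2) *
    \int[mu]_(t in `]0, T[) part b ((e t)%:C%C * f t (trig i)).
  move=> inte; have c0 : bes i `^ (m' / 2) != 0 by rewrite gt_eqF// powR_gt0// bes_gt0.
  apply: (mulfI (invr_neq0 c0)); rewrite mulKf// -RintegralZl//.
  rewrite [RHS]Rintegral_mkcond; apply: eq_Rintegral => t _; rewrite patchE /time_data indicE.
  case: (t \in _); last by rewrite mul0r !mulr0.
  by rewrite part_real mul1r /bdata mulrCA mulKf.
rewrite !E// h mulrN; congr (- _); rewrite mulrA -gt0_powRD ?bes_gt0//.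
by congr (_ `^ _ * _); field.
Qed.

Definition mean (a l : R) : seqn :=
  fun i => \int[mu]_t (bump a l t * time_data T m b u t i).

Let measurable_bump a l : measurable_fun [set: measurableTypeR R] (bump a l : measurableTypeR R -> R).
Proof. by apply: continuous_measurable_fun; exact: continuous_bump. Qed.

Lemma bnd_mean a l : 0 < l ->
  (forall i, mu.-integrable setT (EFin \o (fun t => bump a l t * time_data T m b u t i))) /\
  bnd p (mean a l) (2 * (K / l * l `^ (1 - p^-1) * U)).
Proof.
move=> l0; apply: (bnd_time_integral p1 uB b (ltW l0)).
- by rewrite divr_ge0// ltW.
- exact: measurable_bump.
- by move=> t; exact: bump_le.
Qed.

(** The position of the half interval is left free, because [bnd_trace] lets it shrink to either end
    point. *)
Lemma bnd_mean_step a a' l : 0 < l -> 0 <= a -> a + l <= T -> a <= a' -> a' + l / 2 <= a + l ->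
  bnd p (fun i => bes i `^ (- beta) * (mean a' (l / 2) i - mean a l i))
    ((4 + 24 * K) * (U + V) * l `^ (beta / s - p^-1)).
Proof.
move=> l0 a0 alT aa' a'l; have [U0 V0] := UV0.
have l20 : 0 < l / 2 by rewrite divr_gt0.
pose eta (t : R) := cutoff a' (l / 2) t - cutoff a l t.
pose X := l `^ (1 - p^-1).
have X0 : 0 <= X by exact: powR_ge0.
have heta : time_test_function T eta by exact: cutoff_test_function.
have [vB _] := vP.
have [intv bndv] := @bnd_time_integral _ _ _ p1 _ _ _ vB b eta 1 a l (ltW l0) ler01
  (measurable_funB (measurable_cutoff a' (l / 2)) (measurable_cutoff a l))
  (fun t => cutoffB_le t l0 aa' a'l).
have [int1 bnd1] := bnd_mean a l0; have [int2 bnd2] := bnd_mean a' l20.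
pose D i := mean a' (l / 2) i - mean a l i.
have De i : D i = - (bes i `^ s * \int[mu]_t (eta t * time_data T (m - 2 * s) b v t i)).
  have E : (fun t => (eta^`())%classic t * time_data T m b u t i) =
      (fun t => bump a' (l / 2) t * time_data T m b u t i - bump a l t * time_data T m b u t i).
    by apply/funext => t; rewrite derive1_cutoffB mulrBl.
  rewrite -integral_derivative_data//; last first.
    by rewrite E; exact: (integrableB measurableT (int2 i) (int1 i)).
  by rewrite E RintegralB.
have hA : bnd p (fun i => bes i `^ (- s) * D i) (2 * (X * V)).
  have := bndZ p1 (-1) bndv; rewrite normrN normr1 !mul1r; apply: bnd_ext => i.
  by rewrite De mulN1r mulrN mulrA -gt0_powRD ?bes_gt0// addNr powRr0 mul1r.
(* 6 = 2 + 2 * 2: halving the interval doubles the bound K / l of the weight, while the power of the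
   length does not increase. *)
have hD : bnd p D (6 * (K / l * X * U)).
  apply: bnd_ext (bnd_le _ (bndD p1 bnd2 (bndZ p1 (-1) bnd1))) => [i|].
    by rewrite mulN1r.
  rewrite normrN normr1 mul1r.
  have h : (l / 2) `^ (1 - p^-1) <= X.
    rewrite ge0_ler_powR ?nnegrE ?(ltW l0) ?(ltW l20)//; last by lra.
    by rewrite subr_ge0 invf_le1// ltW.
  have h2 : K / (l / 2) * (l / 2) `^ (1 - p^-1) * U <= 2 * (K / l * X * U).
    rewrite (_ : K / (l / 2) = 2 * (K / l)); last by field; rewrite gt_eqF.
    rewrite -!mulrA ler_wpM2l// ler_wpM2l ?(ltW K0)// ler_wpM2l ?invr_ge0 ?(ltW l0)//.
    by rewrite ler_wpM2r.
  rewrite -/X; lra.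
pose rho := l `^ (s^-1).
have rho0 : 0 < rho by rewrite powR_gt0.
have hB : bnd p (fun i => (rho * bes i) `^ s * (bes i `^ (- s) * D i)) (6 * (K * X * U)).
  have := bndZ p1 l hD; rewrite ger0_norm ?(ltW l0)// => h.
  apply: bnd_ext (bnd_le _ h) => [i|].
    rewrite powRM ?(ltW rho0) ?(ltW (bes_gt0 _))// -powRrM mulVf ?gt_eqF// powRr1 ?(ltW l0)//.
    by rewrite -mulrA; congr (_ * _); rewrite mulrA -gt0_powRD ?bes_gt0// subrr powRr0 mul1r.
  by rewrite le_eqVlt; apply/orP; left; apply/eqP; field; rewrite gt_eqF.
(* The bound obtained is 2 (2 X V + 2 (6 K X U)), whence the constant 4 + 24 K. The factor rho^(s -
   beta) = l^(1 - beta/s) is divided out afterwards. *)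
have := bnd_moment p1 rho0 (s := s) (g := s - beta) _ _ hA hB.
have beta0 : 0 < beta by apply: lt_trans sp_beta; rewrite divr_gt0.
rewrite s0 s1 subr_ge0 (ltW beta_s)/= lerBlDr lerDl (ltW beta0) => /(_ isT isT) h.
have := bndZ p1 (l `^ (beta / s - 1)) h.
rewrite ger0_norm ?powR_ge0// => h2; apply: bnd_ext (bnd_le _ h2) => [i|].
  rewrite powRM ?(ltW rho0) ?(ltW (bes_gt0 _))// -powRrM -!mulrA mulrA -gt0_powRD//.
  rewrite (_ : beta / s - 1 + s^-1 * (s - beta) = 0); last by field; rewrite gt_eqF.
  rewrite powRr0 mul1r mulrA -gt0_powRD ?bes_gt0//; congr (_ `^ _ * _); ring.
rewrite (_ : beta / s - p^-1 = (beta / s - 1) + (1 - p^-1)); last by ring.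
rewrite [l `^ (beta / s - 1 + _)]gt0_powRD// -/X; move: (l `^ _) (powR_ge0 l (beta / s - 1)) => Y Y0.
rewrite [leRHS](_ : _ = Y * ((4 + 24 * K) * (U + V) * X)); last by ring.
rewrite ler_wpM2l//.
have : 0 <= X * (4 * U + 24 * K * V) by rewrite mulr_ge0// addr_ge0// mulr_ge0// mulr_ge0// ltW.
lra.
Qed.

(** Convergence is claimed for one coefficient at a time. Continuity of [w] in the weak space of
    order m - 2 s is then enough, since passing to order m costs a factor fixed with [i]. *)
Lemma mean_near_trace t i e : t \in `[0, T] -> 0 < e ->
  exists2 r, 0 < r & forall a l, 0 < l -> l < r -> 0 <= a -> a + l <= T -> a <= t -> t <= a + l ->
    `|bdata m (w t) b i - mean a l i| <= e.
Proof.
move=> t0 e0; have [aew wB wcont] := w_trace.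
have bs0 : 0 < bes i `^ s :> R by rewrite powR_gt0// bes_gt0.
(* Chosen so that the weight, at most K / l over a length l, and the change of order together give
   back exactly e. *)
pose e' := e / (K * bes i `^ s).
have e'0 : 0 < e' by rewrite divr_gt0// mulr_gt0.
have e'00 : (0 < e'%:E)%E by rewrite lte_fin.
have /nbhs_ballP[r /= r0 hr] := wcont t t0 _ (open_ereal_lt' e'00).
exists r => // a l l0 lr a0 alT at_ tal.
have [int1 _] := bnd_mean a l0.
pose W := bdata m (w t) b i.
have intW : mu.-integrable setT (EFin \o (fun t' : measurableTypeR R => bump a l t' * W)).
  exact: (integrableZr measurableT W (integrable_bump a l0)).
pose h t' := bump a l t' * W - bump a l t' * time_data T m b u t' i.
have inth : mu.-integrable setT (EFin \o h) by exact: (integrableB measurableT intW (int1 i)).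
have -> : W - mean a l i = \int[mu]_t' h t'.
  by rewrite RintegralB// RintegralZr ?Rintegral_bump ?mul1r//; exact: integrable_bump.
pose B := bes i `^ s * e'.
pose J : set (measurableTypeR R) := `[a, a + l]%classic.
have mJ : measurable J by exact: measurable_itv.
have B0 : 0 < B by rewrite mulr_gt0.
have J0 (x : measurableTypeR R) : 0 <= K / l * B * \1_J x.
  by apply: mulr_ge0 => //; apply: mulr_ge0; [exact: ltW (divr_gt0 K0 l0)|exact: ltW].
have hle : {ae mu, forall t', setT t' -> (`|h t'|%:E <= (K / l * B * \1_J t')%:E)%E}.
  apply: (@filterS _ _ (ae_filter_ringOfSetsType mu) _ _ _ aew) => t' ht' _; rewrite lee_fin.
  have [hb|hb] := boolP ((t' < a + l / 4) || (a + 3 / 4 * l < t')).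
    by rewrite /h bump0// !mul0r subrr normr0; exact: J0.
  (* Where the weight does not vanish, t' lies in the open interval ]0, T[, even if a = 0 or a + l =
     T; there [w] and [u] agree almost everywhere. *)
  move: hb; rewrite negb_or -!leNgt => /andP[hb1 hb2].
  have t'T : t' \in `]0, T[ by rewrite in_itv/=; apply/andP; split; lra.
  have t'T' : t' \in `[0, T] by rewrite in_itv/=; apply/andP; split; lra.
  have tt' : ball t r t' by rewrite /ball/= ltr_norml; apply/andP; split; lra.
  have hn := hr t' tt' t'T'.
  rewrite /h -mulrBr normrM [X in _ <= X]mulrAC; apply: ler_pM => //.
    exact: bump_le.
  rewrite /time_data indicE mem_set//= mul1r /bdata -(ht' t'T (trig i) (test_function_trig i)).
  rewrite -/(bdata m (w t') b i) /W distrC -bdataB (bdata_shift (m - 2 * s)).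
  rewrite (_ : (m - (m - 2 * s)) / 2 = s); last by field.
  rewrite normrM ger0_norm ?powR_ge0// ler_wpM2l ?powR_ge0//.
  have pw : parity (w t' - w t).
    by apply: parityB; apply: parity_distribution; [have [] := wB _ t'T'|have [] := wB _ t0].
  apply: le_trans (le_coef_nrm p1 i (fincoef_bessel p1 b pw (lt_trans hn (ltry _)))) _.
  by rewrite -lee_fin; apply: le_trans (nrm_le_bessel_norm p1 _ b pw) (ltW hn).
apply: le_trans (le_normr_Rintegral measurableT inth) _.
have iJ : mu.-integrable setT (EFin \o (fun t' : measurableTypeR R => K / l * B * \1_J t')).
  exact: (integrableZl measurableT (K / l * B) (integrable_indic_itv a (a + l) true false)).
have mh : measurable_fun [set: measurableTypeR R] (h : measurableTypeR R -> R).
  by case/integrableP : inth => /measurable_EFinP.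
have H : (\int[mu]_t' `|h t'|%:E <= \int[mu]_t' (K / l * B * \1_J t')%:E)%E.
  apply: ae_ge0_le_integral => //.
  - by apply/measurable_EFinP; exact: (measurableT_comp _ mh).
  - by move=> x _; rewrite lee_fin; exact: J0.
  - by case/integrableP : iJ.
have inth' : mu.-integrable setT (EFin \o (fun t' => `|h t'|)) by exact: (integrable_norm inth).
rewrite -lee_fin /Rintegral fineK; last exact: integrable_fin_num.
apply: le_trans H _.
under eq_integral do rewrite EFinM.
rewrite integralZl//; last exact: (integrable_indic_itv a (a + l) true false).
rewrite integral_indic// setIT /= lebesgue_measure_itv/= lte_fin ltrDl l0 -EFinB -EFinM lee_fin.
rewrite addrAC subrr add0r le_eqVlt; apply/orP; left; apply/eqP; rewrite /B /e'.
by field; rewrite !gt_eqF.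
Qed.


Let theta := beta / s - p^-1.

Let theta0 : 0 < theta.
Proof. by rewrite subr_gt0 ltr_pdivlMr// mulrC. Qed.

Let q := (2^-1 : R) `^ theta.

Let q1 : q < 1.
Proof.
exact: half_powR_lt1.
Qed.

(* [al + c * del] is approximated by averages over the intervals of length
   [del / 2^k] that divide it in the same proportion; [c = 0] and [c = 1] give
   the two end points, with the same initial average. *)
Lemma bnd_trace al del c : 0 <= al -> 0 < del -> al + del <= T -> 0 <= c <= 1 ->
  bnd p (fun i => bes i `^ (- beta) * (bdata m (w (al + c * del)) b i - mean al del i))
    ((4 + 24 * K) * (U + V) * del `^ theta / (1 - q)).
Proof.
move=> al0 del0 alT /andP[c0 c1].
have [U0 V0] := UV0.
pose l k := del * 2^-1 ^+ k; pose a k := al + c * (del - l k).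
have lS k : l k.+1 = l k / 2 by rewrite /l exprSr mulrA.
have l_gt0 k : 0 < l k by rewrite mulr_gt0// exprn_gt0// invr_gt0.
have l_le k : l k <= del.
  elim: k => [|k IH]; first by rewrite /l expr0 mulr1.
  by rewrite lS; have := l_gt0 k; lra.
have a_ge0 k : 0 <= a k by rewrite addr_ge0// mulr_ge0// subr_ge0.
have at_le k : al + c * del - a k = c * l k by rewrite /a; ring.
have a_le k : a k + l k <= al + del.
  have : 0 <= (1 - c) * (del - l k) by rewrite mulr_ge0 ?subr_ge0.
  by rewrite /a; lra.
have aS k : a k.+1 = a k + c * (l k / 2) by rewrite /a lS; field.
have stepP k a' : a k <= a' -> _ := @bnd_mean_step _ a' _ (l_gt0 k) (a_ge0 k) (le_trans (a_le k) alT).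
have hstep k : bnd p
    (fun i => bes i `^ (- beta) * (mean (a k.+1) (l k.+1) i - mean (a k) (l k) i))
    ((4 + 24 * K) * (U + V) * del `^ theta * q ^+ k).
  have := stepP k (a k.+1); rewrite lS aS => h.
  have := h _ _; rewrite (_ : l k `^ (beta / s - p^-1) = del `^ theta * q ^+ k).
    rewrite -(mulrA _ (del `^ theta)); apply.
      by rewrite lerDl mulr_ge0// divr_ge0// ltW.
    rewrite -addrA lerD2l; have : 0 <= (1 - c) * l k by rewrite mulr_ge0 ?subr_ge0// ltW.
    by lra.
  rewrite -/theta /l powRM ?(ltW del0) ?exprn_ge0 ?invr_ge0//; congr (_ * _).
  have h2 : 0 <= 2^-1 :> R by rewrite invr_ge0.
  by rewrite -(powR_mulrn k h2) -(powR_mulrn k (powR_ge0 _ _)) -!powRrM mulrC.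
apply: (bnd_series p1 hstep).
- move=> k; rewrite -mulr_sumr ler_wpM2l//.
    by rewrite !mulr_ge0 ?powR_ge0// addr_ge0// mulr_ge0// ltW.
  have q0 : 0 <= q by exact: powR_ge0.
  have -> : \sum_(j < k) q ^+ j = (1 - q ^+ k) / (1 - q).
    elim: k => [|k IH]; first by rewrite big_ord0 expr0 subrr mul0r.
    by rewrite big_ord_recr/= IH exprS; field; rewrite subr_eq0 eq_sym lt_eqF.
  rewrite ler_pdivrMr ?subr_gt0// mulVf ?subr_eq0 ?gt_eqF//.
  by rewrite lerBlDr lerDl exprn_ge0.
- move=> i; set t := al + c * del.
  have E k : \sum_(j < k) bes i `^ (- beta) * (mean (a j.+1) (l j.+1) i - mean (a j) (l j) i) =
      bes i `^ (- beta) * (mean (a k) (l k) i - mean al del i).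
    elim: k => [|k IH].
      have -> : l 0 = del by rewrite /l expr0 mulr1.
      have -> : a 0 = al by rewrite /a /l expr0 mulr1 (subrr del) mulr0 addr0.
      by rewrite big_ord0 (subrr (mean al del i)) mulr0.
    rewrite big_ord_recr/= IH.
    by move: (mean _ _ i) (mean _ _ i) (mean _ _ i) => x y z; ring.
  under eq_cvg do rewrite E.
  apply: cvgMr; apply: cvgB; last exact: cvg_cst.
  apply/cvgrPdist_le => e e0.
  have tT : t \in `[0, T].
    have cd : c * del <= 1 * del by rewrite ler_wpM2r// ltW.
    rewrite in_itv/= addr_ge0 ?mulr_ge0 ?(ltW del0)//=; rewrite /t; lra.
  have [r r0 hr] := mean_near_trace i tT e0.
  have l_cvg : l k @[k --> \oo] --> (0 : R).
    rewrite -[X in _ --> X](mulr0 del); apply: cvgMr; apply: cvg_expr.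
    by rewrite ger0_norm ?invr_ge0// invf_lt1 ?ltr1n.
  have r20 : 0 < r / 2 by rewrite divr_gt0.
  move/cvgrPdist_le : l_cvg => /(_ _ r20); apply: filterS => k.
  rewrite sub0r normrN ger0_norm ?(ltW (l_gt0 k))// => lr.
  apply: hr => //.
  + by lra.
  + exact: le_trans (a_le k) alT.
  + by rewrite -subr_ge0 at_le mulr_ge0// ltW.
  + by rewrite -lerBlDl at_le ler_piMl// ltW.
Qed.

(** The average over the whole interval cancels between the two end points; each of them contributes
    one geometric series of ratio q, whence 2 / (1 - q). *)
Lemma bnd_increment t tau : t \in `[0, T] -> tau \in `[0, T] ->
  bnd p (bdata (m - 2 * beta) (w t - w tau) b)
    (2 * ((4 + 24 * K) / (1 - q)) * (U + V) * `|t - tau| `^ theta).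
Proof.
have [U0 V0] := UV0.
have C0 : 0 <= 2 * ((4 + 24 * K) / (1 - q)) * (U + V).
  rewrite !mulr_ge0 ?addr_ge0 ?invr_ge0 ?subr_ge0 ?(ltW q1)// mulr_ge0// ltW//.
have E (x : functional R n) i : bdata (m - 2 * beta) x b i = bes i `^ (- beta) * bdata m x b i.
  by rewrite (bdata_shift m); congr (_ `^ _ * _); field.
have H t' tau' : t' < tau' -> t' \in `[0, T] -> tau' \in `[0, T] ->
    bnd p (bdata (m - 2 * beta) (w t' - w tau') b)
    (2 * ((4 + 24 * K) / (1 - q)) * (U + V) * `|t' - tau'| `^ theta).
  rewrite !in_itv/= => lt_tt' /andP[h1 h2] /andP[h3 h4].
  have del0 : 0 < tau' - t' by rewrite subr_gt0.
  have dT : t' + (tau' - t') <= T by rewrite addrC subrK.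
  have c0 : 0 <= (0 : R) <= 1 by rewrite lexx ler01.
  have c1 : 0 <= (1 : R) <= 1 by rewrite lexx ler01.
  have := bnd_trace h1 del0 dT c1; have := bnd_trace h1 del0 dT c0.
  rewrite mul0r addr0 mul1r (addrC t') subrK => k1 k2.
  have := bndD p1 k1 (bndZ p1 (-1) k2); rewrite normrN normr1 mul1r => k3.
  apply: bnd_ext (bnd_le _ k3) => [i|]; first by rewrite E bdataB; ring.
  rewrite ltr0_norm ?subr_lt0// opprB le_eqVlt; apply/orP; left; apply/eqP.
  by move: ((tau' - t') `^ theta) (4 + 24 * K) (U + V) (1 - q)^-1 => x1 x2 x3 x4; ring.
move=> ht htau; have [tt|tt|->] := ltgtP t tau.
- exact: H.
- rewrite distrC; have := bndZ p1 (-1) (H _ _ tt htau ht); rewrite normrN normr1 mul1r.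
  by apply: bnd_ext => i; rewrite !bdataB; ring.
- apply: bnd_ext (bnd_le _ (bnd0 p1)) => [i|]; first by rewrite bdataB subrr.
  by rewrite mulr_ge0// powR_ge0.
Qed.

End traces.

(** * The Hoelder estimate *)

Theorem theorem2p6 (R : realType) (d : nat) (s eps p beta : R) :
  (0 < d)%N -> 0 < s -> s <= 1 -> 0 < eps -> 1 < p ->
  s / p < beta -> beta < s ->
  exists C : R -> R,
    [/\ forall T, 0 < T -> 0 < C T,
        forall T0, exists M, forall T, 0 < T -> T <= T0 -> C T <= M &
        forall (T mu : R) (u w : R -> functional R d), 0 < T ->
          calH_space s T mu p u ->
          continuous_representative s T mu p u w ->
          bessel_space (mu - 2 * s / p + eps) p (w 0) ->
          [/\ holder_space (beta / s - p^-1) T (mu - 2 * beta) p w,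
              forall t tau, t \in `[0, T] -> tau \in `[0, T] ->
                (bessel_norm (mu - 2 * beta)%R p (w t - w tau)%R `^ p <=
                 (C T * `|t - tau| `^ (beta / s * p - 1))%R%:E *
                 (calH_norm s T mu p u `^ p +
                  bessel_norm (mu - 2 * s / p + eps)%R p (w 0%R) `^ p))%E &
              (holder_norm (beta / s - p^-1)%R T (mu - 2 * beta)%R p w <=
               (C T)%:E * (calH_norm s T mu p u +
                 bessel_norm (mu - 2 * s / p + eps)%R p (w 0%R)))%E]].
Proof.
move=> _ s0 s1 eps0 p1 sp_beta beta_s.
have p0 : 0 < p by exact: lt_trans p1.
have [K K0 stepK] := @derive_smooth_step_bounded R.
pose theta := beta / s - p^-1.
have theta0 : 0 < theta by rewrite subr_gt0 ltr_pdivlMr// mulrC.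
(* The constant of [bnd_increment] is hidden behind a variable, which keeps the later arithmetic
   polynomial in B. *)
have [B B0 BE] : exists2 B, 0 <= B & B = 2 * ((4 + 24 * K) / (1 - 2^-1 `^ theta)).
  exists (2 * ((4 + 24 * K) / (1 - 2^-1 `^ theta))) => //.
  have := half_powR_lt1 theta0; rewrite -subr_gt0 => h.
  by rewrite mulr_ge0// divr_ge0 ?(ltW h)// addr_ge0// mulr_ge0// ltW.
(* The first summand pays for the value at time 0, the second for the Hoelder quotient and for the
   passage from time 0 to t, the third for the estimate in p-th powers. The sum is nondecreasing in
   T, so [C T0] is a bound for T <= T0. *)
pose C T := 2 + 2 * B * (1 + T `^ theta) + (2 * B) `^ p.
have B20 : 0 <= 2 * B by exact: mulr_ge0.
have T_term T : 0 <= 2 * B * (1 + T `^ theta).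
  by rewrite (mulr_ge0 B20)// (addr_ge0 ler01)// powR_ge0.
have C_pos T : 0 < C T.
  by have := T_term T; have := powR_ge0 (2 * B) p; rewrite /C; lra.
exists C; split=> [T _|T0|T mu u w T0 u_calH w_trace w0B]; first exact: C_pos.
  exists (C T0) => T T_gt0 TT0; rewrite /C lerD2r lerD2l ler_wpM2l// lerD2l.
  by rewrite ge0_ler_powR ?nnegrE ?(ltW theta0) ?(ltW T_gt0)// (le_trans (ltW T_gt0)).
have [_ wB _] := w_trace.
have w_par t : t \in `[0, T] -> parity (w t).
  by move=> tT; apply: parity_distribution; have [] := wB t tT.
have par_sub t tau : t \in `[0, T] -> tau \in `[0, T] -> parity (w t - w tau).
  by move=> tT tauT; apply: parityB; exact: w_par.
have T00 : 0 \in `[0, T] by rewrite in_itv/= lexx ltW.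
have ge0_bessel m' f : parity f -> (0 <= bessel_norm m' p f :> \bar R)%E.
  move=> pf; apply: le_trans (nrm_le_bessel_norm p1 m' true pf).
  by rewrite lee_fin nrm_ge0.
have NE := calH_normE u_calH.
set N := _ + _ in NE.
have N0 : 0 <= N by rewrite addr_ge0// fine_ge0// poweR_ge0.
pose n0 := fine (bessel_norm (mu - 2 * s / p + eps) p (w 0)).
have n0E : bessel_norm (mu - 2 * s / p + eps) p (w 0) = n0%:E.
  have [_ h] := w0B; rewrite /n0 fineK// ge0_fin_numE//; apply: ge0_bessel; exact: w_par.
have n00 : 0 <= n0 by rewrite -lee_fin -n0E; apply: ge0_bessel; exact: w_par.
have incr b t tau : t \in `[0, T] -> tau \in `[0, T] ->
    bnd p (bdata (mu - 2 * beta) (w t - w tau) b) (B * N * `|t - tau| `^ theta).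
  by rewrite BE; exact: (bnd_increment s0 s1 p1 sp_beta beta_s u_calH w_trace K0 stepK).
have holder t tau : t \in `[0, T] -> tau \in `[0, T] ->
    (bessel_norm (mu - 2 * beta)%R p (w t - w tau)%R <= (2 * B * N * `|t - tau| `^ theta)%:E)%E.
  move=> tT tauT; rewrite -(mulrA 2) -mulrA; apply: bessel_norm_le => //; first exact: par_sub.
  by move=> b; exact: incr.
have sup t : t \in `[0, T] ->
    (bessel_norm (mu - 2 * beta)%R p (w t) <= (2 * n0 + 2 * B * N * T `^ theta)%:E)%E.
  move=> tT.
  rewrite (_ : 2 * n0 + _ = 2 * (n0 + B * N * T `^ theta)); last by ring.
  apply: bessel_norm_le => //; first exact: w_par.
  (* Half the gap between the orders mu - 2 s / p + eps and mu - 2 beta. It is nonnegative, so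
     lowering the order of [w 0] is a contraction by [bnd_bessel]. *)
  move=> b; pose al := beta - s / p + eps / 2.
  have al0 : 0 <= al by rewrite addr_ge0 ?divr_ge0 ?(ltW eps0)// subr_ge0 ltW.
  have h0 : bnd p (bdata (mu - 2 * s / p + eps) (w 0) b) n0.
    have [_ w0fin] := w0B.
    apply: bnd_le (bnd_nrm (fincoef_bessel p1 b (w_par _ T00) w0fin)).
    by rewrite -lee_fin -n0E; apply: nrm_le_bessel_norm => //; exact: w_par.
  have h1 := incr b t 0 tT T00.
  have h2 := bndD p1 (bnd_bessel p1 al0 h0) h1.
  apply: bnd_ext (bnd_le _ h2) => [i|].
    rewrite bdataB (bdata_shift (mu - 2 * s / p + eps) (mu - 2 * beta) (w 0)).
    rewrite (_ : (mu - 2 * beta - (mu - 2 * s / p + eps)) / 2 = - al); last first.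
      by rewrite /al; field; rewrite gt_eqF.
    by rewrite addrC subrK.
  rewrite lerD2l ler_wpM2l ?mulr_ge0// subr0.
  move: tT; rewrite in_itv/= => /andP[t0 tT].
  by rewrite ge0_ler_powR ?nnegrE ?(ltW theta0) ?(ltW T0)// ger0_norm.
have norm : (holder_norm (beta / s - p^-1)%R T (mu - 2 * beta)%R p w <=
             (C T)%:E * (calH_norm s T mu p u +
               bessel_norm (mu - 2 * s / p + eps)%R p (w 0%R)))%E.
  rewrite NE n0E -EFinD -EFinM.
  apply: (@le_trans _ _ ((2 * n0 + 2 * B * N * T `^ theta)%:E + (2 * B * N)%:E)%E).
    apply: leeD; apply: ge_ereal_sup => _ [z zT <-]; first exact: sup.
    have [z1 z2 z12] := zT.
    have D0 : 0 < `|z.1 - z.2| `^ theta by rewrite powR_gt0// normr_gt0 subr_eq0.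
    apply: le_trans (lee_wpmul2r _ (holder _ _ z1 z2)) _.
      by rewrite lee_fin invr_ge0 ltW.
    by rewrite -EFinM lee_fin mulfK// gt_eqF.
  rewrite -EFinD lee_fin -subr_ge0.
  rewrite (_ : _ - _ = 2 * N + 2 * B * (1 + T `^ theta) * n0 + (2 * B) `^ p * (N + n0)).
    have h1 : 0 <= 2 * N by exact: mulr_ge0.
    have h2 := mulr_ge0 (T_term T) n00.
    have h3 := mulr_ge0 (powR_ge0 (2 * B) p) (addr_ge0 N0 n00).
    exact: addr_ge0 (addr_ge0 h1 h2) h3.
  by rewrite /C; ring.
split=> //.
- split=> [t tT|].
    by have [wd _] := wB t tT; split=> //; exact: le_lt_trans (sup t tT) (ltry _).
  by apply: le_lt_trans norm _; rewrite NE n0E -EFinD -EFinM ltry.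
- move=> t tau tT tauT; rewrite NE n0E !poweR_EFin -EFinD -EFinM.
  have D0 := powR_ge0 `|t - tau| theta.
  apply: (@le_trans _ _ ((2 * B * N * `|t - tau| `^ theta)%:E `^ p)%E).
    apply: gt0_ler_poweR; rewrite ?in_itv/= ?leey ?andbT ?(ltW p0)//.
    + by apply: ge0_bessel; exact: par_sub.
    + by rewrite lee_fin !mulr_ge0.
    + exact: holder.
  rewrite poweR_EFin lee_fin powRM ?mulr_ge0// powRM ?mulr_ge0// -powRrM.
  rewrite (_ : theta * p = beta / s * p - 1); last by rewrite /theta; field; rewrite !gt_eqF.
  rewrite -mulrA [X in _ * X]mulrC mulrA; apply: ler_pM.
  + by rewrite mulr_ge0 ?powR_ge0.
  + exact: powR_ge0.
  + rewrite ler_wpM2r ?powR_ge0// /C lerDr.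
    by have := T_term T; lra.
  + by rewrite lerDl powR_ge0.
Qed.
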